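(* Let $K$ be a field, let $\mathbb{X}\subseteq\mathbb{P}^n_K$ be a $0$-dimensional locally Gorenstein scheme with no point of $\mathrm{Supp}(\mathbb{X})$ on the hyperplane $X_0=0$, and let $\sigma$ be a homogeneous trace map of degree zero of $Q^h(R)/L_0$. Let $\mathfrak{F}_{\widetilde R/R}$ be the conductor of $R$ in $\widetilde R$. (a) If $\mathbb{X}$ is a Cayley-Bacharach scheme, then $\mathfrak{F}_{\widetilde R/R}\subseteq\mathrm{tr}(\mathfrak{C}^\sigma_{\mathbb{X}})$. (b) The scheme $\mathbb{X}$ is a Cayley-Bacharach scheme such that $\mathfrak{F}_{\widetilde R/R}=\mathrm{tr}(\mathfrak{C}^\sigma_{\mathbb{X}})$ if and only if $\mathbb{X}$ has minimal Dedekind different.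
   Context: Setting. $P=K[X_0,\dots,X_n]$ has the standard grading, $I_{\mathbb{X}}\subseteq P$ is the (saturated) homogeneous vanishing ideal of $\mathbb{X}$, $R=P/I_{\mathbb{X}}$, and $\mathrm{Supp}(\mathbb{X})=\{p_1,\dots,p_s\}$ is the set of closed points. The residue class $x_0$ of $X_0$ in $R$ is a non-zerodivisor. $\mathcal{O}_{\mathbb{X},p_j}$ is the local ring at $p_j$, with residue field $\kappa(p_j)$; $\varkappa_j=\dim_K\kappa(p_j)$; $\deg(\mathbb{X})=\sum_j\dim_K\mathcal{O}_{\mathbb{X},p_j}$. $\mathrm{HF}_{\mathbb{X}}(i)=\dim_KR_i$, and $r_{\mathbb{X}}$ is the least integer such that $\mathrm{HF}_{\mathbb{X}}(i)=\deg(\mathbb{X})$ for all $i\ge r_{\mathbb{X}}$. $\mathbb{X}$ is locally Gorenstein if every $\mathcal{O}_{\mathbb{X},p_j}$ is a Gorenstein ring. $Q^h(R)$ is the localization of $R$ at all homogeneous non-zerodivisors; $Q^h(R)=R_{x_0}\cong\prod_{j=1}^s\mathcal{O}_{\mathbb{X},p_j}[T_j,T_j^{-1}]$ with $\deg T_j=1$, via the injection $\tilde\imath:R\to Q^h(R)$, $\tilde\imath(f)=(f_{p_1}T_1^i,\dots,f_{p_s}T_s^i)$ for $f\in R_i$, where $f_{p_j}$ is the germ of $f$ at $p_j$ (the image of $f/x_0^i$ in $\mathcal{O}_{\mathbb{X},p_j}$). Conductor. $\widetilde R=\prod_{j=1}^s\mathcal{O}_{\mathbb{X},p_j}[T_j]$,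 which contains $R$ via $\tilde\imath$, and $\mathfrak{F}_{\widetilde R/R}=\{f\in\widetilde R\mid f\widetilde R\subseteq R\}$. Complementary module, different, trace. $L_0=K[x_0,x_0^{-1}]$. A homogeneous trace map of degree zero of $Q^h(R)/L_0$ is a homogeneous element $\sigma$ of degree $0$ of the graded module $\underline{\mathrm{Hom}}_{L_0}(Q^h(R),L_0)$ which is a $Q^h(R)$-basis of it; it exists when $\mathbb{X}$ is locally Gorenstein. The Dedekind complementary module $\mathfrak{C}^\sigma_{\mathbb{X}}\subseteq Q^h(R)$ is the image of the injection $\underline{\mathrm{Hom}}_{K[x_0]}(R,K[x_0])\to\underline{\mathrm{Hom}}_{L_0}(Q^h(R),L_0)=Q^h(R)\sigma\cong Q^h(R)$, $\varphi\mapsto\varphi\otimes\mathrm{id}_{L_0}$ (the last isomorphism sending $g\sigma$ to $g$). The Dedekind different is $\delta^\sigma_{\mathbb{X}}=\{f\in Q^h(R)\mid f\cdot\mathfrak{C}^\sigma_{\mathbb{X}}\subseteq R\}$, a homogeneous ideal of $R$. $\mathbb{X}$ has minimal Dedekind different if $\delta^\sigma_{\mathbb{X}}=\bigoplus_{i\ge2r_{\mathbb{X}}}R_i$. The trace $\mathrm{tr}(\mathfrak{C}^\sigma_{\mathbb{X}})$ is the sum of the ideals $\phi(\mathfrak{C}^\sigma_{\mathbb{X}})\subseteq R$ over all $\phi\in\underline{\mathrm{Hom}}_R(\mathfrak{C}^\sigma_{\mathbb{X}},R)$; it equals $\delta^\sigma_{\mathbb{X}}\cdot\mathfrak{C}^\sigma_{\mathbb{X}}$.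 Cayley-Bacharach. A subscheme $\mathbb{Y}\subseteq\mathbb{X}$ is a $p_j$-subscheme if $\mathcal{O}_{\mathbb{Y},p_k}=\mathcal{O}_{\mathbb{X},p_k}$ for $k\ne j$ and $\mathcal{O}_{\mathbb{X},p_j}\to\mathcal{O}_{\mathbb{Y},p_j}$ is surjective; it is maximal if $\deg(\mathbb{Y})=\deg(\mathbb{X})-\varkappa_j$. Maximal $p_j$-subschemes correspond bijectively to the ideals $\langle s_j\rangle$ of $\mathcal{O}_{\mathbb{X},p_j}$ generated by a nonzero socle element $s_j$ (with $\mathcal{O}_{\mathbb{Y},p_j}=\mathcal{O}_{\mathbb{X},p_j}/\langle s_j\rangle$). For $a\in\mathcal{O}_{\mathbb{X},p_j}$ put $\mu(a)=\min\{i\in\mathbb{N}\mid(0,\dots,0,aT_j^i,0,\dots,0)\in\tilde\imath(R)\}$ (entry in position $j$). If $e_{j1},\dots,e_{j\varkappa_j}\in\mathcal{O}_{\mathbb{X},p_j}$ have residue classes forming a $K$-basis of $\kappa(p_j)$, put $\mu_{\mathbb{Y}/\mathbb{X}}=\max_k\mu(e_{jk}s_j)$ (independent of the choices). $\deg_{\mathbb{X}}(p_j)$ is the minimum of $\mu_{\mathbb{Y}/\mathbb{X}}$ over all maximal $p_j$-subschemes $\mathbb{Y}$; one has $\deg_{\mathbb{X}}(p_j)\le r_{\mathbb{X}}$. $\mathbb{X}$ is a Cayley-Bacharach scheme if $\deg_{\mathbb{X}}(p_j)=r_{\mathbb{X}}$ for all $j$. *)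

(* Defs.v *)
From HB Require Import structures.
From mathcomp Require Import all_boot all_order all_algebra.
From mathcomp Require Import generic_quotient.
From mathcomp Require Import boolp classical_sets.
From mathcomp Require Import mpoly.
From mathcomp Require Import ring.

Set Implicit Arguments.
Unset Strict Implicit.
Unset Printing Implicit Defensive.

Import GRing.Theory.

Local Open Scope ring_scope.
Local Open Scope quotient_scope.
Local Open Scope classical_set_scope.

(* The unit ideal is allowed, so quotients and localizations are only [Pz]
   rings: the coordinate ring of the empty scheme and the stalk of a subscheme
   at a point outside of it are zero. *)
Record ideal (A : comPzRingType) := Ideal {
  ideal_car :> A -> Prop;
  ideal0 : ideal_car 0;
  idealD : forall x y, ideal_car x -> ideal_car y -> ideal_car (x + y);
  idealM : forall a x, ideal_car x -> ideal_car (a * x) }.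

Section Quotient.
Variables (A : comPzRingType) (J : ideal A).

Lemma idealN x : J x -> J (- x).
Proof. by move=> Jx; rewrite -mulN1r; apply: idealM. Qed.

Definition quot_rel : rel A := fun x y => `[< J (x - y) >].

Lemma quot_rel_equiv : equiv_class_of quot_rel.
Proof.
split=> [x | x y | y x z].
- by apply/asboolP; rewrite subrr; apply: ideal0.
- by apply/asboolP/asboolP => /idealN; rewrite opprB.
- move=> /asboolP Jxy /asboolP Jyz; apply/asboolP.
  by have := idealD Jxy Jyz; rewrite addrA subrK.
Qed.

Canonical quot_rel_equivRel := EquivRelPack quot_rel_equiv.

Definition quot := {eq_quot quot_rel}.
HB.instance Definition _ := Choice.on quot.
HB.instance Definition _ := EqQuotient.on quot.

Definition quot_pi (a : A) : quot := \pi_quot a.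

Lemma quot_piE x y : (quot_pi x = quot_pi y) <-> J (x - y).
Proof.
split; first by move/eqP; rewrite -[_ == _]/(_ == _ %[mod quot]) eqmodE => /asboolP.
by move=> Jxy; apply/eqP; rewrite -[_ == _]/(_ == _ %[mod quot]) eqmodE; apply/asboolP.
Qed.

Lemma quot_reprK (x : quot) : quot_pi (repr x) = x.
Proof. exact: reprK. Qed.

Lemma quot_repr a : J (repr (quot_pi a) - a).
Proof. by apply/quot_piE; rewrite quot_reprK. Qed.

Definition quot_add (x y : quot) : quot := quot_pi (repr x + repr y).
Definition quot_opp (x : quot) : quot := quot_pi (- repr x).
Definition quot_mul (x y : quot) : quot := quot_pi (repr x * repr y).

Lemma quot_addE a b : quot_add (quot_pi a) (quot_pi b) = quot_pi (a + b).
Proof.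
by apply/quot_piE; rewrite opprD addrACA; apply: idealD; apply: quot_repr.
Qed.

Lemma quot_oppE a : quot_opp (quot_pi a) = quot_pi (- a).
Proof. by apply/quot_piE; rewrite -opprD; apply/idealN/quot_repr. Qed.

Lemma quot_mulE a b : quot_mul (quot_pi a) (quot_pi b) = quot_pi (a * b).
Proof.
apply/quot_piE; set a' := repr _; set b' := repr _.
have -> : a' * b' - a * b = b' * (a' - a) + a * (b' - b) by ring.
by apply: idealD; apply: idealM; apply: quot_repr.
Qed.

Lemma quot_ind (T : quot -> Prop) : (forall a, T (quot_pi a)) -> forall x, T x.
Proof. by move=> Ta x; rewrite -(quot_reprK x). Qed.

Lemma quot_addA : associative quot_add.
Proof.
by elim/quot_ind=> a; elim/quot_ind=> b; elim/quot_ind=> c; rewrite !quot_addE addrA.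
Qed.
Lemma quot_addC : commutative quot_add.
Proof. by elim/quot_ind=> a; elim/quot_ind=> b; rewrite !quot_addE addrC. Qed.
Lemma quot_add0 : left_id (quot_pi 0) quot_add.
Proof. by elim/quot_ind=> a; rewrite quot_addE add0r. Qed.
Lemma quot_addN : left_inverse (quot_pi 0) quot_opp quot_add.
Proof. by elim/quot_ind=> a; rewrite quot_oppE quot_addE addNr. Qed.

HB.instance Definition _ :=
  GRing.isZmodule.Build quot quot_addA quot_addC quot_add0 quot_addN.

Lemma quot_mulA : associative quot_mul.
Proof.
by elim/quot_ind=> a; elim/quot_ind=> b; elim/quot_ind=> c; rewrite !quot_mulE mulrA.
Qed.
Lemma quot_mulC : commutative quot_mul.
Proof. by elim/quot_ind=> a; elim/quot_ind=> b; rewrite !quot_mulE mulrC. Qed.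
Lemma quot_mul1 : left_id (quot_pi 1) quot_mul.
Proof. by elim/quot_ind=> a; rewrite quot_mulE mul1r. Qed.
Lemma quot_mulDl : left_distributive quot_mul +%R.
Proof.
elim/quot_ind=> a; elim/quot_ind=> b; elim/quot_ind=> c.
by rewrite /= -[X in quot_mul X]/(quot_add _ _) -[RHS]/(quot_add _ _)
   quot_addE !quot_mulE quot_addE mulrDl.
Qed.

HB.instance Definition _ :=
  GRing.Zmodule_isComPzRing.Build quot quot_mulA quot_mulC quot_mul1 quot_mulDl.

Lemma quot_piD a b : quot_pi (a + b) = quot_pi a + quot_pi b.
Proof. by rewrite -quot_addE. Qed.
Lemma quot_piN a : quot_pi (- a) = - quot_pi a.
Proof. by rewrite -quot_oppE. Qed.
Lemma quot_piM a b : quot_pi (a * b) = quot_pi a * quot_pi b.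
Proof. by rewrite -quot_mulE. Qed.
Lemma quot_pi0 : quot_pi 0 = 0. Proof. by []. Qed.
Lemma quot_pi1 : quot_pi 1 = 1. Proof. by []. Qed.

End Quotient.

(* The canonical map A/I -> A/J; well defined when I is contained in J. *)
Definition quot_map (A : comPzRingType) (I J : ideal A) (x : quot I) : quot J :=
  quot_pi J (repr x).

Record mulset (A : comPzRingType) := Mulset {
  mulset_car :> A -> Prop;
  mulset1 : mulset_car 1;
  mulsetM : forall x y, mulset_car x -> mulset_car y -> mulset_car (x * y) }.

Section Localization.
Variables (A : comPzRingType) (S : mulset A).

Definition denom := {s : A | `[< S s >]}.

Lemma denomP (s : denom) : S (val s).
Proof. by apply/asboolP; apply: (valP s). Qed.

Definition mk_denom (s : A) (Ss : S s) : denom := exist _ s (asboolT Ss).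
Definition denom1 : denom := mk_denom (mulset1 S).
Definition denomM (s t : denom) : denom :=
  mk_denom (mulsetM (denomP s) (denomP t)).

Definition loc_rel : rel (A * denom)%type := fun x y =>
  `[< exists2 u, S u & u * (x.1 * val y.2 - y.1 * val x.2) = 0 >].

Lemma loc_rel_equiv : equiv_class_of loc_rel.
Proof.
split=> [x | x y | y x z].
- by apply/asboolP; exists 1; [apply: mulset1 | rewrite subrr mulr0].
- by apply/asboolP/asboolP => -[u Su E]; exists u; rewrite // -opprB mulrN E oppr0.
- move=> /asboolP[u Su Eu] /asboolP[v Sv Ev]; apply/asboolP.
  exists (u * v * val y.2).
    by apply: mulsetM; [apply: mulsetM | apply: denomP].
  have -> : u * v * val y.2 * (x.1 * val z.2 - z.1 * val x.2) =
      v * val z.2 * (u * (x.1 * val y.2 - y.1 * val x.2)) +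
      u * val x.2 * (v * (y.1 * val z.2 - z.1 * val y.2)) by ring.
  by rewrite Eu Ev !mulr0 addr0.
Qed.

Canonical loc_rel_equivRel := EquivRelPack loc_rel_equiv.

Definition loc := {eq_quot loc_rel}.
HB.instance Definition _ := Choice.on loc.
HB.instance Definition _ := EqQuotient.on loc.

Definition loc_pi (x : A * denom) : loc := \pi_loc x.

Lemma loc_piE x y : (loc_pi x = loc_pi y) <->
  exists2 u, S u & u * (x.1 * val y.2 - y.1 * val x.2) = 0.
Proof.
split; first by move/eqP; rewrite -[_ == _]/(_ == _ %[mod loc]) eqmodE => /asboolP.
by move=> H; apply/eqP; rewrite -[_ == _]/(_ == _ %[mod loc]) eqmodE; apply/asboolP.
Qed.

Lemma loc_reprK (x : loc) : loc_pi (repr x) = x.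
Proof. exact: reprK. Qed.

Lemma loc_repr x :
  exists2 u, S u & u * ((repr (loc_pi x)).1 * val x.2
                        - x.1 * val (repr (loc_pi x)).2) = 0.
Proof. by apply/loc_piE; rewrite loc_reprK. Qed.

Definition loc_add (x y : loc) : loc :=
  let a := repr x in let b := repr y in
  loc_pi (a.1 * val b.2 + b.1 * val a.2, denomM a.2 b.2).
Definition loc_opp (x : loc) : loc := loc_pi (- (repr x).1, (repr x).2).
Definition loc_mul (x y : loc) : loc :=
  loc_pi ((repr x).1 * (repr y).1, denomM (repr x).2 (repr y).2).

Lemma loc_addE a b : loc_add (loc_pi a) (loc_pi b) =
  loc_pi (a.1 * val b.2 + b.1 * val a.2, denomM a.2 b.2).
Proof.
rewrite /loc_add; have [u Su Eu] := loc_repr a; have [v Sv Ev] := loc_repr b.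
move: (repr (loc_pi a)) (repr (loc_pi b)) Eu Ev => a' b' Eu Ev.
apply/loc_piE; exists (u * v); first exact: mulsetM.
rewrite /=.
have -> : u * v * ((a'.1 * val b'.2 + b'.1 * val a'.2) * (val a.2 * val b.2) -
    (a.1 * val b.2 + b.1 * val a.2) * (val a'.2 * val b'.2)) =
    v * val b.2 * val b'.2 * (u * (a'.1 * val a.2 - a.1 * val a'.2))
    + u * val a.2 * val a'.2 * (v * (b'.1 * val b.2 - b.1 * val b'.2)) by ring.
by rewrite Eu Ev !mulr0 addr0.
Qed.

Lemma loc_oppE a : loc_opp (loc_pi a) = loc_pi (- a.1, a.2).
Proof.
rewrite /loc_opp; have [u Su Eu] := loc_repr a.
move: (repr (loc_pi a)) Eu => a' Eu; apply/loc_piE; exists u => //=.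
have -> : u * (- a'.1 * val a.2 - - a.1 * val a'.2) =
   - (u * (a'.1 * val a.2 - a.1 * val a'.2)) by ring.
by rewrite Eu oppr0.
Qed.

Lemma loc_mulE a b : loc_mul (loc_pi a) (loc_pi b) =
  loc_pi (a.1 * b.1, denomM a.2 b.2).
Proof.
rewrite /loc_mul; have [u Su Eu] := loc_repr a; have [v Sv Ev] := loc_repr b.
move: (repr (loc_pi a)) (repr (loc_pi b)) Eu Ev => a' b' Eu Ev.
apply/loc_piE; exists (u * v); first exact: mulsetM.
rewrite /=.
have -> : u * v * (a'.1 * b'.1 * (val a.2 * val b.2) -
    a.1 * b.1 * (val a'.2 * val b'.2)) =
    v * b'.1 * val b.2 * (u * (a'.1 * val a.2 - a.1 * val a'.2))
    + u * a.1 * val a'.2 * (v * (b'.1 * val b.2 - b.1 * val b'.2)) by ring.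
by rewrite Eu Ev !mulr0 addr0.
Qed.

Lemma loc_ind (T : loc -> Prop) : (forall a, T (loc_pi a)) -> forall x, T x.
Proof. by move=> Ta x; rewrite -(loc_reprK x). Qed.

Lemma loc_eq (a b : A * denom) :
  a.1 * val b.2 = b.1 * val a.2 -> loc_pi a = loc_pi b.
Proof.
move=> E; apply/loc_piE; exists 1; first exact: mulset1.
by rewrite E subrr mulr0.
Qed.

Lemma loc_addA : associative loc_add.
Proof.
elim/loc_ind=> a; elim/loc_ind=> b; elim/loc_ind=> c; rewrite !loc_addE.
by apply: loc_eq => /=; ring.
Qed.
Lemma loc_addC : commutative loc_add.
Proof.
by elim/loc_ind=> a; elim/loc_ind=> b; rewrite !loc_addE; apply: loc_eq => /=; ring.
Qed.
Lemma loc_add0 : left_id (loc_pi (0, denom1)) loc_add.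
Proof. by elim/loc_ind=> a; rewrite loc_addE; apply: loc_eq => /=; ring. Qed.
Lemma loc_addN : left_inverse (loc_pi (0, denom1)) loc_opp loc_add.
Proof.
by elim/loc_ind=> a; rewrite loc_oppE loc_addE; apply: loc_eq => /=; ring.
Qed.

HB.instance Definition _ :=
  GRing.isZmodule.Build loc loc_addA loc_addC loc_add0 loc_addN.

Lemma loc_mulA : associative loc_mul.
Proof.
elim/loc_ind=> a; elim/loc_ind=> b; elim/loc_ind=> c; rewrite !loc_mulE.
by apply: loc_eq => /=; ring.
Qed.
Lemma loc_mulC : commutative loc_mul.
Proof.
by elim/loc_ind=> a; elim/loc_ind=> b; rewrite !loc_mulE; apply: loc_eq => /=; ring.
Qed.
Lemma loc_mul1 : left_id (loc_pi (1, denom1)) loc_mul.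
Proof. by elim/loc_ind=> a; rewrite loc_mulE; apply: loc_eq => /=; ring. Qed.
Lemma loc_mulDl : left_distributive loc_mul +%R.
Proof.
elim/loc_ind=> a; elim/loc_ind=> b; elim/loc_ind=> c.
rewrite -[X in loc_mul X]/(loc_add _ _) -[RHS]/(loc_add _ _).
by rewrite loc_addE !loc_mulE loc_addE; apply: loc_eq => /=; ring.
Qed.

HB.instance Definition _ :=
  GRing.Zmodule_isComPzRing.Build loc loc_mulA loc_mulC loc_mul1 loc_mulDl.

(* The fraction a/s. It is only meaningful for s in S; otherwise the
   denominator is replaced by 1. *)
Definition frac (a s : A) : loc := loc_pi (a, insubd denom1 s).

Lemma val_denom s : S s -> val (insubd denom1 s) = s.
Proof. by move=> Ss; rewrite insubdK //; apply/asboolP. Qed.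

Lemma frac_eq a s b t : S s -> S t ->
  (frac a s = frac b t) <-> exists2 u, S u & u * (a * t - b * s) = 0.
Proof. by move=> Ss St; rewrite loc_piE /= !val_denom. Qed.

Lemma fracD a s b t : S s -> S t ->
  frac a s + frac b t = frac (a * t + b * s) (s * t).
Proof.
move=> Ss St; rewrite -[LHS]/(loc_add _ _) loc_addE; apply: loc_eq => /=.
by rewrite !val_denom //; apply: mulsetM.
Qed.

Lemma fracN a s : S s -> - frac a s = frac (- a) s.
Proof. by move=> Ss; rewrite -[LHS]/(loc_opp _) loc_oppE. Qed.

Lemma fracM a s b t : S s -> S t -> frac a s * frac b t = frac (a * b) (s * t).
Proof.
move=> Ss St; rewrite -[LHS]/(loc_mul _ _) loc_mulE; apply: loc_eq => /=.
by rewrite !val_denom //; apply: mulsetM.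
Qed.

Lemma frac0 : frac 0 1 = 0.
Proof. by apply: loc_eq; rewrite /= !mul0r. Qed.

Lemma frac1 : frac 1 1 = 1.
Proof. by apply: loc_eq; rewrite /= val_denom //; apply: mulset1. Qed.

Lemma fracP (z : loc) : exists a s, S s /\ z = frac a s.
Proof.
elim/loc_ind: z => -[a s]; exists a, (val s); split; first exact: denomP.
by rewrite /frac valKd.
Qed.

End Localization.

(* The map induced by f on localizations; well defined when f is a ring
   homomorphism mapping S into T. *)
Definition loc_map (A B : comPzRingType) (S : mulset A) (T : mulset B)
    (f : A -> B) (z : loc S) : loc T :=
  frac T (f (repr z).1) (f (val (repr z).2)).

Section FiniteInjectiveDimension.
Variable A : comNzRingType.

Definition noetherian : Prop :=
  forall J : ideal A, exists (m : nat) (g : 'I_m -> A),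
    forall x, J x <-> exists c : 'I_m -> A, x = \sum_i c i * g i.

Definition injective_module (E : lmodType A) : Prop :=
  forall (M N : lmodType A) (i : {linear M -> N}) (f : {linear M -> E}),
    injective i -> exists g : {linear N -> E}, forall x, g (i x) = f x.

Fixpoint inj_dim_le (d : nat) (M : lmodType A) : Prop :=
  injective_module M \/
  if d isn't d'.+1 then False else
  exists (E C : lmodType A) (i : {linear M -> E}) (q : {linear E -> C}),
    [/\ injective_module E, injective i, (forall c, exists e, q e = c),
        (forall e, q e = 0 <-> exists x, e = i x) & inj_dim_le d' C].

(* The definition for a local ring: no localization is involved. *)
Definition gorenstein : Prop :=
  noetherian /\ exists d, inj_dim_le d (A^o : lmodType A).

(* In a local ring the maximal ideal consists of the non-units. *)
Definition max_ideal : set A := [set a | ~ exists b, a * b = 1].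

Definition socle : set A := [set s | forall a, max_ideal a -> a * s = 0].

End FiniteInjectiveDimension.
Arguments max_ideal A : clear implicits.
Arguments socle A : clear implicits.

(* [least P] is 0 if P is empty. *)
Definition least (P : set nat) : nat :=
  xget 0%N [set m | P m /\ forall k, P k -> (m <= k)%N].

Section Dimension.
Variables (K : fieldType) (V : lmodType K).

(* The residue classes of e form a K-basis of U/W. *)
Definition basis_mod (U W : set V) (d : nat) (e : 'I_d -> V) : Prop :=
  (forall i, U (e i)) /\
  forall v, U v -> exists! c : 'rV[K]_d, W (v - \sum_i c 0 i *: e i).

(* dim_K (U/W), or 0 if it is infinite. *)
Definition kdim (U W : set V) : nat :=
  least [set d | exists e : 'I_d -> V, basis_mod U W e].

End Dimension.

Section Proj.
Variables (K : fieldType) (n : nat).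
Local Notation P := {mpoly K[n.+1]}.

Definition homogeneous (J : ideal P) : Prop :=
  forall F d, J F -> J (pihomog mdeg d F).

(* Closed subschemes of projective n-space correspond to saturated homogeneous
   ideals; the unit ideal gives the empty scheme. *)
Record proj_scheme := ProjScheme {
  sch_ideal :> ideal P;
  sch_homog : homogeneous sch_ideal;
  sch_sat : forall F,
    (exists N, forall G, G \is N.-homog -> sch_ideal (G * F)) -> sch_ideal F }.

Record proj_point := ProjPoint {
  pt_ideal :> ideal P;
  pt_homog : homogeneous pt_ideal;
  pt_prime : forall F G, pt_ideal (F * G) -> pt_ideal F \/ pt_ideal G;
  pt_relevant : exists i, ~ pt_ideal 'X_i }.

Record supp (X : proj_scheme) := Supp {
  supp_pt :> proj_point;
  supp_sub : forall F, X F -> supp_pt F }.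

Definition zero_dim (X : proj_scheme) : Prop :=
  (exists x : supp X, True) /\
  forall x y : supp X, (forall F, x F -> y F) -> forall F, y F -> x F.

Section CoordinateRing.
Variable X : proj_scheme.

Definition coord_ring := quot X.
HB.instance Definition _ := GRing.ComPzRing.on coord_ring.

Definition cls (F : P) : coord_ring := quot_pi X F.

Definition coord_scale (k : K) (f : coord_ring) : coord_ring := cls k%:MP * f.

Lemma coord_scaleA a b f : coord_scale a (coord_scale b f) = coord_scale (a * b) f.
Proof. by rewrite /coord_scale mulrA [cls (a * b)%:MP]/cls mpolyCM quot_piM. Qed.
Lemma coord_scale1 : left_id 1 coord_scale.
Proof. by move=> f; rewrite /coord_scale /cls mpolyC1 quot_pi1 mul1r. Qed.
Lemma coord_scaleDr : right_distributive coord_scale +%R.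
Proof. by move=> k f g; rewrite /coord_scale mulrDr. Qed.
Lemma coord_scaleDl f : {morph coord_scale^~ f : a b / a + b}.
Proof. by move=> a b; rewrite /coord_scale /cls mpolyCD quot_piD mulrDl. Qed.

HB.instance Definition _ := GRing.Zmodule_isLmodule.Build K coord_ring
  coord_scaleA coord_scale1 coord_scaleDr coord_scaleDl.

Definition x0 : coord_ring := cls 'X_ord0.

Definition gr_coord (d : nat) : set coord_ring :=
  [set f | exists2 F, F \is d.-homog & f = cls F].

Definition grz_coord (d : int) : set coord_ring :=
  if d is Posz m then gr_coord m else [set 0].

Definition coord_ge (m : nat) : set coord_ring :=
  [set f | exists N (g : nat -> coord_ring),
     (forall i, gr_coord i (g i)) /\ f = \sum_(m <= i < N) g i].

Definition hilb (i : nat) : nat := kdim (gr_coord i) [set 0].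

End CoordinateRing.

Section Stalk.
Variables (Y : proj_scheme) (x : proj_point).

Definition homog_away_car (g : coord_ring Y) : Prop :=
  exists d G, [/\ G \is d.-homog, ~ x G & g = cls Y G].

Lemma homog_away1 : homog_away_car 1.
Proof.
exists 0%N, 1; split=> //; first exact: dhomog1.
have [i xi] := pt_relevant x => x1; apply: xi.
by rewrite -['X_i]mulr1; apply: idealM.
Qed.

Lemma homog_awayM g h :
  homog_away_car g -> homog_away_car h -> homog_away_car (g * h).
Proof.
move=> [d [G [hG xG ->]]] [e [H [hH xH ->]]]; exists (d + e)%N, (G * H).
split; [exact: dhomogM | by case/pt_prime | by rewrite /cls quot_piM].
Qed.

Definition homog_away : mulset (coord_ring Y) := Mulset homog_away1 homog_awayM.

(* The local ring of Y at x is the degree zero part of the homogeneous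
   localization of the coordinate ring of Y at x. *)
Definition deg0 : {pred loc homog_away} := fun z =>
  `[< exists d F G, [/\ F \is d.-homog, G \is d.-homog, ~ x G
                      & z = frac homog_away (cls Y F) (cls Y G)] >].

Lemma homog_awayP d G : G \is d.-homog -> ~ x G -> homog_away (cls Y G).
Proof. by move=> hG xG; exists d, G. Qed.

Lemma deg0_subring : subring_closed deg0.
Proof.
have x1 : ~ x 1.
  by have [i xi] := pt_relevant x => x1; apply: xi; rewrite -['X_i]mulr1; apply: idealM.
split.
- apply/asboolP; exists 0%N, 1, 1; split=> //; rewrite ?dhomog1 //.
  by rewrite [cls Y 1]quot_pi1 frac1.
- move=> _ _ /asboolP[d [F [G [hF hG xG ->]]]] /asboolP[e [F' [G' [hF' hG' xG' ->]]]].
  have sG := homog_awayP hG xG; have sG' := homog_awayP hG' xG'.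
  apply/asboolP; exists (d + e)%N, (F * G' - F' * G), (G * G'); split.
  + by apply: rpredB; [apply: dhomogM | rewrite addnC; apply: dhomogM].
  + exact: dhomogM.
  + by case/pt_prime.
  + by rewrite fracN // fracD // /cls quot_piD quot_piN !quot_piM mulNr.
- move=> _ _ /asboolP[d [F [G [hF hG xG ->]]]] /asboolP[e [F' [G' [hF' hG' xG' ->]]]].
  have sG := homog_awayP hG xG; have sG' := homog_awayP hG' xG'.
  apply/asboolP; exists (d + e)%N, (F * F'), (G * G'); split.
  + exact: dhomogM.
  + exact: dhomogM.
  + by case/pt_prime.
  + by rewrite fracM // /cls !quot_piM.
Qed.

HB.instance Definition _ :=
  GRing.isSubringClosed.Build (loc homog_away) deg0 deg0_subring.

Record stalk := Stalk { stalk_val : loc homog_away; _ : stalk_val \in deg0 }.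

HB.instance Definition _ := [isSub for stalk_val].
HB.instance Definition _ := [Choice of stalk by <:].
HB.instance Definition _ :=
  GRing.SubChoice_isSubComPzRing.Build _ _ stalk deg0_subring.

(* An element of degree zero of the localization, seen in the stalk. *)
Definition to_stalk (z : loc homog_away) : stalk := insubd 0 z.

Definition stalk_scalar (k : K) : stalk :=
  to_stalk (frac homog_away (cls Y k%:MP) 1).

Lemma stalk_scalarE k :
  val (stalk_scalar k) = frac homog_away (cls Y k%:MP) 1.
Proof.
rewrite insubdK //; apply/asboolP; exists 0%N, k%:MP, 1; split=> //.
- by rewrite -[k%:MP]mulr1 mul_mpolyC; apply/rpredZ/dhomog1.
- exact: dhomog1.
- have [i xi] := pt_relevant x => x1; apply: xi.
  by rewrite -['X_i]mulr1; apply: idealM.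
Qed.

Definition stalk_scale (k : K) (z : stalk) : stalk := stalk_scalar k * z.

Lemma stalk_scaleA a b z : stalk_scale a (stalk_scale b z) = stalk_scale (a * b) z.
Proof.
rewrite /stalk_scale mulrA; congr (_ * _); apply: val_inj; rewrite rmorphM /=.
rewrite !stalk_scalarE fracM; try exact: mulset1.
by rewrite mulr1 /cls mpolyCM quot_piM.
Qed.
Lemma stalk_scale1 : left_id 1 stalk_scale.
Proof.
move=> z; rewrite /stalk_scale [stalk_scalar 1](_ : _ = 1) ?mul1r //.
by apply: val_inj; rewrite stalk_scalarE /cls mpolyC1 quot_pi1 frac1 rmorph1.
Qed.
Lemma stalk_scaleDr : right_distributive stalk_scale +%R.
Proof. by move=> k f g; rewrite /stalk_scale mulrDr. Qed.
Lemma stalk_scaleDl z : {morph stalk_scale^~ z : a b / a + b}.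
Proof.
move=> a b; rewrite /stalk_scale -mulrDl; congr (_ * _); apply: val_inj.
rewrite rmorphD /= !stalk_scalarE fracD; try exact: mulset1.
by rewrite !mulr1 /cls mpolyCD quot_piD.
Qed.

HB.instance Definition _ := GRing.Zmodule_isLmodule.Build K stalk
  stalk_scaleA stalk_scale1 stalk_scaleDr stalk_scaleDl.

End Stalk.

(* The canonical map between the local rings at x of a scheme X and of a closed
   subscheme Y; well defined when Y is contained in X. *)
Definition stalk_map (X Y : proj_scheme) (x : proj_point) (z : stalk X x) :
    stalk Y x :=
  to_stalk (loc_map (homog_away Y x) (@quot_map _ X Y) (val z)).

(* At a point of X the stalk is nonzero. *)
Definition local_ring (X : proj_scheme) (x : supp X) := stalk X x.

Section LocalRing.
Variables (X : proj_scheme) (x : supp X).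

HB.instance Definition _ := GRing.ComPzRing.on (local_ring x).
HB.instance Definition _ := GRing.Lmodule.on (local_ring x).

Lemma local_ring_neq0 : (1 : local_ring x) != 0.
Proof.
apply/eqP => /(congr1 val); rewrite rmorph1 rmorph0 -frac1 -frac0.
case/frac_eq; [exact: mulset1 | exact: mulset1 |].
move=> _ [d [G [_ xG ->]]]; rewrite mul0r subr0 !mulr1 => /quot_piE.
by rewrite subr0 => /(@supp_sub _ x).
Qed.

HB.instance Definition _ :=
  GRing.PzSemiRing_isNonZero.Build (local_ring x) local_ring_neq0.

(* The germ f/x0^d of a homogeneous element f of degree d, for x outside of the
   hyperplane X_0 = 0. *)
Definition germ (d : nat) (f : coord_ring X) : local_ring x :=
  to_stalk (frac (homog_away X x) f (x0 X ^+ d)).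

End LocalRing.

Definition locally_gorenstein (X : proj_scheme) : Prop :=
  forall x : supp X, gorenstein (local_ring x).

Definition residue_dim (X : proj_scheme) (x : supp X) : nat :=
  kdim [set: local_ring x] (max_ideal (local_ring x)).

Section GradedHom.
Variables (S : Type) (B : set S) (U V : zmodType).
Variables (actU : S -> U -> U) (actV : S -> V -> V).
Variables (grU : int -> set U) (grV : int -> set V) (M : set U) (N : set V).

(* Hom_B(M, N) for B-submodules M of U and N of V; only the values of f on M
   matter. *)
Definition homs (f : U -> V) : Prop :=
  [/\ forall u, M u -> N (f u),
      forall u v, M u -> M v -> f (u + v) = f u + f v
    & forall b u, B b -> M u -> f (actU b u) = actV b (f u)].

Definition homs_deg (d : int) (f : U -> V) : Prop :=
  homs f /\ forall i u, M u -> grU i u -> grV (i + d) (f u).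

(* The graded module of homomorphisms is the sum of the groups of homogeneous
   homomorphisms of degree d, for all integers d. *)
Definition graded_homs (f : U -> V) : Prop :=
  exists (m : nat) (g : 'I_m -> U -> V) (d : 'I_m -> int),
    (forall k, homs_deg (d k) (g k)) /\
    forall u, M u -> f u = \sum_k g k u.

End GradedHom.

Section Dedekind.
Variable X : proj_scheme.
Local Notation R := (coord_ring X).

Definition homog_nzd_car (s : R) : Prop :=
  (exists d, gr_coord d s) /\ forall a, s * a = 0 -> a = 0.

Lemma homog_nzd1 : homog_nzd_car 1.
Proof.
by split=> [|a]; [exists 0%N, 1; [exact: dhomog1 | ] | rewrite mul1r].
Qed.

Lemma homog_nzdM s t : homog_nzd_car s -> homog_nzd_car t -> homog_nzd_car (s * t).
Proof.
move=> [[d [F hF ->]] nF] [[e [G hG ->]] nG]; split.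
  by exists (d + e)%N, (F * G); [exact: dhomogM | rewrite /cls quot_piM].
by move=> a; rewrite -mulrA => /nF/nG.
Qed.

Definition homog_nzd : mulset R := Mulset homog_nzd1 homog_nzdM.

(* Q^h(R) is the localization at all homogeneous non-zerodivisors. *)
Definition hquot := loc homog_nzd.
HB.instance Definition _ := GRing.ComPzRing.on hquot.

Definition hfrac (a s : R) : hquot := frac homog_nzd a s.
Definition inj_hquot (a : R) : hquot := hfrac a 1.

Definition gr_hquot (i : int) : set hquot :=
  [set z | exists a b f g, [/\ gr_coord a f, gr_coord b g, homog_nzd g,
                               z = hfrac f g & i = a%:Z - b%:Z]].

(* K[x0] and K[x0, 1/x0] are not types of their own, but subsets of R and of
   Q^h(R). *)
Definition Kx0 : set R :=
  [set a | exists q : {poly K}, a = \sum_(i < size q) q`_i *: x0 X ^+ i].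
Definition L0 : set hquot :=
  [set z | exists2 a, Kx0 a & exists m, z = hfrac a (x0 X ^+ m)].

Definition dual_R : set (R -> R) :=
  graded_homs Kx0 *%R *%R (@grz_coord X) (@grz_coord X) [set: R] Kx0.

Definition hom_hquot : set (hquot -> hquot) :=
  homs L0 *%R *%R [set: hquot] L0.
Definition dual_hquot : set (hquot -> hquot) :=
  graded_homs L0 *%R *%R gr_hquot gr_hquot [set: hquot] L0.

Definition trace_map (sigma : hquot -> hquot) : Prop :=
  homs_deg L0 *%R *%R gr_hquot gr_hquot [set: hquot] L0 0 sigma /\
  forall psi, dual_hquot psi ->
    exists! g : hquot, forall z, psi z = sigma (g * z).

(* psi is the map induced by phi after tensoring with L0, i.e., its unique
   L0-linear extension to Q^h(R). *)
Definition tensor_L0 (phi : R -> R) (psi : hquot -> hquot) : Prop :=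
  hom_hquot psi /\ forall a, psi (inj_hquot a) = inj_hquot (phi a).

Variable sigma : hquot -> hquot.

Definition complementary : set hquot :=
  [set g | exists2 phi, dual_R phi & tensor_L0 phi (fun z => sigma (g * z))].

Definition different : set hquot :=
  [set f | forall c, complementary c -> exists a, f * c = inj_hquot a].

(* The elements of the sum of the ideals phi(C), for phi in the graded module
   of homomorphisms Hom_R(C, R). *)
Definition trace_compl : set R :=
  [set f | exists (m : nat) (phi : 'I_m -> hquot -> R) (c : 'I_m -> hquot),
     [/\ forall k, graded_homs [set: R] (fun a z => inj_hquot a * z) *%R
                     gr_hquot (@grz_coord X) complementary [set: R] (phi k),
         forall k, complementary (c k)
       & f = \sum_k phi k (c k)]].

End Dedekind.

Section Points.
Variables (X : proj_scheme) (s : nat) (p : 'I_s -> supp X).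
Local Notation R := (coord_ring X).

(* The degree of a closed subscheme Y of X: the stalks of Y are zero at the
   points of X that do not lie on Y. *)
Definition deg_sub (Y : proj_scheme) : nat :=
  (\sum_(j < s) kdim [set: stalk Y (p j)] [set 0%R])%N.
Definition deg : nat := deg_sub X.

Definition reg_index : nat :=
  least [set m | forall i, (m <= i)%N -> hilb X i = deg].

(* Written as functions with pointwise multiplication. *)
Definition Rtilde := forall j, {poly local_ring (p j)}.

(* The representative of f is split into homogeneous components, and the
   component of degree d contributes its germ times T_j^d. *)
Definition itilde (f : R) : Rtilde := fun j =>
  \poly_(d < msize (repr f)) germ (p j) d (cls X (pihomog mdeg d (repr f))).

Definition conductor : set Rtilde :=
  [set F | forall G : Rtilde, exists f, itilde f = fun j => F j * G j].

Definition mu (j : 'I_s) (a : local_ring (p j)) : nat :=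
  least [set i | exists f : R,
    itilde f = dfwith (fun k => 0 : {poly local_ring (p k)}) (a *: 'X^i)].

Definition pj_subscheme (j : 'I_s) (Y : proj_scheme) : Prop :=
  [/\ forall F, X F -> Y F,
      forall k, k != j -> bijective (@stalk_map X Y (p k))
    & forall w, exists z, @stalk_map X Y (p j) z = w].

Definition max_pj_subscheme (j : 'I_s) (Y : proj_scheme) : Prop :=
  pj_subscheme j Y /\ (deg_sub Y + residue_dim (p j) = deg)%N.

(* m is the number mu_{Y/X}, computed from one choice of the socle element and of the
   elements e_jk; it does not depend on these choices. *)
Definition is_mu_sub (j : 'I_s) (Y : proj_scheme) (m : nat) : Prop :=
  exists (t : local_ring (p j)) (e : 'I_(residue_dim (p j)) -> local_ring (p j)),
    [/\ t != 0 /\ socle (local_ring (p j)) t,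
        forall z : local_ring (p j),
          @stalk_map X Y (p j) z = 0 <-> exists b, z = b * t,
        basis_mod [set: local_ring (p j)] (max_ideal (local_ring (p j))) e
      & m = (\max_k mu (e k * t)%R)%N].

Definition pt_deg (j : 'I_s) : nat :=
  least [set m | exists2 Y, max_pj_subscheme j Y & is_mu_sub j Y m].

Definition cayley_bacharach : Prop := forall j, pt_deg j = reg_index.

Definition minimal_different (sigma : hquot X -> hquot X) : Prop :=
  different sigma = (@inj_hquot X) @` @coord_ge X (2 * reg_index).

End Points.

End Proj.

Arguments conductor {K n X s} p _.
Arguments coord_ge {K n} X m _.
Arguments gr_coord {K n} X d _.

(* Main.v *)
(* Let A be the ring of the affine scheme X and R_d its subspace of the functions
   f/x0^d, so that R is the subring of A[T] of the polynomials whose coefficient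
   of T^d lies in R_d, and Q^h(R) = A[T, 1/T]. The trace map induces a K-linear
   form tau on A such that every linear form on A is tau(g _) for a unique g; as
   A has countable dimension, a diagonal argument shows that A is
   finite-dimensional. Hence R_d = A for d >= r, and tau is a perfect pairing.
   In degree -k the complementary module is the orthogonal of R_(k-1), in degree
   d the conductor is the largest ideal of A inside R_d, and the trace is the
   product of the different and the complementary module. By duality the socle
   of each local ring is generated by any of its nonzero elements, so that X is
   Cayley-Bacharach iff R_(r-1) contains no nonzero ideal of A, iff the
   orthogonal of R_(r-1) generates the unit ideal. In this case the conductor is
   the part of R of degree >= r, and it is contained in the product of the
   component of degree -r of the complementary module and the part of R of degree
   >= 2r, which always lies in the different. *)
From HB Require Import structures.
Require Import Defs.
From mathcomp Require Import all_boot all_algebra.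
From mathcomp Require Import boolp classical_sets.
From mathcomp Require Import mpoly.
From mathcomp Require Import ring zify.

Set Implicit Arguments.
Unset Strict Implicit.
Unset Printing Implicit Defensive.

Import GRing.Theory.

Local Open Scope ring_scope.
Local Open Scope classical_set_scope.

(** * Linear algebra *)

(** In (b) the degrees do the work. The complementary module is zero in degrees below -r. If the
    different starts in degree 2r, the trace therefore starts in degree r and lies in the conductor;
    and a nonzero ideal aA inside R_i with i < r would put a T^(2r-1) into the different.
    Conversely, let a T^d be in the different with d < 2r, and c T^(-r) in the complementary module.
    If d < r, the product vanishes; otherwise it lies in the trace, hence in the conductor, in
    degree d - r < r, and vanishes by the Cayley-Bacharach property. So a kills a set that generates
    the unit ideal, and a = 0. The obstacle is finiteness: dimension zero is only a statement about
    inclusions of points, while every count needs dim A finite. If dim A were infinite, the dual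
    would be too large to consist of forms tau(g _) with g in A. Once A is finite-dimensional, the
    ideals generated by the powers of an element stabilize, and the resulting idempotents split A
    into the local rings. *)

Lemma least_eq (P : set nat) m :
  P m -> (forall k, P k -> (m <= k)%N) -> least P = m.
Proof.
move=> Pm mP; apply: xget_unique => // k [Pk kP].
by apply/eqP; rewrite eqn_leq kP // mP.
Qed.

Lemma least_spec (P : set nat) m : P m ->
  P (least P) /\ forall k, P k -> (least P <= k)%N.
Proof.
move=> Pm; have exP : exists m, `[< P m >] by exists m; apply/asboolP.
case: (ex_minnP exP) => l /asboolP Pl ml.
by rewrite (least_eq Pl) => [|k Pk]; last (by apply/ml/asboolP); split=> // k /asboolP/ml.
Qed.

Lemma leastP (P : set nat) m : P m -> P (least P).
Proof. by case/least_spec. Qed.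

Lemma least_le (P : set nat) m : P m -> (least P <= m)%N.
Proof. by move=> Pm; apply: (least_spec Pm).2. Qed.

Section Linear.
Variables (K : fieldType) (V V' : lmodType K) (f : V -> V').
Hypothesis lf : linear f.

Definition linear_of : {linear V -> V'} :=
  HB.pack f (GRing.isLinear.Build K V V' _ f lf).

Lemma linear_sum (I : finType) (c : I -> K) (e : I -> V) :
  f (\sum_i c i *: e i) = \sum_i c i *: f (e i).
Proof.
rewrite -[f]/(linear_of : V -> V') linear_sum.
by apply: eq_bigr => i _; rewrite linearZ.
Qed.

Lemma linear_fB u v : f (u - v) = f u - f v.
Proof. exact: (linearB linear_of). Qed.

Lemma linear_f0 : f 0 = 0.
Proof. exact: (linear0 linear_of). Qed.

End Linear.

Section Subspace.
Variables (K : fieldType) (V : lmodType K).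

Definition subspace (U : set V) : Prop :=
  U 0 /\ forall a u v, U u -> U v -> U (a *: u + v).

Variable (U : set V).
Hypothesis sU : subspace U.

Lemma subspaceD u v : U u -> U v -> U (u + v).
Proof. by move=> Uu Uv; rewrite -[u]scale1r; apply: sU.2. Qed.

Lemma subspaceZ a u : U u -> U (a *: u).
Proof. by move=> Uu; rewrite -[_ *: _]addr0; apply: sU.2 => //; apply: sU.1. Qed.

Lemma subspaceB u v : U u -> U v -> U (u - v).
Proof. by move=> Uu Uv; rewrite -scaleN1r addrC; apply: sU.2. Qed.

Lemma subspace_sum (I : Type) (r : seq I) (P : pred I) (F : I -> V) :
  (forall i, P i -> U (F i)) -> U (\sum_(i <- r | P i) F i).
Proof. by move=> UF; apply: big_ind => //; [apply: sU.1 | apply: subspaceD]. Qed.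

End Subspace.

Lemma subspace0 (K : fieldType) (V : lmodType K) : subspace [set 0 : V].
Proof. by split=> //= a u v -> ->; rewrite scaler0 addr0. Qed.

Lemma subspaceT (K : fieldType) (V : lmodType K) : subspace [set: V].
Proof. by []. Qed.

(** * Dimensions of subquotients *)

Section KdimIso.
Variables (K : fieldType) (V V' : lmodType K) (f : V -> V').
Variables (U W : set V) (U' W' : set V').
Hypotheses (lf : linear f) (sU : subspace U) (sW' : subspace W').
Hypotheses (fU : forall u, U u -> U' (f u)).
Hypothesis (fW : forall u, U u -> W' (f u) <-> W u).
Hypothesis (f_onto : forall v, U' v -> exists2 u, U u & W' (v - f u)).

(** The hypotheses say that [f] induces an isomorphism from U/W to U'/W'. Having the equivalence for
    each [d] spares [kdim_iso] any finiteness assumption: the two sets to which [kdim] applies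
    [least] coincide, even when both are empty. *)
Lemma basis_mod_iso d :
  (exists e : 'I_d -> V, basis_mod U W e) <->
  (exists e : 'I_d -> V', basis_mod U' W' e).
Proof.
have U_sum (c : 'rV[K]_d) (e : 'I_d -> V) :
    (forall i, U (e i)) -> U (\sum_i c 0 i *: e i).
  by move=> Ue; apply: subspace_sum => // i _; apply: subspaceZ.
split=> [[e [Ue Be]] | [e' [Ue' Be']]].
  exists (f \o e); split=> [i | v U'v]; first exact: fU.
  have [u Uu W'vu] := f_onto U'v.
  have eqW (c : 'rV[K]_d) : W (u - \sum_i c 0 i *: e i) <-> W' (v - \sum_i c 0 i *:
    f (e i)).
    rewrite -fW; last by apply: subspaceB => //; apply: U_sum.
    rewrite linear_fB // linear_sum //.
    set t := \sum_i _; split=> W't; last first.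
      have -> : f u - t = (v - t) - (v - f u) by rewrite opprB [RHS]addrC addrA subrK.
      exact: subspaceB.
    have -> : v - t = (v - f u) + (f u - t) by rewrite addrA subrK.
    exact: subspaceD.
  have [c [Wc uc]] := Be _ Uu; exists c; split; first exact/eqW.
  by move=> c' /eqW; apply: uc.
have exe i : exists u, U u /\ W' (e' i - f u).
  by have [u Uu Wu] := f_onto (Ue' i); exists u.
have [e eP] := choice exe.
exists e; split=> [i | u Uu]; first by have [] := eP i.
have Ue i : U (e i) by have [] := eP i.
have eqW (c : 'rV[K]_d) : W (u - \sum_i c 0 i *: e i) <-> W' (f u - \sum_i c 0 i *: e' i).
  rewrite -fW; last by apply: subspaceB => //; apply: U_sum.
  rewrite linear_fB // linear_sum //.
  have W'd : W' (\sum_i c 0 i *: e' i - \sum_i c 0 i *: f (e i)).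
    rewrite -sumrB; apply: subspace_sum => // i _.
    by rewrite -scalerBr; apply: subspaceZ => //; have [] := eP i.
  set t' := \sum_i c 0 i *: e' i in W'd *; set t := \sum_i c 0 i *: f (e i) in W'd *.
  split=> W't.
    have -> : f u - t' = (f u - t) - (t' - t) by rewrite opprB addrA subrK.
    exact: subspaceB.
  have -> : f u - t = (f u - t') + (t' - t) by rewrite addrA subrK.
  exact: subspaceD.
have [c [Wc uc]] := Be' _ (fU Uu); exists c; split; first exact/eqW.
by move=> c' /eqW; apply: uc.
Qed.

Lemma kdim_iso : kdim U W = kdim U' W'.
Proof.
by congr (least _); apply/seteqP; split=> d /= /basis_mod_iso.
Qed.

End KdimIso.

Section KdimVect.
Variables (K : fieldType) (T : vectType K).

(** A space [U] inside [S] of maximal dimension is all of [S], since it stays inside [S] when a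
    vector of [S] is added to it. *)
Lemma set_vspace (S : set T) : subspace S ->
  exists U : {vspace T}, forall v, v \in U <-> S v.
Proof.
move=> sS; pose P d := `[< exists2 U : {vspace T}, \dim U = d & forall v, v \in U ->
  S v >].
have exP : exists d, P d.
  by exists 0%N; apply/asboolP; exists 0%VS; [exact: dimv0 | move=> v /[!memv0] /eqP->;
    exact: sS.1].
have Pb d : P d -> (d <= \dim {:T})%N.
  by move=> /asboolP[U <- _]; apply/dimvS/subvf.
have [d /asboolP[U dU SU] dmax] := ex_maxnP exP Pb.
exists U => v; split=> [|Sv]; first exact: SU.
have : P (\dim (U + <[v]>)%VS).
  apply/asboolP; exists (U + <[v]>)%VS => // w /memv_addP[u uU [x /vlineP[k ->] ->]].
  by rewrite addrC; apply: sS.2 => //; apply: SU.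
move/dmax; rewrite -dU => le_d.
have /eqP-> : (U == U + <[v]>)%VS by rewrite eqEdim addvSl.
by apply: (subvP (addvSr U _)); apply: memv_line.
Qed.

Lemma basis_mod_vspace (U W : {vspace T}) d : (W <= U)%VS ->
  (exists e : 'I_d -> T, basis_mod [set v | v \in U] [set v | v \in W] e) <->
  d = (\dim U - \dim W)%N.
Proof.
move=> WU; split=> [[e [Ue Be]] | ->].
  pose X := [tuple e i | i < d].
  have Xe (i : 'I_d) : X`_i = e i by rewrite -tnth_nth tnth_mktuple.
  have uniq (c c' : 'rV[K]_d) v : v \in U -> v - \sum_i c 0 i *: e i \in W ->
      v - \sum_i c' 0 i *: e i \in W -> c = c'.
    by move=> Uv Wc Wc'; have [c0 [_ uc]] := Be _ Uv; rewrite -(uc _ Wc) -(uc _ Wc').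
  have row_sum (k : 'I_d -> K) : \sum_i (\row_i k i) 0 i *: e i = \sum_i k i *: X`_i.
    by apply: eq_bigr => i _; rewrite mxE Xe.
  (* Uniqueness of coordinates is applied here to the vector 0, and below to a vector of W in the
     span, for which the zero coordinates work as well. *)
  have frX : free X.
    apply/freeP => k k0 i.
    have := uniq (\row_i k i) 0 0 (mem0v _); rewrite row_sum k0 subr0 mem0v.
    rewrite big1 => [|j _]; last by rewrite mxE scale0r.
    by rewrite subr0 mem0v => /(_ isT isT) /rowP/(_ i); rewrite !mxE.
  have XU : (<<X>> <= U)%VS.
    by apply/span_subvP => x /tnthP[i ->]; rewrite tnth_mktuple; apply: Ue.
  have capXW : (<<X>> :&: W = 0)%VS.
    apply/eqP; rewrite -subv0; apply/subvP => v /memv_capP[vX vW].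
    have vU := subvP WU _ vW.
    have Ev := coord_span vX; have := uniq (\row_i coord X i v) 0 _ vU.
    rewrite row_sum -Ev subrr mem0v big1 => [|j _]; last by rewrite mxE scale0r.
    rewrite subr0 vW => /(_ isT isT) c0; rewrite memv0 Ev big1 // => i _.
    by move/rowP/(_ i): c0; rewrite !mxE => ->; rewrite scale0r.
  have <- : (<<X>> + W)%VS = U.
    apply/eqP; rewrite eqEsubv subv_add XU WU /=; apply/subvP => v vU.
    have [c [Wc _]] := Be _ vU; rewrite -[v](subrK (\sum_i c 0 i *: e i)) addrC.
    apply: memv_add => //; apply: memv_suml => i _; apply: memvZ.
    by rewrite -Xe memv_span ?mem_nth ?size_tuple.
  by rewrite dimv_disjoint_sum // addnK (eqP frX) size_tuple.
have dE : (\dim U - \dim W)%N = \dim (U :\: W)%VS.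
  by rewrite -(dimv_cap_compl U W) (capv_idPr WU) addKn.
rewrite dE; pose X := vbasis (U :\: W)%VS; have bX := vbasisP (U :\: W)%VS.
exists (fun i => X`_i); split=> [i | v /= vU].
  by apply: (subvP (diffvSl U W)); apply: vbasis_mem; apply: mem_nth; rewrite size_tuple.
have : v \in ((U :\: W) + W)%VS by rewrite addv_diff; apply: subvP vU; apply: addvSl.
move=> /memv_addP[x xUW [w wW Ev]].
have Ex := coord_basis bX xUW.
exists (\row_i coord X i x); split.
  have /= -> : \sum_i (\row_i coord X i x) 0 i *: X`_i = x.
    by rewrite [RHS]Ex; apply: eq_bigr => i _; rewrite mxE.
  by rewrite Ev addrC addKr.
move=> c /=; set y := \sum_i _ => Wc.
have yUW : y \in (U :\: W)%VS.
  apply: memv_suml => i _; apply: memvZ; apply: vbasis_mem; apply: mem_nth.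
  by rewrite size_tuple.
have xy : x - y = 0.
  apply/eqP; rewrite -memv0 -(capv_diff U W); apply/memv_capP; split.
    exact: memvB.
  have -> : x - y = v - y - w by rewrite Ev addrAC addrK.
  exact: memvB.
apply/rowP => i; rewrite mxE.
move/subr0_eq: xy => ->; rewrite /y coord_sum_free //; exact: basis_free bX.
Qed.

Lemma kdim_vspace (U W : {vspace T}) : (W <= U)%VS ->
  kdim [set v | v \in U] [set v | v \in W] = (\dim U - \dim W)%N.
Proof.
move=> WU; apply: least_eq => [|k] /=; first exact/basis_mod_vspace.
by move/(basis_mod_vspace _ WU) ->.
Qed.

End KdimVect.

(** * Finite-dimensional spaces without a chosen basis *)

Section FiniteDimension.
Variables (K : fieldType) (V : lmodType K).

Definition findim : Prop := exists (m : nat) (g : 'I_m -> V),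
  forall v, exists c : 'I_m -> K, v = \sum_i c i *: g i.

Hypothesis fV : findim.

Let model : exists (m : nat) (f : 'rV[K]_m -> V),
  linear f /\ forall v, exists x, f x = v.
Proof.
have [m [g gP]] := fV; exists m, (fun x => \sum_i x 0 i *: g i); split.
  move=> a x y; rewrite scaler_sumr -big_split; apply: eq_bigr => i _ /=.
  by rewrite !mxE scalerDl scalerA.
move=> v; have [c ->] := gP v; exists (\row_i c i).
by apply: eq_bigr => i _; rewrite mxE.
Qed.

(** Subspaces of an [lmodType] are pulled back along a surjection from a row space, where [{vspace}]
    and [\dim] are available. *)
Lemma findim_vspace : exists (m : nat) (f : 'rV[K]_m -> V),
  [/\ linear f, forall v, exists x, f x = v
    & forall U, subspace U -> exists Uv : {vspace 'rV[K]_m}, forall x, x \in Uv <->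
      U (f x)].
Proof.
have [m [f [lf f_onto]]] := model; exists m, f; split=> // U sU.
apply: (@set_vspace K _ (fun x => U (f x))); split=> [|a x y Ux Uy].
  by rewrite (linear_f0 lf); apply: sU.1.
by rewrite lf; apply: sU.2.
Qed.

Lemma kdimD (W U T : set V) : subspace W -> subspace U -> subspace T ->
  W `<=` U -> U `<=` T -> kdim T W = (kdim T U + kdim U W)%N.
Proof.
move=> sW sU sT WU UT; have [m [f [lf f_onto mk]]] := findim_vspace.
have [Tv TvP] := mk _ sT; have [Uv UvP] := mk _ sU; have [Wv WvP] := mk _ sW.
(* The kernel of [f] lies in every preimage, so its dimension cancels in the difference. *)
have kE (A B : set V) (Av Bv : {vspace 'rV[K]_m}) :
    subspace A -> subspace B -> B `<=` A ->
    (forall x, x \in Av <-> A (f x)) -> (forall x, x \in Bv <-> B (f x)) ->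
    kdim A B = (\dim Av - \dim Bv)%N.
  move=> sA sB BA AvP BvP; rewrite -kdim_vspace; last first.
    by apply/subvP => x /BvP/BA/AvP.
  symmetry; apply: (kdim_iso lf) => //.
  - by split=> [|a u v /= Au Av']; [apply: mem0v | rewrite memvD ?memvZ].
  - by move=> u /AvP.
  - by move=> u _; rewrite -BvP.
  - move=> v Av'; have [x fx] := f_onto v; exists x; first by apply/AvP; rewrite fx.
    by rewrite fx subrr; apply: sB.1.
have WT : W `<=` T by apply: subset_trans UT.
rewrite (kE T W Tv Wv) // (kE T U Tv Uv) // (kE U W Uv Wv) //.
have dUT : (\dim Uv <= \dim Tv)%N by apply/dimvS/subvP => x /UvP/UT/TvP.
have dWU : (\dim Wv <= \dim Uv)%N by apply/dimvS/subvP => x /WvP/WU/UvP.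
by rewrite addnBA // subnK.
Qed.

Lemma kdim_basis (U W : set V) : subspace U -> subspace W -> W `<=` U ->
  exists e : 'I_(kdim U W) -> V, basis_mod U W e.
Proof.
move=> sU sW WU; have [m [f [lf f_onto mk]]] := findim_vspace.
have [Uv UvP] := mk _ sU; have [Wv WvP] := mk _ sW.
apply: (@leastP [set d | exists e : 'I_d ->
  V, basis_mod U W e] (\dim Uv - \dim Wv)) => /=.
apply/(basis_mod_iso (U := [set x | x \in Uv]) (W := [set x | x \in Wv]) lf) => //.
- by split=> [|a u v /= Au Av']; [apply: mem0v | rewrite memvD ?memvZ].
- by move=> u /UvP.
- by move=> u _; rewrite -WvP.
- move=> v Av'; have [x fx] := f_onto v; exists x; first by apply/UvP; rewrite fx.
  by rewrite fx subrr; apply: sW.1.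
- by apply/basis_mod_vspace => //; apply/subvP => x /WvP/WU/UvP.
Qed.

(** Serves as a descending chain condition: inside a subspace of smallest dimension in a family, no
    other member of the family is strictly smaller. *)
Lemma kdim_sub_eq (U T : set V) : subspace U -> subspace T -> U `<=` T ->
  (kdim T [set 0%R] <= kdim U [set 0%R])%N -> T `<=` U.
Proof.
move=> sU sT UT; have s0 := subspace0 V.
rewrite (@kdimD [set 0] U T) //; last by move=> _ ->; apply: sU.1.
rewrite -[leqRHS]add0n leq_add2r leqn0 => /eqP k0 v Tv.
have [e [_ /(_ _ Tv) [c [Uc _]]]] := kdim_basis sT sU UT.
have n0 : forall i : 'I_(kdim T U), False by rewrite k0 => -[].
by move: Uc; rewrite big1 ?subr0 // => i; case: (n0 i).
Qed.

Lemma separate (U : set V) x : subspace U -> ~ U x ->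
  exists phi : V -> K^o, [/\ linear phi, forall u, U u -> phi u = 0 & phi x = 1].
Proof.
move=> sU Ux; have [m [f [lf f_onto mk]]] := findim_vspace.
have [Uv UvP] := mk _ sU; have [y fy] := f_onto x.
have yU : y \notin Uv by apply/negP => /UvP; rewrite fy.
(* [q] is a projection that kills [Uv]; one of its coordinates that is nonzero at [y], scaled to be
   1 there, is the functional. *)
pose q z := z - projv Uv z.
have /rV0Pn[i qi] : q y != 0.
  by apply: contraNneq yU => /subr0_eq->; apply: memv_proj.
pose phi0 z : K^o := q z 0 i / q y 0 i.
have lphi0 : linear phi0.
  move=> a u v; rewrite /phi0 /q linearP !mxE scalerAl -mulrDl; congr (_ / _).
  by rewrite /GRing.scale /=; ring.
have phi0U z : z \in Uv -> phi0 z = 0.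
  by move=> zU; rewrite /phi0 /q projv_id // subrr mxE mul0r.
have phi0y : phi0 y = 1 by rewrite /phi0 mulfV.
have [g gP] := choice f_onto.
(* [phi0] vanishes on the kernel of [f], which lies in [Uv], so it descends to [V]. *)
have phi0ker u v : f u = f v -> phi0 u = phi0 v.
  move=> fuv; apply/eqP; rewrite -subr_eq0 -(linear_fB lphi0); apply/eqP/phi0U/UvP.
  by rewrite (linear_fB lf) fuv subrr; apply: sU.1.
exists (fun v => phi0 (g v)); split.
- by move=> a u v /=; rewrite -lphi0; apply: phi0ker; rewrite lf !gP.
- by move=> u Uu; apply/phi0U/UvP; rewrite gP.
- by rewrite -phi0y; apply: phi0ker; rewrite gP.
Qed.

End FiniteDimension.

Lemma findim_onto (K : fieldType) (V V' : lmodType K) (f : V -> V') :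
  linear f -> (forall v, exists u, f u = v) -> findim V -> findim V'.
Proof.
move=> lf f_onto [m [g gP]]; exists m, (f \o g) => v.
have [u <-] := f_onto v; have [c ->] := gP u; exists c.
exact: linear_sum.
Qed.

(** * Spaces of countable dimension and their duals *)

Section CountableDual.
Variables (K : fieldType) (V : lmodType K) (a : nat -> V).

Definition comb m (c : nat -> K) : V := \sum_(i < m) c i *: a i.

Lemma comb_widen m k c : (m <= k)%N -> (forall i, (m <= i)%N -> c i = 0) ->
  comb k c = comb m c.
Proof.
move=> mk c0; rewrite /comb (big_ord_widen k (fun i => c i *: a i) mk) [RHS]big_mkcond.
apply: eq_bigr => i _ /=.
by case: ltnP => // /c0->; rewrite scale0r.
Qed.

Hypothesis a_span : forall v, exists m c, v = comb m c.

(** The [a i] with [indep i] form the basis extracted greedily from the spanning sequence.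
    Coordinates in it are stored as a polynomial, that is, as a finitely supported sequence. *)
Let indep i := ~ exists c, a i = comb i c.

Let coordinates v (p : {poly K}) :=
  (forall i, ~ indep i -> p`_i = 0) /\ v = comb (size p) (fun i => p`_i).

Let combE (p : {poly K}) m : (size p <= m)%N ->
  comb (size p) (fun i => p`_i) = comb m (fun i => p`_i).
Proof. by move=> pm; rewrite (comb_widen pm) // => i; apply: nth_default. Qed.

Let coordinates_ex v : exists p, coordinates v p.
Proof.
have [m [c ->]] := a_span v; elim: m c => [|m IH] c.
  by exists 0; split=> [i _|]; rewrite ?coef0 // size_poly0 /comb !big_ord0.
rewrite /comb big_ord_recr -/(comb m c) /=.
case: (pselect (indep m)) => [mI | /contrapT[c' ac']].
  have [p [pI ->]] := IH c; exists (p + c m *: 'X^m); split.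
    move=> i iI; rewrite coefD coefZ coefXn pI // add0r.
    by case: eqP => [im|_]; rewrite ?mulr0 //; case: iI; rewrite im.
  set q := p + _; pose N := (maxn m.+1 (maxn (size p) (size q)))%N.
  have pN : (size p <= N)%N by rewrite /N !leq_max leqnn orbT.
  have qN : (size q <= N)%N by rewrite /N !leq_max leqnn !orbT.
  have mN : (m < N)%N by rewrite /N leq_max leqnn.
  rewrite (combE pN) (combE qN) /comb.
  rewrite [RHS](eq_bigr (fun i : 'I_N => p`_i *: a i + (c m * (i == m :> nat)%:R) *:
    a i)).
    rewrite big_split /=; congr (_ + _).
    rewrite (bigD1 (Ordinal mN)) //= eqxx mulr1 big1 ?addr0 // => i im.
    by rewrite (_ : (i == m :> nat) = false) ?mulr0 ?scale0r //; apply/negbTE.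
  by move=> i _; rewrite coefD coefZ coefXn scalerDl.
have -> : comb m c + c m *: a m = comb m (fun i => c i + c m * c' i).
  rewrite ac' /comb scaler_sumr -big_split.
  by apply: eq_bigr => i _ /=; rewrite scalerDl scalerA.
exact: IH.
Qed.

Let coordinates_eq0 p : coordinates 0 p -> p = 0.
Proof.
case=> pI p0; apply/eqP/negPn/negP => pn0.
have sp : size p = (size p).-1.+1 by rewrite prednK // size_poly_gt0.
have lp : lead_coef p != 0 by rewrite lead_coef_eq0.
case: (pselect (indep (size p).-1)) => [|/pI/eqP]; last exact/negP.
apply; exists (fun i => - (lead_coef p)^-1 * p`_i).
move: p0; rewrite sp /comb big_ord_recr /= -/(lead_coef p) => /esym/eqP.
rewrite addrC addr_eq0 => /eqP E.
rewrite -[LHS]scale1r -(mulVf lp) -scalerA E scalerN -scaleNr scaler_sumr.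
by apply: eq_bigr => i _; rewrite scalerA.
Qed.

Let coord_linear k u v p q : coordinates u p -> coordinates v q ->
  coordinates (k *: u + v) (k *: p + q).
Proof.
move=> [pI ->] [qI ->]; split=> [i iI|].
  by rewrite coefD coefZ pI // qI // mulr0 addr0.
pose N := (maxn (size (k *: p + q)%R) (maxn (size p) (size q)))%N.
have rN : (size (k *: p + q)%R <= N)%N by rewrite leq_max leqnn.
have pN : (size p <= N)%N by rewrite !leq_max leqnn orbT.
have qN : (size q <= N)%N by rewrite !leq_max leqnn !orbT.
rewrite (combE pN) (combE qN) (combE rN) /comb scaler_sumr -big_split.
by apply: eq_bigr => i _; rewrite /= coefD coefZ scalerDl scalerA.
Qed.

Let coord_uniq v p q : coordinates v p -> coordinates v q -> p = q.
Proof.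
move=> vp vq; have := coord_linear (-1) vp vq.
rewrite scaleN1r addNr => /coordinates_eq0; rewrite scaleN1r addrC.
by move/subr0_eq.
Qed.

Variable beta : V -> V -> K^o.
Hypothesis beta_l : forall v, linear (beta^~ v).
Hypothesis beta_onto : forall phi : V -> K^o, linear phi ->
  exists g, forall v, phi v = beta g v.

(* The block of m.+1 values of phi at the basis vectors numbered (m, 0), ...,
   (m, m) avoids the restrictions to this block of the m functionals
   beta (a i), i < m; so phi is not beta g for any g in their span. *)
Lemma findim_dual : findim V.
Proof.
apply: contrapT => infV.
have inf N : exists i, (N <= i)%N /\ indep i.
  apply: contrapT => noI; apply: infV; exists N, (fun i => a i) => v.
  have [p [pI ->]] := coordinates_ex v; exists (fun i => p`_i).
  apply: combE.
  apply/leq_sizeP => i Ni; apply: pI => iI; apply: noI; exists i => //.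
have [nx nxP] := choice inf.
(* [idx] enumerates independent indices increasingly, and [pos] uses [pickle] on pairs to reserve
   disjoint blocks of them. *)
pose idx := fix idx k := if k is l.+1 then nx (idx l).+1 else nx 0%N.
have idxI k : indep (idx k) by case: k => [|k]; apply: (nxP _).2.
have idx_lt k l : (k < l)%N -> (idx k < idx l)%N.
  elim: l => // l IH; rewrite ltnS leq_eqVlt => /predU1P[->|/IH kl].
    exact: (nxP _).1.
  by apply: ltn_trans kl _; apply: (nxP _).1.
have idx_inj : injective idx.
  by move=> k l kl; case: (ltngtP k l) => // /idx_lt; rewrite kl ltnn.
pose pos (m l : nat) := idx (pickle (m, l)).
pose M m : 'M[K]_(m, m.+1) := \matrix_(i, l) beta (a i) (a (pos m l)).
(* [M m] has m rows and m + 1 columns, so some vector escapes its row space. *)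
have exu m : exists u : 'rV[K]_m.+1, ~~ (u <= M m)%MS.
  have : ~~ row_full (M m).
    by apply/negP => /eqP rM; have := rank_leq_row (M m); rewrite rM ltnn.
  rewrite -sub1mx; case/row_subPn => i Mi; by exists (row i 1%:M).
pose u m : 'rV[K]_m.+1 := sval (cid (exu m)).
have uP m : ~~ (u m <= M m)%MS := svalP (cid (exu m)).
(* The value prescribed at [a i]: an entry of [u m] if [i] is the position of a pair (m, l);
   otherwise any value will do. *)
have exw i : exists x : K, forall k, idx k = i ->
    forall m l, unpickle k = Some (m, l) -> x = u m 0 (inord l).
  case: (pselect (exists k, idx k = i)) => [[k <-]|]; last first.
    by move=> noi; exists 0 => k ki; case: noi; exists k.
  case Ek: (unpickle k : option (nat * nat)) => [[m l]|].
    exists (u m 0 (inord l)) => k' /idx_inj->; rewrite Ek => m' l' [<- <-] //.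
  by exists 0 => k' /idx_inj->; rewrite Ek.
have [w wP] := choice exw.
have [cd cdP] := choice coordinates_ex.
pose phi v : K^o := \sum_(i < size (cd v)) (cd v)`_i * w i.
have phiE v N : (size (cd v) <= N)%N -> phi v = \sum_(i < N) (cd v)`_i * w i.
  move=> vN; rewrite /phi (big_ord_widen N (fun i => (cd v)`_i * w i) vN) big_mkcond.
  by apply: eq_bigr => i _ /=; case: ltnP => // /(nth_default 0)->; rewrite mul0r.
have phi_lin : linear phi.
  move=> k x y; have cE : cd (k *: x + y) = k *: cd x + cd y.
    by apply: (coord_uniq (cdP _)); apply: coord_linear.
  pose N := maxn (size (cd (k *: x + y))) (maxn (size (cd x)) (size (cd y))).
  have rN : (size (cd (k *: x + y)%R) <= N)%N by rewrite leq_max leqnn.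
  have pN : (size (cd x) <= N)%N by rewrite !leq_max leqnn orbT.
  have qN : (size (cd y) <= N)%N by rewrite !leq_max leqnn !orbT.
  rewrite (phiE _ _ rN) (phiE _ _ pN) (phiE _ _ qN) cE scaler_sumr -big_split.
  by apply: eq_bigr => i _ /=; rewrite coefD coefZ /GRing.scale /=; ring.
have phi_pos m (l : 'I_m.+1) : phi (a (pos m l)) = u m 0 l.
  have cE : cd (a (pos m l)) = 'X^(pos m l).
    apply: (coord_uniq (cdP _)); split=> [i iI|].
      rewrite coefXn; case: eqP => // im; case: iI; rewrite im; exact: idxI.
    rewrite size_polyXn /comb (bigD1 ord_max) //= coefXn eqxx scale1r big1 ?addr0 //.
    by move=> i im; rewrite coefXn (_ : (_ == _) = false) ?scale0r //; apply/negbTE.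
  rewrite /phi cE size_polyXn (bigD1 ord_max) //= coefXn eqxx mul1r big1 ?addr0;
    last first.
    by move=> i im; rewrite coefXn (_ : (_ == _) = false) ?mul0r //; apply/negbTE.
  by rewrite (wP _ (pickle (m, l : nat)) erefl m l) ?pickleK // inord_val.
have [g phig] := beta_onto phi_lin.
(* The length of a combination giving [g] selects the block that contradicts it. *)
have [m [c gE]] := a_span g.
case/negP: (uP m); apply/submxP; exists (\row_i c i); apply/rowP => l.
rewrite -phi_pos phig gE /comb; apply: etrans (linear_sum (beta_l _) _ _) _.
by rewrite !mxE; apply: eq_bigr => i _; rewrite !mxE.
Qed.

End CountableDual.

(** * Homogeneous ideals *)

Notation hc := (pihomog mdeg).

Section HomogeneousComponents.
Variables (K : fieldType) (n : nat).
Local Notation P := {mpoly K[n.+1]}.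
Implicit Types (F G : P).

(* The components of F as a polynomial in a grading variable, so that hpoly is
   multiplicative. *)
Definition hpoly : P -> {poly P} :=
  mmap (fun c : K => c%:MP%:P) (fun i => ('X_i)%:P * 'X).

Lemma hpolyX m : mmap1 (fun i => ('X_i)%:P * 'X) m = 'X_[m] *: 'X^(mdeg m) :> {poly P}.
Proof.
rewrite /mmap1 mdegE -prodrXr mpolyXE_id -mul_polyC rmorph_prod -big_split.
by apply: eq_bigr => i _ /=; rewrite exprMn rmorphXn.
Qed.

Lemma coef_hpoly F d : (hpoly F)`_d = hc d F.
Proof.
rewrite pihomogE [RHS]big_mkcond /hpoly /mmap coef_sum; apply: eq_bigr => m _.
rewrite hpolyX coefCM coefZ coefXn eq_sym mul_mpolyC.
by case: eqP => _; rewrite ?mulr1 ?mulr0 ?scaler0.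
Qed.

Lemma hpolyM F G : hpoly (F * G) = hpoly F * hpoly G.
Proof.
have fM : monoid_morphism (fun c : K => c%:MP%:P : {poly P}).
  by split=> [|x y]; rewrite ?mpolyC1 ?mpolyCM ?rmorphM ?rmorph1.
have fB : zmod_morphism (fun c : K => c%:MP%:P : {poly P}).
  by move=> x y; rewrite mpolyCB rmorphB.
pose f : {rmorphism K -> {poly P}} := HB.pack (fun c : K => c%:MP%:P : {poly P})
  (GRing.isZmodMorphism.Build _ _ _ fB) (GRing.isMonoidMorphism.Build _ _ _ fM).
exact: (mmap_is_multiplicative (fun i => ('X_i)%:P * 'X) f).1.
Qed.

Lemma hcM d F G : hc d (F * G) = \sum_(i < d.+1) hc i F * hc (d - i) G.
Proof.
rewrite -coef_hpoly hpolyM coefM.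
by apply: eq_bigr => i _; apply: (congr2 *%R); apply: coef_hpoly.
Qed.

Lemma hc_homog d F : hc d F \is d.-homog.
Proof. exact: pihomogP. Qed.

Lemma hcE d e F : F \is d.-homog -> hc e F = if e == d then F else 0.
Proof.
move=> hF; case: eqP => [->|/eqP ne]; first exact: pihomog_dE.
by rewrite (pihomog_ne0 _ hF) // eq_sym.
Qed.

Lemma hcMr d e F G : G \is d.-homog ->
  hc e (F * G) = if (d <= e)%N then hc (e - d) F * G else 0.
Proof.
move=> hG; rewrite hcM; case: leqP => [de|ed].
  have lt_e : (e - d < e.+1)%N by rewrite ltnS leq_subr.
  rewrite (bigD1 (Ordinal lt_e)) //= (hcE _ hG) subKn // eqxx big1 ?addr0 //.
  move=> i ie; rewrite (hcE _ hG); case: eqP => [Ed|_]; last by rewrite mulr0.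
  by case/negP: ie; apply/eqP/val_inj; rewrite /= -Ed subKn // -ltnS.
apply: big1 => i _; rewrite (hcE _ hG); case: eqP => [Ed|_]; last by rewrite mulr0.
by move: ed; rewrite -Ed ltnNge leq_subr.
Qed.

Lemma hc_large d F : (msize F <= d)%N -> hc d F = 0.
Proof.
move=> Fd; rewrite pihomogE big_seq_cond big1 // => m /andP[mF /eqP md].
by have := msize_mdeg_lt mF; rewrite md ltnNge Fd.
Qed.

Lemma hc_sum N F : (msize F <= N)%N -> F = \sum_(d < N) hc d F.
Proof. exact: pihomog_partitionE. Qed.

Lemma homog1 : (1 : P) \is 0.-homog. Proof. exact: dhomog1. Qed.

Lemma homogX0 k : ('X_ord0 ^+ k : P) \is k.-homog.
Proof.
elim: k => [|k IH]; first by rewrite expr0 homog1.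
by rewrite exprS -[k.+1]add1n; apply: dhomogM => //; rewrite dhomogX /= mdeg1.
Qed.

Lemma homogMX0 k d F : F \is d.-homog -> ('X_ord0 ^+ k * F) \is (k + d).-homog.
Proof. by move=> hF; apply: dhomogM => //; apply: homogX0. Qed.

Lemma homogC d (k : K) F : F \is d.-homog -> (k%:MP * F) \is d.-homog.
Proof. by move=> hF; rewrite mul_mpolyC; apply: rpredZ. Qed.

End HomogeneousComponents.

Section Ideals.
Variables (A : comPzRingType) (J : ideal A).

Lemma idealB x y : J x -> J y -> J (x - y).
Proof. by move=> Jx /idealN Jy; apply: idealD. Qed.

Lemma idealMr a x : J x -> J (x * a).
Proof. by rewrite mulrC; apply: idealM. Qed.

Lemma ideal_sum (I : Type) (r : seq I) (Q : pred I) (F : I -> A) :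
  (forall i, Q i -> J (F i)) -> J (\sum_(i <- r | Q i) F i).
Proof. by move=> JF; apply: big_ind => //; [apply: ideal0 | apply: idealD]. Qed.

Lemma idealBl x y : J (x - y) -> J x -> J y.
Proof. by move=> Jxy Jx; rewrite -[y](subKr x); apply: idealB. Qed.

Lemma idealBr x y : J (x - y) -> J y -> J x.
Proof. by move=> Jxy Jx; rewrite -[x](subrK y); apply: idealD. Qed.

Lemma adjoin_subproof (f : A) :
  [/\ exists j g, J j /\ 0 = j + g * f,
      forall x y, (exists j g, J j /\ x = j + g * f) ->
        (exists j g, J j /\ y = j + g * f) -> exists j g, J j /\ x + y = j + g * f
    & forall a x, (exists j g, J j /\ x = j + g * f) ->
        exists j g, J j /\ a * x = j + g * f].
Proof.
split; first by exists 0, 0; rewrite mul0r addr0; split=> //; apply: ideal0.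
- move=> _ _ [j [g [Jj ->]]] [j' [g' [Jj' ->]]]; exists (j + j'), (g + g').
  by split; [apply: idealD | rewrite mulrDl addrACA].
- move=> a _ [j [g [Jj ->]]]; exists (a * j), (a * g).
  by split; [apply: idealM | rewrite mulrDr mulrA].
Qed.

Definition adjoin (f : A) : ideal A :=
  let: And3 H0 HD HM := adjoin_subproof f in
  @Ideal A (fun x => exists j g, J j /\ x = j + g * f) H0 HD HM.

Lemma adjoinP f x : adjoin f x <-> exists j g, J j /\ x = j + g * f.
Proof. by rewrite /adjoin; case: adjoin_subproof. Qed.

Lemma sub_adjoin f x : J x -> adjoin f x.
Proof. by move=> Jx; apply/adjoinP; exists x, 0; rewrite mul0r addr0. Qed.

Lemma mem_adjoin f : adjoin f f.
Proof. by apply/adjoinP; exists 0, 1; rewrite mul1r add0r; split=> //; apply: ideal0. Qed.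

Definition colon (f : A) : ideal A.
Proof.
exists (fun x => J (x * f)).
- by rewrite mul0r; apply: ideal0.
- by move=> x y Jx Jy; rewrite mulrDl; apply: idealD.
- by move=> a x Jx; rewrite -mulrA; apply: idealM.
Defined.

Lemma sub_colon f x : J x -> colon f x.
Proof. exact: idealMr. Qed.

End Ideals.

(** * Homogeneous primes *)

Section HomogeneousIdeals.
Variables (K : fieldType) (n : nat).
Local Notation P := {mpoly K[n.+1]}.
Implicit Types (F G : P) (J q : ideal P).

Lemma homogeneous_adjoin J d F :
  homogeneous J -> F \is d.-homog -> homogeneous (adjoin J F).
Proof.
move=> hJ hF _ e /adjoinP[j [g [Jj ->]]]; apply/adjoinP.
exists (hc e j), (if (d <= e)%N then hc (e - d) g else 0); split; first exact: hJ.
by rewrite pihomogD (hcMr _ _ hF); case: ifP; rewrite ?mul0r.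
Qed.

Lemma homogeneous_colon J d F :
  homogeneous J -> F \is d.-homog -> homogeneous (colon J F).
Proof.
move=> hJ hF G e /= /(fun H => hJ _ (e + d)%N H).
by rewrite (hcMr _ _ hF) leq_addl addnK.
Qed.

Lemma hc_ideal J F : (forall d, J (hc d F)) -> J F.
Proof. by move=> JF; rewrite [F](hc_sum (leqnn _)); apply: ideal_sum. Qed.

Lemma top_component J F : ~ J F ->
  exists d, ~ J (hc d F) /\ forall e, (d < e)%N -> J (hc e F).
Proof.
move=> nJF; pose Q d := `[< ~ J (hc d F) >].
have exQ : exists d, Q d.
  apply: contrapT => nQ; apply: nJF; apply: hc_ideal => d; apply: contrapT => Jd.
  by apply: nQ; exists d; apply/asboolP.
have bQ d : Q d -> (d <= msize F)%N.
  move=> /asboolP Qd; rewrite leqNgt; apply/negP => /ltnW Fd.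
  by apply: Qd; rewrite hc_large //; apply: ideal0.
case: (ex_maxnP exQ bQ) => d /asboolP Qd dmax; exists d; split=> // e de.
apply: contrapT => Je; have := dmax e; rewrite leqNgt de => H.
by have /H : Q e by apply/asboolP.
Qed.

(** If [d] and [e] are the top degrees in which [F] and [G] have components outside [q], then modulo
    [q] the component of [F * G] of degree [d + e] is the product of these two components. *)
Lemma homogeneous_prime q : homogeneous q ->
  (forall d e F G, F \is d.-homog -> G \is e.-homog -> q (F * G) -> q F \/ q G) ->
  forall F G, q (F * G) -> q F \/ q G.
Proof.
move=> hq pq F G qFG; apply: contrapT => /not_orP[qF qG].
have [d [qFd Fd]] := top_component qF; have [e [qGe Ge]] := top_component qG.
have [] // := pq _ _ _ _ (hc_homog d F) (hc_homog e G).
have := hq _ (d + e)%N qFG; rewrite hcM.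
have lt_d : (d < (d + e).+1)%N by rewrite ltnS leq_addr.
rewrite (bigD1 (Ordinal lt_d)) //= addKn.
set S := \sum_(i < _ | _) _; move=> qS; rewrite -[X in q X](addrK S).
apply: idealB => //; apply: ideal_sum => i id.
case: (ltngtP i d) => [lt|gt|E].
- by apply/idealM/Ge; rewrite ltn_subRL ltn_add2r.
- by apply/idealMr/Fd.
- by case/negP: id; apply/eqP/val_inj.
Qed.

(** By Zorn's lemma there is a maximal one among the homogeneous ideals that contain [J] and are
    disjoint from [S]. It is prime, although [S] may contain inhomogeneous elements, because
    primality need only be tested on homogeneous ones. *)
Lemma homogeneous_prime_avoiding J (S : P -> Prop) :
  homogeneous J -> S 1 -> (forall F G, S F -> S G -> S (F * G)) ->
  (forall F, J F -> ~ S F) ->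
  exists q : ideal P, [/\ homogeneous q,
    forall F G, q (F * G) -> q F \/ q G,
    forall F, J F -> q F & forall F, q F -> ~ S F].
Proof.
move=> hJ S1 SM JS.
pose good (I : ideal P) :=
  [/\ homogeneous I, forall F, J F -> I F & forall F, I F -> ~ S F].
have gJ : good J by [].
pose T := {I : ideal P | good I}; pose t0 : T := exist _ J gJ.
pose R (s t : T) := `[< forall F, sval s F -> sval t F >].
have Rxx t : R t t by apply/asboolP.
have Rtr r s t : R r s -> R s t -> R r t.
  by move=> /asboolP rs /asboolP st; apply/asboolP => F /rs/st.
have [|[q [hq Jq qS]] qmax] := ZL_preorder t0 Rxx Rtr.
  (* The union of the chain, with [J] added so that the empty chain has a bound too. *)
  move=> C Ctot; pose U F := J F \/ exists2 t : T, C t & sval t F.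
  have UD F G : U F -> U G -> U (F + G).
    case=> [JF|[t Ct tF]] [JG|[s Cs sG]].
    - by left; apply: idealD.
    - by right; exists s => //; apply: idealD => //; have [_ + _] := svalP s; apply.
    - by right; exists t => //; apply: idealD => //; have [_ + _] := svalP t; apply.
    - case: (Ctot _ _ Ct Cs) => /asboolP sub; right.
        by exists s => //; apply: idealD => //; apply: sub.
      by exists t => //; apply: idealD => //; apply: sub.
  have UM F G : U G -> U (F * G).
    case=> [JG|[t Ct tG]]; first by left; apply: idealM.
    by right; exists t => //; apply: idealM.
  pose I := @Ideal P U (or_introl (ideal0 J)) UD UM.
  have gI : good I.
    split.
    - move=> F d [JF|[t Ct tF]]; first by left; apply: hJ.
      by right; exists t => //; have [+ _ _] := svalP t; apply.
    - by move=> F JF; left.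
    - move=> F [JF|[t Ct tF]]; first exact: JS.
      by have [_ _] := svalP t; apply.
  by exists (exist _ I gI) => s Cs; apply/asboolP => F sF; right; exists s.
exists q; split=> //; apply: homogeneous_prime => // d e F G hF hG qFG.
apply: contrapT => /not_orP[qF qG].
(* By maximality, adjoining a homogeneous element outside [q] produces an ideal that meets [S]. *)
have meet k H : H \is k.-homog -> ~ q H -> exists2 s, adjoin q H s & S s.
  move=> hH qH; apply: contrapT => noS; apply: qH.
  have gH : good (adjoin q H).
    split; first exact: homogeneous_adjoin hH.
      by move=> ? /Jq; apply: sub_adjoin.
    by move=> s qs Ss; apply: noS; exists s.
  have Rqt := qmax (exist _ _ gH); apply: (asboolP _ (Rqt _)); last exact: mem_adjoin.
  by apply/asboolP => s /=; apply: sub_adjoin.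
have [s /adjoinP[j [g [qj Es]]] Ss] := meet _ _ hF qF.
have [t /adjoinP[k [h [qk Et]]] St] := meet _ _ hG qG.
apply: (qS (s * t)); last exact: SM.
rewrite Es Et.
have -> : (j + g * F) * (k + h * G) = j * (k + h * G) + (g * F * k + g * h * (F * G)) by ring.
by apply: idealD; [apply: idealMr | apply: idealD; apply: idealM].
Qed.

End HomogeneousIdeals.

(** * The affine coordinate ring *)

(** The hypotheses are bundled with the scheme because instances on the ring A depend on them: A is
    nonzero as X has a point and avoids X_0 = 0. *)
Record aff_scheme (K : fieldType) (n : nat) := AffScheme {
  aff_sch :> proj_scheme K n;
  aff_dim : zero_dim aff_sch;
  aff_hyp : forall x : supp aff_sch, ~ x 'X_ord0 }.

Arguments aff_hyp {K n a} x _.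

Section Points.
Variables (K : fieldType) (n : nat) (X : aff_scheme K n).
Local Notation P := {mpoly K[n.+1]}.
Implicit Types (F G : P).

Lemma prime_point (q : ideal P) : homogeneous q ->
  (forall F G, q (F * G) -> q F \/ q G) -> (exists i, ~ q 'X_i) ->
  (forall F, X F -> q F) -> exists x : supp X, forall F, x F <-> q F.
Proof.
move=> hq pq rq Xq; pose x0 := ProjPoint hq pq rq.
by exists (@Supp K n X x0 Xq).
Qed.

Lemma point1 (x : supp X) : ~ x 1.
Proof. by move=> x1; apply: (aff_hyp x); rewrite -['X_ord0]mulr1; apply: idealM. Qed.

Lemma point_X0n (x : supp X) k : ~ x ('X_ord0 ^+ k).
Proof.
elim: k => [|k IH]; first by rewrite expr0; apply: point1.
by rewrite exprS => /pt_prime[/aff_hyp|].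
Qed.

(** Pigeonhole: a monomial of degree larger than the sum of the k_i is divisible by some
    X_i^(k_i). *)
Lemma powers_irrelevant (J : ideal P) N :
  (forall i : 'I_n.+1, exists k, J ('X_i ^+ k)) ->
  exists M, forall G, G \is M.-homog -> (N <= M)%N /\ J G.
Proof.
move=> JX; have [k kP] := choice JX.
exists (N + \sum_i k i).+1 => G hG; split; first by rewrite leqW // leq_addr.
rewrite [G]mpolyE big_seq_cond; apply: ideal_sum => m /andP[mG _].
have md : mdeg m = (N + \sum_i k i).+1 by have /dhomogP := hG; apply.
have [i ki] : exists i, (k i <= m i)%N.
  apply: contrapT => nk; have : (mdeg m <= \sum_i k i)%N.
    rewrite mdegE; apply: leq_sum => i _; rewrite leqNgt; apply/negP => /ltnW H.
    by apply: nk; exists i.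
  by rewrite md leqNgt ltnS leq_addl.
rewrite -mul_mpolyC; apply: idealM; rewrite mpolyXE_id (bigD1 i) //=.
by rewrite -(subnK ki) exprD -mulrA mulrCA; apply/idealMr/kP.
Qed.

(** If X_0 G lies in the ideal of X and G does not, saturation gives a variable X_i with no power in
    the colon ideal of G. A homogeneous prime that contains this colon ideal and avoids the powers
    of X_i is a point of X on X_0 = 0. *)
Lemma X0_nzd F : X ('X_ord0 * F) -> X F.
Proof.
suff hom d G : G \is d.-homog -> X ('X_ord0 * G) -> X G.
  move=> XF; apply: hc_ideal => d; apply: (hom d); first exact: hc_homog.
  have := sch_homog d.+1 XF; rewrite mulrC (hcMr (d := 1)) ?subn1 /= 1?mulrC //.
  by rewrite dhomogX /= mdeg1.
move=> hG XG; apply: contrapT => nXG.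
have [i iP] : exists i, forall k, ~ X ('X_i ^+ k * G).
  apply: contrapT => noi; apply: nXG.
  have [i|M MP] := @powers_irrelevant (colon X G) 0%N.
    apply: contrapT => nok; apply: noi; exists i => k Xk.
    by apply: nok; exists k.
  by apply: sch_sat; exists M => H hH; have [_] := MP H hH.
pose S H := exists k : nat, H = 'X_i ^+ k :> P.
have [||||q [hq pq Jq qS]] := @homogeneous_prime_avoiding _ _ (colon X G) S.
- exact: homogeneous_colon (@sch_homog _ _ X) hG.
- by exists 0%N.
- by move=> _ _ [k ->] [l ->]; exists (k + l)%N; rewrite exprD.
- by move=> H + [k EH]; rewrite EH => /iP.
have [||x xq] := prime_point hq pq.
- by exists i => qi; apply: (qS 'X_i) => //; exists 1%N.
- by move=> H XH; apply: Jq; apply: sub_colon.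
by apply: (aff_hyp x); apply/xq; apply: Jq.
Qed.

Lemma X0n_nzd k F : X ('X_ord0 ^+ k * F) -> X F.
Proof. by elim: k => [|k IH]; rewrite ?mul1r // exprS -mulrA => /X0_nzd. Qed.

Lemma point_avoiding (J : ideal P) : homogeneous J -> (forall F, X F -> J F) ->
  (forall k, ~ J ('X_ord0 ^+ k)) -> exists x : supp X, forall F, J F -> x F.
Proof.
move=> hJ XJ JX0; pose S H := exists k : nat, H = 'X_ord0 ^+ k :> P.
have [||||q [hq pq Jq qS]] := @homogeneous_prime_avoiding _ _ J S.
- exact: hJ.
- by exists 0%N.
- by move=> _ _ [k ->] [l ->]; exists (k + l)%N; rewrite exprD.
- by move=> H + [k EH]; rewrite EH => /JX0.
have [||x xq] := prime_point hq pq.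
- by exists ord0 => qi; apply: (qS 'X_ord0) => //; exists 1%N.
- by move=> H /XJ/Jq.
by exists x => F /Jq/xq.
Qed.

(** Otherwise the annihilator of F modulo the ideal of X contains no power of X_0, as x0 is a
    non-zerodivisor, and is therefore contained in a point of X. *)
Lemma local_zero d F : F \is d.-homog ->
  (forall x : supp X, exists2 G, ~ x G & X (G * F)) -> X F.
Proof.
move=> hF Fx; apply: contrapT => nXF.
have [||k Jk|x xJ] := @point_avoiding (colon X F).
- exact: homogeneous_colon (@sch_homog _ _ X) hF.
- by move=> ?; apply: sub_colon.
- by apply: nXF; apply: X0n_nzd Jk.
by have [G xG XG] := Fx x; apply/xG/xJ.
Qed.

(** This is why Q^h(R) is the localization at x0 alone. Otherwise G lies in some point x. As G is a
    non-zerodivisor, no product G^k F with F outside x lies in the ideal of X, so some homogeneous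
    prime avoids all these products; it is a point contained in x that does not contain G, against
    dimension zero. *)
Lemma nzd_dvd_X0n b G : G \is b.-homog -> (forall F, X (G * F) -> X F) ->
  exists e H, H \is e.-homog /\ X ('X_ord0 ^+ (e + b) - H * G).
Proof.
move=> hG nG; apply: contrapT => no.
have [||k /adjoinP[j [g [Xj Ej]]]|x xG] := @point_avoiding (adjoin X G).
- exact: homogeneous_adjoin (@sch_homog _ _ X) hG.
- by move=> ?; apply: sub_adjoin.
- apply: no; exists k, (hc k ('X_ord0 ^+ b * g)); split; first exact: hc_homog.
  have /(congr1 (hc (k + b)%N)) : 'X_ord0 ^+ (k + b) =
    'X_ord0 ^+ b * j + 'X_ord0 ^+ b * g * G.
    by rewrite addnC exprD Ej mulrDr mulrA.
  rewrite pihomogD (hcE _ (homogX0 _ _ _)) eqxx (hcMr _ _ hG) leq_addl addnK => ->.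
  by rewrite addrK; apply: sch_homog; apply: idealM.
have {}xG : x G by apply/xG/mem_adjoin.
pose S H := exists k F, ~ x F /\ H = G ^+ k * F.
have [||||q [hq pq Xq qS]] := @homogeneous_prime_avoiding _ _ X S.
- exact: sch_homog.
- by exists 0%N, 1; rewrite mulr1; split=> //; apply: point1.
- move=> _ _ [k [F [xF ->]]] [l [F' [xF' ->]]]; exists (k + l)%N, (F * F').
  by split; [case/pt_prime | rewrite exprD mulrACA].
- move=> H + [k [F [xF EH]]]; rewrite {}EH => XF; apply/xF/supp_sub.
  by elim: k XF => [|k IH]; rewrite ?mul1r // exprS -mulrA => /nG.
have [|//|y yq] := prime_point hq pq.
  exists ord0 => /qS; apply; exists 0%N, 'X_ord0; rewrite mul1r; split=> //.
  exact: aff_hyp.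
have yx F : y F -> x F.
  move=> /yq/qS nSF; apply: contrapT => xF; apply: nSF.
  by exists 0%N, F; rewrite mul1r.
have /yq/qS := (aff_dim X).2 _ _ yx _ xG; apply; exists 1%N, 1; rewrite mulr1.
by split=> //; apply: point1.
Qed.

Definition aff_ideal : ideal P := adjoin X ('X_ord0 - 1).

(** Comparing components in F = G + H (X_0 - 1) gives H_e = X_0 H_(e-1) - F_e modulo the ideal of X,
    so H_e = - X_0^(e-d) F for e >= d. As H has finitely many components, some power of X_0 kills
    F. *)
Lemma aff_ideal_homog d F : F \is d.-homog -> aff_ideal F -> X F.
Proof.
move=> hF /adjoinP[G [H [XG EF]]].
have hE e : X (hc e H + (if (d <= e)%N then 'X_ord0 ^+ (e - d) * F else 0)).
  elim: e => [|e IH].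
    have := congr1 (hc 0) EF; rewrite pihomogD mulrBr mulr1 pihomogB.
    rewrite (hcMr (d := 1)) ?dhomogX /= ?mdeg1 // sub0r (hcE _ hF) leqn0 eq_sym sub0n mul1r => ->.
    by rewrite addrCA subrr addr0; apply: sch_homog.
  have := congr1 (hc e.+1) EF; rewrite pihomogD mulrBr mulr1 pihomogB.
  rewrite (hcMr (d := 1)) ?dhomogX /= ?mdeg1 // subn1 (hcE _ hF) /= => Ee.
  have XGe : X (hc e.+1 G) by apply: sch_homog.
  move: IH; case: (ltngtP e.+1 d) Ee => [ed|de|ed] Ee.
  - rewrite leqNgt (ltnW ed) addr0 /= addr0 => XH.
    have -> : hc e.+1 H = hc e.+1 G + 'X_ord0 * hc e H.
      by move/eqP: Ee; rewrite addrA eq_sym subr_eq0 => /eqP<-; rewrite mulrC.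
    by apply: idealD => //; apply: idealM.
  - move: de; rewrite ltnS => de; rewrite de subSn // exprS => XH.
    have -> : hc e.+1 H = hc e.+1 G + 'X_ord0 * hc e H.
      by move/eqP: Ee; rewrite addrA eq_sym subr_eq0 => /eqP<-; rewrite mulrC.
    by rewrite -addrA -mulrA -mulrDr; apply: idealD => //; apply: idealM.
  - rewrite -ed ltnn addr0 subnn mul1r => XH.
    have -> : hc e.+1 H + F = hc e.+1 G + hc e H * 'X_ord0 by rewrite [in LHS]Ee; ring.
    by apply: idealD => //; apply: idealMr.
have := hE (d + msize H)%N; rewrite hc_large ?leq_addl // add0r leq_addr.
exact: X0n_nzd.
Qed.

(* The ring of global functions on X, which is affine as X avoids X_0 = 0. *)
Definition aff : Type := quot aff_ideal.
HB.instance Definition _ := GRing.ComPzRing.on aff.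
Definition affc (F : P) : aff := quot_pi aff_ideal F.

Lemma affc_zmod : zmod_morphism affc.
Proof. by move=> F G; rewrite /affc quot_piD quot_piN. Qed.
Lemma affc_monoid : monoid_morphism affc.
Proof. by split=> [|F G]; rewrite /affc ?quot_piM ?quot_pi1. Qed.
HB.instance Definition _ := GRing.isZmodMorphism.Build _ _ affc affc_zmod.
HB.instance Definition _ := GRing.isMonoidMorphism.Build _ _ affc affc_monoid.

Lemma affc_eq0 F : affc F = 0 <-> aff_ideal F.
Proof. by rewrite -(rmorph0 affc) quot_piE subr0. Qed.

Lemma affc_homog_eq0 d F : F \is d.-homog -> affc F = 0 -> X F.
Proof. by move=> hF /affc_eq0; apply: aff_ideal_homog hF. Qed.

Lemma affcX F : X F -> affc F = 0.
Proof. by move=> XF; apply/affc_eq0/sub_adjoin. Qed.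

Lemma aff1_neq0 : (1 : aff) != 0.
Proof.
have [[x _] _] := aff_dim X; apply/eqP; rewrite -(rmorph1 affc) => /affc_homog_eq0.
by move/(_ _ (homog1 _ _))/(@supp_sub _ _ _ x)/point1.
Qed.
HB.instance Definition _ := GRing.PzSemiRing_isNonZero.Build aff aff1_neq0.

Definition aff_scale (k : K) (a : aff) : aff := affc k%:MP * a.
Lemma aff_scaleA a b f : aff_scale a (aff_scale b f) = aff_scale (a * b) f.
Proof. by rewrite /aff_scale mulrA mpolyCM rmorphM. Qed.
Lemma aff_scale1 : left_id 1 aff_scale.
Proof. by move=> f; rewrite /aff_scale mpolyC1 rmorph1 mul1r. Qed.
Lemma aff_scaleDr : right_distributive aff_scale +%R.
Proof. by move=> k f g; rewrite /aff_scale mulrDr. Qed.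
Lemma aff_scaleDl f : {morph aff_scale^~ f : a b / a + b}.
Proof. by move=> a b; rewrite /aff_scale mpolyCD rmorphD mulrDl. Qed.
HB.instance Definition _ := GRing.Zmodule_isLmodule.Build K aff
  aff_scaleA aff_scale1 aff_scaleDr aff_scaleDl.

Lemma aff_scaleAl (k : K) (a b : aff) : k *: (a * b) = k *: a * b.
Proof. by rewrite /GRing.scale /= /aff_scale mulrA. Qed.

Lemma aff_scaleE (k : K) (a : aff) : k *: a = affc k%:MP * a.
Proof. by []. Qed.

Lemma affcZ (k : K) F : affc (k *: F) = k *: affc F.
Proof. by rewrite -mul_mpolyC rmorphM. Qed.

Lemma aff_scaleAr (k : K) (a b : aff) : k *: (a * b) = a * (k *: b).
Proof. by rewrite mulrC aff_scaleAl mulrC. Qed.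

Lemma aff_ind (Q : aff -> Prop) : (forall F, Q (affc F)) -> forall a, Q a.
Proof. exact: quot_ind. Qed.

Lemma affc_X0 : affc 'X_ord0 = 1.
Proof.
apply/eqP; rewrite -subr_eq0 -(rmorph1 affc) -rmorphB; apply/eqP/affc_eq0.
exact: mem_adjoin.
Qed.

Lemma affc_X0M k F : affc ('X_ord0 ^+ k * F) = affc F.
Proof. by rewrite rmorphM rmorphXn /= affc_X0 expr1n mul1r. Qed.

(* As X_0 = 1 in A and x0 is a non-zerodivisor, fil d is a copy of R_d. *)
Definition fil (d : nat) : set aff := [set a | exists2 F, F \is d.-homog & a = affc F].

Lemma fil_subspace d : subspace (fil d).
Proof.
split=> [|k _ _ [F hF ->] [G hG ->]]; first by exists 0; rewrite ?dhomog0 ?rmorph0.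
exists (k *: F + G); first by apply: rpredD => //; apply: rpredZ.
by rewrite rmorphD /= affcZ.
Qed.

Lemma filM d e a b : fil d a -> fil e b -> fil (d + e) (a * b).
Proof.
move=> [F hF ->] [G hG ->]; exists (F * G); first exact: dhomogM.
by rewrite rmorphM.
Qed.

Lemma fil1 d : fil d 1.
Proof. by exists ('X_ord0 ^+ d); rewrite ?homogX0 // rmorphXn /= affc_X0 expr1n. Qed.

Lemma fil_le d e : (d <= e)%N -> fil d `<=` fil e.
Proof.
by move=> de a ad; rewrite -(subnK de) -[a]mul1r; apply: filM => //; apply: fil1.
Qed.

Lemma fil_hc d F : fil d (affc (hc d F)).
Proof. by exists (hc d F) => //; apply: hc_homog. Qed.

Lemma filP (a : aff) : exists N, forall M, (N <= M)%N -> fil M a.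
Proof.
elim/aff_ind: a => F; exists (msize F) => M FM.
rewrite [F](hc_sum FM) rmorph_sum; apply: (subspace_sum (fil_subspace M)) => i _.
by apply: (fil_le (ltnW (ltn_ord i))); apply: fil_hc.
Qed.

Lemma fil_common (a b : aff) : exists N F G,
  [/\ F \is N.-homog, G \is N.-homog, a = affc F & b = affc G].
Proof.
have [N Na] := filP a; have [M Mb] := filP b.
have [F hF ->] := Na (maxn N M) (leq_maxl _ _).
have [G hG ->] := Mb (maxn N M) (leq_maxr _ _).
by exists (maxn N M), F, G.
Qed.

End Points.
Arguments affc {K n X} F.
Arguments fil {K n X} d _.

(** * R and Q^h(R) as polynomials over A *)

Section InversePair.
Variables (B : comPzRingType) (x y : B).
Hypothesis xy : x * y = 1.
Implicit Types (a b : B).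

Lemma inv_pairXn k : x ^+ k * y ^+ k = 1.
Proof. by rewrite -exprMn xy expr1n. Qed.

Lemma inv_pair_cross N M a b : a * x ^+ M = b * x ^+ N <-> a * y ^+ N = b * y ^+ M.
Proof.
have E c k l : c * x ^+ k * (y ^+ k * y ^+ l) = c * y ^+ l.
  by rewrite mulrA -[_ * _ * y ^+ k]mulrA inv_pairXn mulr1.
have E' c k l : c * y ^+ k * (x ^+ k * x ^+ l) = c * x ^+ l.
  by rewrite mulrA -[_ * _ * x ^+ k]mulrA [y ^+ k * _]mulrC inv_pairXn mulr1.
split=> H.
  by rewrite -(E a M N) H [y ^+ M * _]mulrC E.
by rewrite -(E' a N M) H [x ^+ N * _]mulrC E'.
Qed.

Lemma inv_pair_unique g h v m : g * v = 1 -> h * g = x ^+ m -> v = h * y ^+ m.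
Proof.
move=> gv hg; rewrite -[LHS]mulr1 -(inv_pairXn m) -hg.
by rewrite mulrA mulrCA [v * g]mulrC gv mulr1.
Qed.

Lemma mulrACB (a b c d : B) : a * b * c * d = a * c * (d * b).
Proof. by ring. Qed.

End InversePair.

Section CoordinatePolynomials.
Variables (K : fieldType) (n : nat) (X : aff_scheme K n).
Local Notation P := {mpoly K[n.+1]}.
Local Notation R := (coord_ring X).
Local Notation A := (aff X).
Implicit Types (F G : P) (f g : R) (p q : {poly A}).

Lemma cls_zmod : zmod_morphism (cls X).
Proof. by move=> F G; rewrite /cls quot_piD quot_piN. Qed.
Lemma cls_monoid : monoid_morphism (cls X).
Proof. by split=> [|F G]; rewrite /cls ?quot_piM ?quot_pi1. Qed.
HB.instance Definition _ := GRing.isZmodMorphism.Build _ _ (cls X) cls_zmod.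
HB.instance Definition _ := GRing.isMonoidMorphism.Build _ _ (cls X) cls_monoid.

Lemma coord_ind (Q : R -> Prop) : (forall F, Q (cls X F)) -> forall f, Q f.
Proof. exact: quot_ind. Qed.

Lemma cls_eq0 F : cls X F = 0 <-> X F.
Proof. by rewrite -(rmorph0 (cls X)) /= /cls quot_piE subr0. Qed.

(* R = (+)_d R_d as a subring of A[T]. *)
Definition polyR (f : R) : {poly A} :=
  \poly_(d < msize (repr f)) affc (hc d (repr f)).

Lemma coef_polyR F d : (polyR (cls X F))`_d = affc (hc d F).
Proof.
have E : affc (hc d (repr (cls X F))) = affc (hc d F) :> A.
  apply/eqP; rewrite -subr_eq0 -rmorphB -pihomogB; apply/eqP/affcX/sch_homog.
  exact: quot_repr.
rewrite coef_poly -E; case: ltnP => // Fd.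
by rewrite hc_large // rmorph0.
Qed.

Lemma polyR_zmod : zmod_morphism polyR.
Proof.
elim/coord_ind=> F; elim/coord_ind=> G; rewrite -rmorphB; apply/polyP => d.
by rewrite coefB !coef_polyR pihomogB rmorphB.
Qed.

Lemma polyR_monoid : monoid_morphism polyR.
Proof.
split=> [|f g].
  rewrite -(rmorph1 (cls X)); apply/polyP => d.
  by rewrite coef_polyR (hcE _ (homog1 _ _)) coef1; case: eqP; rewrite ?rmorph1 ?rmorph0.
elim/coord_ind: f => F; elim/coord_ind: g => G; rewrite -rmorphM; apply/polyP => d.
rewrite coefM coef_polyR hcM rmorph_sum; apply: eq_bigr => i _.
by rewrite rmorphM !coef_polyR.
Qed.

HB.instance Definition _ := GRing.isZmodMorphism.Build _ _ polyR polyR_zmod.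
HB.instance Definition _ := GRing.isMonoidMorphism.Build _ _ polyR polyR_monoid.

Lemma polyR_inj : injective polyR.
Proof.
move=> f g /eqP; rewrite -subr_eq0 -rmorphB => /eqP fg; apply/subr0_eq.
move: (f - g) fg; elim/coord_ind=> F /= F0; apply/cls_eq0/hc_ideal => d.
apply: (affc_homog_eq0 (hc_homog d F)).
by rewrite -coef_polyR F0 coef0.
Qed.

Lemma polyR_homog d F : F \is d.-homog -> polyR (cls X F) = affc F *: 'X^d.
Proof.
move=> hF; apply/polyP => e; rewrite coef_polyR coefZ coefXn (hcE _ hF).
by case: eqP; rewrite ?mulr1 // mulr0 rmorph0.
Qed.

Lemma polyR_x0 : polyR (x0 X) = 'X.
Proof.
rewrite /x0 (polyR_homog (d := 1)) ?affc_X0 ?scale1r ?expr1 //.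
by rewrite dhomogX /= mdeg1.
Qed.

Lemma polyR_fil f d : fil d (polyR f)`_d.
Proof. by elim/coord_ind: f => F; rewrite coef_polyR; apply: fil_hc. Qed.

Lemma polyR_onto p : (forall d, fil d p`_d) -> exists f, polyR f = p.
Proof.
move=> pf; have exF d : exists F, F \is d.-homog /\ p`_d = affc F.
  by have [F hF ->] := pf d; exists F.
have [F FP] := choice exF; exists (\sum_(d < size p) cls X (F d)).
rewrite rmorph_sum -[RHS]coefK poly_def; apply: eq_bigr => d _ /=.
by rewrite (polyR_homog (FP d).1) (FP d).2.
Qed.

Lemma gr_coordP d f : gr_coord X d f <-> exists2 a, fil d a & polyR f = a *: 'X^d.
Proof.
split=> [[F hF ->]|[_ [F hF ->] Ef]].
  by exists (affc F); [exists F | rewrite (polyR_homog hF)].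
by exists F => //; apply: polyR_inj; rewrite (polyR_homog hF).
Qed.

(** The finitely many coefficients all lie in R_d once d is large. So inverting T in R already
    yields A[T, 1/T]. *)
Lemma polyR_shift p : exists N f, polyR f = 'X^N * p.
Proof.
have [b bP] := choice (@filP _ _ X).
pose N := (\sum_(d < size p) b (p`_d)%R)%N.
have bN e : (e < size p)%N -> (b (p`_e)%R <= N)%N.
  by move=> ep; rewrite /N (bigD1 (Ordinal ep)) //= leq_addr.
have [|f fp] := @polyR_onto ('X^N * p); last by exists N, f.
move=> d; rewrite coefXnM; case: ltnP => [_|Nd]; first exact: (fil_subspace X d).1.
case: (ltnP (d - N) (size p)) => [dp|pd].
  by apply: bP; apply: leq_trans Nd; apply: bN.
by rewrite nth_default //; apply: (fil_subspace X d).1.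
Qed.

Lemma homog_nzd_x0n k : homog_nzd X (x0 X ^+ k).
Proof.
split; first by exists k, ('X_ord0 ^+ k); rewrite ?homogX0 // rmorphXn.
elim/coord_ind=> F; rewrite /x0 -rmorphXn -rmorphM => /cls_eq0/X0n_nzd.
by move/cls_eq0.
Qed.

Definition hq : Type := hquot X.
HB.instance Definition _ := GRing.ComPzRing.on hq.

Definition inj (f : R) : hq := inj_hquot f.

Lemma inj_zmod : zmod_morphism inj.
Proof.
move=> f g; rewrite /inj /inj_hquot /hfrac fracN; last exact: mulset1.
by rewrite fracD; try exact: mulset1; rewrite !mulr1.
Qed.
Lemma inj_monoid : monoid_morphism inj.
Proof.
split=> [|f g]; rewrite /inj /inj_hquot /hfrac; first exact: frac1.
by rewrite fracM; try exact: mulset1; rewrite mulr1.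
Qed.
HB.instance Definition _ := GRing.isZmodMorphism.Build _ _ inj inj_zmod.
HB.instance Definition _ := GRing.isMonoidMorphism.Build _ _ inj inj_monoid.

Lemma inj_inj : injective inj.
Proof.
move=> f g /frac_eq[||h [_ nh]]; [exact: mulset1|exact: mulset1|].
by rewrite !mulr1 => /nh/subr0_eq.
Qed.

Lemma coord1_neq0 : (1 : R) != 0.
Proof.
apply/eqP => R0; have /eqP := oner_neq0 {poly A}; case.
by rewrite -(rmorph1 polyR) R0 rmorph0.
Qed.

Lemma hq1_neq0 : (1 : hq) != 0.
Proof.
by rewrite -(rmorph1 inj) -(rmorph0 inj) (inj_eq inj_inj) coord1_neq0.
Qed.
HB.instance Definition _ := GRing.PzSemiRing_isNonZero.Build hq hq1_neq0.

Definition xq : hq := inj (x0 X).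
Definition yq : hq := hfrac 1 (x0 X).

Lemma xyq : xq * yq = 1.
Proof.
have x0P : homog_nzd X (x0 X) by rewrite -[x0 X]expr1; apply: homog_nzd_x0n.
rewrite /xq /yq /inj /inj_hquot /hfrac -[LHS]/(Defs.frac _ _ _ * Defs.frac _ _ _) fracM //; last exact: mulset1.
rewrite mulr1 mul1r -[RHS]frac1; apply/frac_eq => //; first exact: mulset1.
by exists 1; [exact: mulset1 | rewrite !mul1r mulr1 subrr].
Qed.

Lemma xyqn k : xq ^+ k * yq ^+ k = 1.
Proof. exact: inv_pairXn xyq k. Qed.

Lemma xqnE k : xq ^+ k = inj (cls X ('X_ord0 ^+ k)).
Proof. by rewrite !rmorphXn. Qed.

Local Opaque xq yq.

Lemma hfracE f e b g h : homog_nzd X g -> h * g = x0 X ^+ (e + b) ->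
  hfrac f g = inj (f * h) * yq ^+ (e + b) :> hq.
Proof.
move=> gn hg.
have gx : inj g * (hfrac 1 g : hq) = 1.
  rewrite /inj /inj_hquot /hfrac -[LHS]/(Defs.frac _ _ _ * Defs.frac _ _ _) fracM //;
    last exact: mulset1.
  rewrite mulr1 mul1r -[RHS]frac1; apply/frac_eq => //; first exact: mulset1.
  by exists 1; [exact: mulset1 | rewrite !mul1r mulr1 subrr].
have -> : hfrac f g = inj f * hfrac 1 g :> hq.
  rewrite /inj /inj_hquot /hfrac -[RHS]/(Defs.frac _ _ _ * Defs.frac _ _ _) fracM //;
    last exact: mulset1.
  by rewrite mulr1 mul1r.
have hx : inj h * inj g = xq ^+ (e + b) by rewrite -rmorphM hg rmorphXn.
by rewrite rmorphM -mulrA (inv_pair_unique xyq gx hx).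
Qed.

(* The isomorphism of A with the component of degree 0 of Q^h(R). *)
Definition to_hq (a : A) : hq :=
  let N := xget 0%N [set N | fil N a] in
  inj (cls X (xget 0 [set F | F \is N.-homog /\ a = affc F])) * yq ^+ N.

(** Independence of the choices in [to_hq]: two homogeneous representatives of one element of A
    agree in R after multiplication by suitable powers of x0. *)
Lemma to_hqE d F : F \is d.-homog -> to_hq (affc F) = inj (cls X F) * yq ^+ d.
Proof.
move=> hF; rewrite /to_hq; set a := affc F; set N := xget 0%N _.
have [G hG Ea] : fil N a.
  by apply: (@xgetPex _ 0%N [set N | fil N a]); exists d, F.
set H := xget _ _; have [hH EH] : H \is N.-homog /\ a = affc H.
  by apply: (@xgetPex _ 0 [set F | F \is N.-homog /\ a = affc F]); exists G.
have XE : X ('X_ord0 ^+ d * H - 'X_ord0 ^+ N * F).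
  apply: (@affc_homog_eq0 _ _ _ (d + N)).
    by apply: rpredB; [|rewrite addnC]; apply: homogMX0.
  by rewrite rmorphB /= !affc_X0M -EH subrr.
apply: (proj1 (inv_pair_cross xyq N d _ _)); rewrite !xqnE -!rmorphM; congr inj;
  apply/subr0_eq.
by rewrite -rmorphB; apply/cls_eq0; rewrite mulrC [F * _]mulrC.
Qed.

Lemma to_hqXn d F : F \is d.-homog -> to_hq (affc F) * xq ^+ d = inj (cls X F).
Proof. by move=> hF; rewrite (to_hqE hF) -mulrA [yq ^+ d * _]mulrC xyqn mulr1. Qed.

Lemma to_hq_zmod : zmod_morphism to_hq.
Proof.
move=> a b; have [N [F [G [hF hG -> ->]]]] := fil_common a b.
rewrite -rmorphB /= (to_hqE (d := N)) ?rpredB // (to_hqE hF) (to_hqE hG).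
by rewrite !rmorphB mulrBl.
Qed.

Lemma to_hq_monoid : monoid_morphism to_hq.
Proof.
split=> [|a b].
  by rewrite -(rmorph1 affc) (to_hqE (homog1 _ _)) !rmorph1 mulr1.
have [N [F [G [hF hG -> ->]]]] := fil_common a b.
rewrite -rmorphM /= (to_hqE (dhomogM hF hG)) (to_hqE hF) (to_hqE hG).
by rewrite !rmorphM exprD mulrACA.
Qed.
HB.instance Definition _ := GRing.isZmodMorphism.Build _ _ to_hq to_hq_zmod.
HB.instance Definition _ := GRing.isMonoidMorphism.Build _ _ to_hq to_hq_monoid.

(** By [evalq_inj] and [hqP] this map, which sends T to x0, identifies A[T, 1/T] with Q^h(R); [yq]
    is 1/T. *)
Definition evalq (p : {poly A}) : hq := horner_eval xq (map_poly to_hq p).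
HB.instance Definition _ := GRing.RMorphism.copy evalq (horner_eval xq \o map_poly to_hq).

Lemma evalqX : evalq 'X = xq.
Proof. by rewrite /evalq /horner_eval map_polyX hornerX. Qed.

Lemma evalqC a : evalq a%:P = to_hq a.
Proof. by rewrite /evalq /horner_eval map_polyC hornerC. Qed.

Lemma evalqZXn a k : evalq (a *: 'X^k) = to_hq a * xq ^+ k.
Proof. by rewrite -mul_polyC rmorphM rmorphXn /= evalqC evalqX. Qed.

Lemma evalq_polyR f : evalq (polyR f) = inj f.
Proof.
elim/coord_ind: f => F; rewrite [F](hc_sum (leqnn _)) !rmorph_sum.
apply: eq_bigr => d _ /=; rewrite (polyR_homog (hc_homog d F)) evalqZXn.
exact/to_hqXn/hc_homog.
Qed.

Lemma evalq_inj : injective evalq.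
Proof.
move=> p q pq; apply/subr0_eq; have [N [f fE]] := polyR_shift (p - q).
have : inj f = 0 by rewrite -evalq_polyR fE rmorphM rmorphB /= pq subrr mulr0.
rewrite -(rmorph0 inj) => /inj_inj f0; move: fE; rewrite f0 rmorph0 => /esym/polyP E.
by apply/polyP => d; have := E (N + d)%N; rewrite coefXnM addKn ltnNge leq_addr !coef0.
Qed.

Lemma hqP (z : hq) : exists p N, z = evalq p * yq ^+ N.
Proof.
have [f [g [gn ->]]] := fracP (z : hquot X).
have [[b [G hG Eg]] nG] := gn.
have [|e [H [hH XH]]] := @nzd_dvd_X0n _ _ X b G hG.
  by move=> F /cls_eq0; rewrite rmorphM /= -Eg => /nG/cls_eq0.
exists (polyR (f * cls X H)), (e + b)%N; rewrite evalq_polyR; apply: hfracE => //.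
rewrite Eg -rmorphM -rmorphXn; apply/esym/subr0_eq.
by rewrite -rmorphB; apply/cls_eq0.
Qed.

Lemma gr_hquotP i (z : hq) :
  gr_hquot i z <-> exists a b c, z = to_hq a * xq ^+ b * yq ^+ c /\ i = b%:Z - c%:Z.
Proof.
split=> [[a [b [f [g [[F hF Ef] [G hG Eg] gn -> ->]]]]]|[a [b [c [-> ->]]]]].
  have [F' XF'|e [H [hH XH]]] := @nzd_dvd_X0n _ _ X b G hG.
    apply/cls_eq0; apply: gn.2; rewrite Eg -rmorphM; exact/cls_eq0.
  exists (affc (F * H)), (a + e)%N, (e + b)%N.
  split; last by rewrite !PoszD; ring.
  rewrite (to_hqXn (dhomogM hF hH)) Ef rmorphM; apply: hfracE => //.
  rewrite Eg -rmorphM -rmorphXn; apply/esym/subr0_eq.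
  by rewrite -rmorphB; apply/cls_eq0.
have [N /(_ N (leqnn _)) [F hF ->]] := filP a.
exists (N + b)%N, (c + N)%N, (cls X F * x0 X ^+ b), (x0 X ^+ (c + N)); split.
- exists (F * 'X_ord0 ^+ b); first by apply: dhomogM => //; apply: homogX0.
  by rewrite rmorphM rmorphXn.
- by exists ('X_ord0 ^+ (c + N)); rewrite ?homogX0 // rmorphXn.
- exact: homog_nzd_x0n.
- rewrite (@hfracE _ c N _ 1) ?mul1r //; last exact: homog_nzd_x0n.
  by rewrite (to_hqE hF) mulr1 rmorphM rmorphXn exprD mulrACB.
- by rewrite !PoszD; ring.
Qed.

(* K[x0] as a subring of A[T]. *)
Definition scalp (q : {poly K}) : {poly A} := map_poly (fun k => k *: (1 : A)) q.

Lemma coef_scalp (q : {poly K}) d : (scalp q)`_d = q`_d *: (1 : A).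
Proof. by rewrite coef_map_id0 // scale0r. Qed.

Lemma polyR_Kx0 (q : {poly K}) : polyR (\sum_(i < size q) q`_i *: x0 X ^+ i) = scalp q.
Proof.
rewrite rmorph_sum /scalp /map_poly poly_def; apply: eq_bigr => i _ /=.
rewrite -[_ *: x0 X ^+ i]/(cls X (q`_i)%:MP * x0 X ^+ i) rmorphM rmorphXn /= polyR_x0.
rewrite (polyR_homog (d := 0)); last by rewrite -[_%:MP]mulr1; apply/homogC/homog1.
by rewrite expr0 -scalerAl mul1r aff_scaleE mulr1.
Qed.

Lemma Kx0P f : Kx0 f <-> exists q : {poly K}, polyR f = scalp q.
Proof.
split=> [[q ->]|[q Eq]]; exists q; first exact: polyR_Kx0.
by apply: polyR_inj; rewrite polyR_Kx0.
Qed.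

Lemma L0P (z : hq) : L0 z <-> exists (q : {poly K}) N, z = evalq (scalp q) * yq ^+ N.
Proof.
have fE f N : hfrac f (x0 X ^+ N) = inj f * yq ^+ N :> hq.
  have := @hfracE f N 0 (x0 X ^+ N) 1; rewrite addn0 mul1r mulr1; apply => //.
  exact: homog_nzd_x0n.
split=> [[f /Kx0P[q Ef] [N ->]]|[q [N ->]]].
  by exists q, N; rewrite fE -evalq_polyR Ef.
exists (\sum_(i < size q) q`_i *: x0 X ^+ i); first by exists q.
by exists N; rewrite fE -evalq_polyR polyR_Kx0.
Qed.

End CoordinatePolynomials.
Arguments polyR {K n X} f.
Arguments inj {K n X} f.
Arguments evalq {K n X} p.
Arguments to_hq {K n X} a.
Arguments scalp {K n X} q.
Arguments xq {K n X}.
Arguments yq {K n X}.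

(** * The trace form *)

(* A failing unification would otherwise unfold the quotient constructions. *)
Local Opaque xq yq inj to_hq evalq.
Local Opaque loc_mul loc_add loc_opp loc_pi quot_mul quot_add quot_opp quot_pi.

Section TraceMap.
Variables (K : fieldType) (n : nat) (X : aff_scheme K n).
Local Notation R := (coord_ring X).
Local Notation A := (aff X).
Local Notation Q := (hq X).
Implicit Types (f : R) (p q : {poly A}) (z w : Q).

Lemma to_hq_inj : injective (@to_hq K n X).
Proof.
by move=> a b ab; apply: (@polyC_inj A); apply: evalq_inj; rewrite !evalqC.
Qed.

Lemma evalq_yE p q N M :
  evalq p * yq ^+ N = evalq q * yq ^+ M :> Q <-> p * 'X^M = q * 'X^N.
Proof.
have E r L : evalq r * xq ^+ L = evalq (r * 'X^L) :> Q.
  by rewrite rmorphM rmorphXn /= evalqX.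
split=> [H|H].
  by apply: evalq_inj; rewrite -!E; apply: (proj2 (inv_pair_cross (xyq X) _ _ _ _)).
by apply: (proj1 (inv_pair_cross (xyq X) _ _ _ _)); rewrite !E H.
Qed.

Lemma evalqDy p q N :
  evalq (p + q) * yq ^+ N = evalq p * yq ^+ N + evalq q * yq ^+ N :> Q.
Proof. by rewrite rmorphD mulrDl. Qed.

Lemma evalq_yE0 p q N : evalq p * yq ^+ N = evalq q :> Q <-> p = q * 'X^N.
Proof. by rewrite -[evalq q]mulr1 -[1 in RHS](expr0 yq) evalq_yE mulr1. Qed.

Lemma evalq_inj_polyR p N f :
  evalq p * yq ^+ N = inj f :> Q <-> p = polyR f * 'X^N.
Proof. by rewrite -evalq_polyR evalq_yE0. Qed.

Lemma scal1_inj : injective (fun k : K => k *: (1 : A)).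
Proof.
move=> k l /= /eqP; rewrite -subr_eq0 -scalerBl scaler_eq0 oner_eq0 orbF subr_eq0.
by move/eqP.
Qed.

Lemma scalp_inj : injective (@scalp K n X).
Proof. by move=> p q pq; apply/polyP => d; apply: scal1_inj; rewrite -!coef_scalp pq. Qed.

Lemma scalpD : {morph @scalp K n X : p q / p + q}.
Proof. by move=> p q; apply/polyP => d; rewrite !(coefD, coef_scalp) scalerDl. Qed.

Lemma scalpM : {morph @scalp K n X : p q / p * q}.
Proof.
move=> p q; apply/polyP => d; rewrite coef_scalp !coefM scaler_suml.
by apply: eq_bigr => i _; rewrite !coef_scalp -aff_scaleAl mul1r scalerA.
Qed.

Lemma scalpXn d : scalp 'X^d = 'X^d :> {poly A}.
Proof.
by apply/polyP => e; rewrite coef_scalp !coefXn; case: eqP; rewrite ?scale1r ?scale0r.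
Qed.

Lemma scalpZXn k d : scalp (k *: 'X^d) = (k *: (1 : A)) *: 'X^d :> {poly A}.
Proof. by apply/polyP => e; rewrite coef_scalp !coefZ !coefXn -scalerA; case: eqP;
  rewrite ?(scale1r, scale0r, scaler0, mulr1, mulr0). Qed.

Section MapLinear.
Variable phi : A -> K.
Hypothesis lphi : linear (phi : A -> K^o).

Definition mapl (p : {poly A}) : {poly K} := map_poly phi p.

Lemma coef_mapl p d : (mapl p)`_d = phi p`_d.
Proof. by rewrite coef_map_id0 // (linear_f0 lphi). Qed.

Lemma linear_fD a b : phi (a + b) = phi a + phi b.
Proof. by rewrite -[a in LHS]scale1r lphi scale1r. Qed.

Lemma maplD p q : mapl (p + q) = mapl p + mapl q.
Proof. by apply/polyP => d; rewrite !(coefD, coef_mapl) linear_fD. Qed.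

Lemma mapl_scalp r p : mapl (scalp r * p) = r * mapl p.
Proof.
apply/polyP => d; rewrite coef_mapl !coefM.
rewrite (eq_bigr (fun i : 'I_d.+1 => r`_i *: p`_(d - i))); last first.
  by move=> i _; rewrite coef_scalp -aff_scaleAl mul1r.
by rewrite (linear_sum lphi); apply: eq_bigr => i _; rewrite coef_mapl.
Qed.

Lemma maplXn N p : mapl ('X^N * p) = 'X^N * mapl p.
Proof. by rewrite -mapl_scalp scalpXn. Qed.

Lemma mapl_mulXn N p : mapl (p * 'X^N) = mapl p * 'X^N.
Proof. by rewrite mulrC maplXn mulrC. Qed.

Lemma maplZXn a d : mapl (a *: 'X^d) = phi a *: 'X^d.
Proof.
apply/polyP => e; rewrite coef_mapl !coefZ !coefXn; case: eqP; rewrite ?mulr1 // !mulr0.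
by rewrite (linear_f0 lphi).
Qed.

Lemma maplC a : mapl a%:P = (phi a)%:P.
Proof.
apply/polyP => e; rewrite coef_mapl !coefC; case: eqP => // _.
by rewrite (linear_f0 lphi).
Qed.

(** Applying [phi] to coefficients commutes with multiplication by T, so the value does not depend
    on how a fraction p / T^N is written. The universal property of [sigma] is applied to these
    extensions. *)
Lemma extend_L0_ex : exists psi : Q -> Q,
  forall p N, psi (evalq p * yq ^+ N) = evalq (scalp (mapl p)) * yq ^+ N.
Proof.
have ex z : exists w, forall p N, z = evalq p * yq ^+ N ->
    w = evalq (scalp (mapl p)) * yq ^+ N.
  have [p [N ->]] := hqP z; exists (evalq (scalp (mapl p)) * yq ^+ N) => q M.
  move/evalq_yE => E; apply/evalq_yE.
  by rewrite -!(scalpXn _) -!scalpM -!mapl_mulXn E.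
have [psi psiP] := choice ex; exists psi => p N; exact: psiP.
Qed.

Lemma dual_extend (psi : Q -> Q) :
  (forall p N, psi (evalq p * yq ^+ N) = evalq (scalp (mapl p)) * yq ^+ N) ->
  dual_hquot (psi : hquot X -> hquot X).
Proof.
move=> psiE; exists 1%N, (fun=> psi), (fun=> 0); split; last first.
  by move=> u _; rewrite big_ord1.
move=> _; split; first split.
- move=> u _; apply/L0P; have [p [N ->]] := hqP u; exists (mapl p), N; exact: psiE.
- move=> u v _ _; have [p [N ->]] := hqP u; have [q [M ->]] := hqP v.
  have -> : evalq p * yq ^+ N + evalq q * yq ^+ M =
      evalq (p * 'X^M + q * 'X^N) * yq ^+ (N + M) :> Q.
    rewrite rmorphD mulrDl; congr (_ + _).
      by apply/evalq_yE; rewrite -mulrA -exprD addnC.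
    by apply/evalq_yE; rewrite -mulrA -exprD.
  rewrite -[_ + psi _]/(_ + _ : Q) !psiE maplD scalpD !mapl_mulXn !scalpM !scalpXn.
  rewrite rmorphD mulrDl; congr (_ + _).
    by apply/evalq_yE; rewrite -mulrA -exprD addnC.
  by apply/evalq_yE; rewrite -mulrA -exprD.
- move=> b u /L0P[r [M ->]] _; have [p [N ->]] := hqP u.
  have E q : evalq (scalp r) * yq ^+ M * (evalq q * yq ^+ N) =
      evalq (scalp r * q) * yq ^+ (M + N) :> Q.
    by rewrite rmorphM exprD mulrACA.
  by rewrite -[(_ * _ : hquot X)]/(_ * _ : Q) E !psiE E mapl_scalp scalpM.
- move=> i u _ /gr_hquotP[a [b [c [-> ->]]]]; rewrite addr0.
  apply/gr_hquotP; exists (phi a *: (1 : A)), b, c; split=> //.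
  by rewrite -!evalqZXn psiE maplZXn scalpZXn.
Qed.

End MapLinear.

Variable sigma : hquot X -> hquot X.
Hypothesis sigma_tr : trace_map sigma.

Let sg : Q -> Q := sigma.

Lemma sigmaD z w : sg (z + w) = sg z + sg w.
Proof. by have [[[_ sD _] _] _] := sigma_tr; apply: sD. Qed.

Lemma sigmaL0 b z : L0 (b : hquot X) -> sg (b * z) = b * sg z.
Proof. by move=> Lb; have [[[_ _ sM] _] _] := sigma_tr; apply: sM. Qed.

Lemma L0_sigma z : L0 (sg z : hquot X).
Proof. by have [[[sL _ _] _] _] := sigma_tr; apply: sL. Qed.

Lemma to_hq_scale k a : to_hq (k *: a) = to_hq (k *: (1 : A)) * to_hq a :> Q.
Proof. by rewrite -rmorphM -aff_scaleAl mul1r. Qed.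

Lemma L0_mono k d N : L0 (to_hq (k *: (1 : A)) * xq ^+ d * yq ^+ N : hquot X).
Proof. by apply/L0P; exists (k *: 'X^d), N; rewrite scalpZXn evalqZXn. Qed.

(** As [sigma] has degree 0, it sends A into the part of degree 0 of L0, which is K; in q(x0) / x0^N
    this part is the coefficient of index N. *)
Lemma tau_ex a : exists k : K, sg (to_hq a) = to_hq (k *: (1 : A)).
Proof.
have [q [N Eq]] := (L0P _).1 (L0_sigma (to_hq a)).
have [[_ sdeg] _] := sigma_tr.
have [|b [l [m [Eb]]]] := (gr_hquotP _ _).1 (sdeg 0 (to_hq a) I _).
  by apply/gr_hquotP; exists a, 0%N, 0%N; rewrite !mulr1.
rewrite addr0 => /esym/subr0_eq[lm]; rewrite lm -mulrA xyqn mulr1 in Eb.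
exists q`_N; rewrite -[LHS]/(sigma _) Eb; congr to_hq.
have := Eq; rewrite -[LHS]/(sigma _) Eb -evalqC => /esym/evalq_yE0/polyP/(_ N).
by rewrite coef_scalp coefMXn ltnn subnn coefC => ->.
Qed.

Definition tau (a : A) : K := xget 0 [set k : K | sg (to_hq a) = to_hq (k *: (1 : A))].

Lemma tauE a : sg (to_hq a) = to_hq (tau a *: (1 : A)).
Proof.
have [k kP] := tau_ex a.
by apply: (@xgetPex _ (0 : K) [set k : K | sg (to_hq a) = to_hq (k *: (1 : A))]);
  exists k.
Qed.

Lemma tau_linear : linear (tau : A -> K^o).
Proof.
move=> k a b; apply: scal1_inj; apply: to_hq_inj; rewrite -tauE.
rewrite rmorphD /= sigmaD [to_hq (k *: a)]to_hq_scale sigmaL0; last first.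
  by have := L0_mono k 0 0; rewrite !expr0 !mulr1.
by rewrite !tauE -to_hq_scale -rmorphD /= scalerA -scalerDl.
Qed.

Local Notation mtau := (mapl tau).

Lemma sigmaE p N : sg (evalq p * yq ^+ N) = evalq (scalp (mtau p)) * yq ^+ N.
Proof.
have sg0 : sg 0 = 0 by apply: (addrI (sg 0)); rewrite -sigmaD !addr0.
have sgZ a d : sg (evalq (a *: 'X^d) * yq ^+ N) =
    evalq (scalp (mtau (a *: 'X^d))) * yq ^+ N.
  rewrite (maplZXn tau_linear) scalpZXn !evalqZXn.
  have E b : to_hq b * xq ^+ d * yq ^+ N = to_hq (1 *: (1 :
    A)) * xq ^+ d * yq ^+ N * to_hq b :> Q.
    by rewrite scale1r rmorph1 mul1r [RHS]mulrC mulrA.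
  by rewrite E sigmaL0 ?tauE -?E //; apply: L0_mono.
rewrite -[p]coefK poly_def;
  pose Pp r := sg (evalq r * yq ^+ N) = evalq (scalp (mtau r)) * yq ^+ N.
apply: (big_ind Pp) => [|r r' Er Er'|i _]; last exact: sgZ.
  have mtau0 : mtau 0 = 0 by apply/polyP => d;
    rewrite (coef_mapl tau_linear) !coef0 (linear_f0 tau_linear).
  have scalp0 : scalp 0 = 0 :> {poly A} by apply/polyP => d;
    rewrite coef_scalp !coef0 scale0r.
  by rewrite /Pp mtau0 scalp0 rmorph0 mul0r.
rewrite /Pp (maplD tau_linear) scalpD.
do 2 rewrite evalqDy; rewrite sigmaD.
exact: (congr2 +%R Er Er').
Qed.

(** The element of Q^h(R) representing the extension of [phi] has the form q / T^N, and [g] is its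
    part of degree 0, the coefficient of index N. *)
Lemma tau_onto (phi : A -> K) : linear (phi : A -> K^o) -> exists g :
  A, forall a, phi a = tau (g * a).
Proof.
move=> lphi; have [psi psiE] := extend_L0_ex lphi.
have [g [gP _]] := sigma_tr.2 _ (dual_extend lphi psiE).
have [q [N Eg]] := hqP (g : Q); exists q`_N => a.
have := gP (to_hq a); rewrite -[_ * _]/((g : Q) * to_hq a) Eg -evalqC.
rewrite -[evalq a%:P in LHS]mulr1 -[1 in LHS](expr0 yq) -[psi _]/(psi (_ * _ : Q)) psiE.
have -> : evalq q * yq ^+ N * evalq a%:P = evalq (q * a%:P) * yq ^+ N :> Q.
  by rewrite rmorphM mulrAC.
rewrite -[sigma _]/(sg _) sigmaE => /evalq_yE.
rewrite expr0 mulr1 maplC // -(scalpXn N) -scalpM => /scalp_inj/polyP/(_ N).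
by rewrite coefMXn ltnn subnn coefC /= (coef_mapl tau_linear) coefMC.
Qed.

(** Both 0 and [g] represent the zero form, and the representing element is unique. *)
Lemma tau_nondegenerate (g : A) : (forall a, tau (g * a) = 0) -> g = 0.
Proof.
move=> g0; have l0 : linear ((fun=> 0) : A -> K^o).
  by move=> k a b; rewrite scaler0 addr0.
have [psi psiE] := extend_L0_ex l0.
have [h [_ hU]] := sigma_tr.2 _ (dual_extend l0 psiE).
have z0 z : psi z = 0.
  have [p [N ->]] := hqP z; rewrite psiE.
  have -> : scalp (mapl (fun _ : A => 0 : K) p) = 0 :> {poly A}.
    by apply/polyP => d; rewrite coef_scalp coef_mapl // coef0 scale0r.
  by rewrite rmorph0 mul0r.
have sg0 : sg 0 = 0 by apply: (addrI (sg 0)); rewrite -sigmaD !addr0.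
have h0 : h = 0 :> Q.
  by apply: hU => z; rewrite z0 -[_ * z]/((0 : Q) * z) mul0r -[sigma _]/(sg 0) sg0.
have hg : h = to_hq g :> Q.
  apply: hU => z; rewrite z0; have [p [N ->]] := hqP (z : Q).
  rewrite -[_ * _]/(to_hq g * (evalq p * yq ^+ N)) -[sigma _]/(sg _) mulrA -evalqC -rmorphM /= sigmaE.
  have -> : mtau (g%:P * p) = 0.
    apply/polyP => d; rewrite (coef_mapl tau_linear) coefCM coef0; exact: g0.
  have -> : scalp 0 = 0 :> {poly A} by apply/polyP => d;
    rewrite coef_scalp !coef0 scale0r.
  by rewrite rmorph0 mul0r.
by apply: to_hq_inj; rewrite rmorph0 -hg h0.
Qed.

Lemma aff_findim : findim A.
Proof.
pose a i : A := if unpickle i is Some m then affc 'X_[m] else 0.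
have comb0 m c : comb a m c = comb a m (fun i => if (i < m)%N then c i else 0).
  by apply: eq_bigr => i _; rewrite ltn_ord.
pose spanned (v : A) := exists m c, v = comb a m c.
have sD k u v : spanned u -> spanned v -> spanned (k *: u + v).
  move=> [m [c ->]] [m' [c' ->]].
  pose d i := if (i < m)%N then c i else 0; pose d' i := if (i < m')%N then c' i else 0.
  exists (maxn m m'), (fun i => k * d i + d' i).
  rewrite comb0 [comb a m' c']comb0 -/d -/d'.
  rewrite -(comb_widen (k := maxn m m') (m := m) a (c := d)) ?leq_maxl //; last first.
    by move=> i; rewrite leqNgt /d => /negbTE->.
  rewrite -(comb_widen (k := maxn m m') (m := m') a (c := d')) ?leq_maxr //; last first.
    by move=> i; rewrite leqNgt /d' => /negbTE->.
  rewrite /comb scaler_sumr -big_split; apply: eq_bigr => i _ /=.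
  by rewrite scalerDl scalerA.
have s0 : spanned 0 by exists 0%N, (fun=> 0); rewrite /comb big_ord0.
have sX m : spanned (affc 'X_[m]).
  exists (pickle m).+1, (fun i => (i == pickle m)%:R).
  rewrite /comb (bigD1 ord_max) //= eqxx scale1r /a pickleK big1 ?addr0 // => i im.
  by rewrite (_ : (_ == _) = false) ?scale0r //; apply/negbTE.
have sA : subspace spanned by [].
pose beta : A -> A -> K^o := fun g v : A => tau (g * v).
apply: (@findim_dual K A a _ beta).
- elim/aff_ind=> F; rewrite [F]mpolyE rmorph_sum.
  by apply: (subspace_sum sA) => m _ /=; rewrite affcZ; apply: subspaceZ.
- by move=> v k g h; rewrite /beta mulrDl -aff_scaleAl tau_linear.
- by move=> phi /tau_onto.
Qed.

Lemma fil_full : exists N, forall (a : A) d, (N <= d)%N -> fil d a.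
Proof.
have [m [g gP]] := aff_findim; have [b bP] := choice (fun i => filP (g i)).
exists (\sum_i b i)%N => a d le_d; have [c ->] := gP a.
apply: (subspace_sum (fil_subspace X d)) => i _; apply: (subspaceZ (fil_subspace X d)).
by apply: bP; apply: leq_trans le_d; rewrite (bigD1 i) //= leq_addr.
Qed.

Lemma tau_separate (U : set A) x : subspace U -> ~ U x ->
  exists g, (forall u, U u -> tau (g * u) = 0) /\ tau (g * x) <> 0.
Proof.
move=> sU Ux; have [phi [lphi phi0 phi1]] := separate aff_findim sU Ux.
have [g gP] := tau_onto lphi; exists g; split=> [u Uu|].
  by rewrite -gP phi0.
by rewrite -gP phi1 => /eqP; rewrite oner_eq0.
Qed.

End TraceMap.

(** * Complementary module, different and trace *)

Section PolyShift.
Variable B : nzRingType.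
Implicit Types p q : {poly B}.

Lemma poly_divXn p N : (forall d, (d < N)%N -> p`_d = 0) ->
  exists q, p = q * 'X^N /\ forall d, q`_d = p`_(d + N).
Proof.
move=> p0; exists (\poly_(d < size p) p`_(d + N)).
have qE d : (\poly_(d < size p) p`_(d + N))`_d = p`_(d + N).
  rewrite coef_poly; case: ltnP => // pd; rewrite nth_default //.
  by apply: leq_trans pd _; apply: leq_addr.
split=> //; apply/polyP => d; rewrite coefMXn; case: ltnP => [/p0//|Nd].
by rewrite qE subnK.
Qed.

Lemma polyMXn_inj N : injective (fun p => p * 'X^N).
Proof.
move=> p q /= pq; apply/polyP => d; have := congr1 (fun r : {poly B} => r`_(d + N)) pq.
by rewrite !coefMXn ltnNge leq_addl addnK.
Qed.

End PolyShift.

Section Dedekind.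
Variables (K : fieldType) (n : nat) (X : aff_scheme K n).
Local Notation R := (coord_ring X).
Local Notation A := (aff X).
Local Notation Q := (hq X).
Implicit Types (f : R) (p q : {poly A}) (z w : Q) (a c v : A).

Variable sigma : hquot X -> hquot X.
Hypothesis sigma_tr : trace_map sigma.

Let sg : Q -> Q := sigma.
Let tl := tau_linear sigma_tr.
Local Notation tau := (tau sigma).
Local Notation mtau := (mapl tau).
Local Notation compl := (complementary sigma : set Q).
Local Notation diff := (different sigma : set Q).

Let sgE p N : sg (evalq p * yq ^+ N) = evalq (scalp (mtau p)) * yq ^+ N :=
  sigmaE sigma_tr p N.
Let sgD z w : sg (z + w) = sg z + sg w := sigmaD sigma_tr z w.
Let sgL0 b z : L0 (b : hquot X) -> sg (b * z) = b * sg z := @sigmaL0 _ _ _ _ sigma_tr b z.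

(* The component of degree -k of the complementary module is the orthogonal
   of R_(k-1). *)
Definition perp (k : nat) (c : A) : Prop :=
  forall j v, (j < k)%N -> fil j v -> tau (c * v) = 0.

(** On u = v T^k with v in R_k, [sigma] takes m u to tau(c v) T^(e + k - N). The hypothesis removes
    exactly the negative exponents, so the values lie in K[x0], and the resulting map has degree e -
    N. *)
Lemma compl_mono c e N :
  (forall k v, (k + e < N)%N -> fil k v -> tau (c * v) = 0) ->
  compl (evalq (c *: 'X^e) * yq ^+ N).
Proof.
move=> tc; set m : Q := _ * _.
have ex f : exists g, Kx0 g /\ inj g = sg (m * inj f).
  have -> : m * inj f = evalq (c *: 'X^e * polyR f) * yq ^+ N.
    by rewrite /m -evalq_polyR rmorphM mulrAC.
  rewrite sgE.
  have [|r [Er _]] := @poly_divXn K (mtau (c *: 'X^e * polyR f)) N.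
    move=> d dN; rewrite (coef_mapl tl) -scalerAl coefZ coefXnM.
    case: ltnP => [_|ed]; first by rewrite mulr0 (linear_f0 tl).
    by rewrite (tc (d - e)%N) ?subnK //; apply: polyR_fil.
  exists (\sum_(i < size r) r`_i *: x0 X ^+ i); split; first by exists r.
  by rewrite -evalq_polyR polyR_Kx0; apply/esym/evalq_yE0; rewrite Er scalpM scalpXn.
have [phi phiP] := choice ex.
have phiE f : inj (phi f) = sg (m * inj f) by have [] := phiP f.
have phi_lin b f g : phi (b * f + g) = phi (b * f) + phi g.
  apply: inj_inj; by rewrite rmorphD /= !phiE rmorphD mulrDr sgD.
have phi0 : phi 0 = 0.
  apply: (addrI (phi 0)); have := phi_lin 0 0 0; by rewrite !mul0r !addr0 => <-.
exists phi; last first.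
  split=> [|a]; last by rewrite -[_ * _]/(m * inj a) -[sigma _]/(sg _) -phiE.
  split=> [u _|u v _ _|b u Lb _].
  - exact: (L0_sigma sigma_tr (m * (u : Q))).
  - by rewrite -[sigma _]/(sg (m * ((u : Q) + (v : Q)))) mulrDr sgD.
  - rewrite -[sigma _]/(sg (m * ((b : Q) * (u : Q)))) mulrCA sgL0 //.
exists 1%N, (fun=> phi), (fun=> (e%:Z - N%:Z)); split; last first.
  by move=> u _; rewrite big_ord1.
move=> _; split; first split.
- by move=> u _; have [] := phiP u.
- by move=> u v _ _; rewrite -[u in LHS]mul1r phi_lin mul1r.
- move=> b u /Kx0P[r Er] _; apply: inj_inj; rewrite rmorphM /= !phiE rmorphM.
  rewrite mulrCA sgL0 //.
  by apply/L0P; exists r, 0%N; rewrite mulr1 -Er evalq_polyR.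
- move=> [k|k] u _ /=; last by move=> ->; rewrite phi0; case: (_ + _) => // j; exists 0;
  rewrite ?dhomog0 ?rmorph0.
  move=> /gr_coordP[v vk Eu].
  have /evalq_inj_polyR : evalq (scalp (tau (c * v) *: 'X^(e + k))) * yq ^+ N =
    inj (phi u).
    rewrite phiE -(maplZXn tl) -sgE; congr sg.
    by rewrite /m -evalq_polyR mulrAC -rmorphM /= Eu -scalerAl -scalerAr scalerA -exprD.
  rewrite scalpZXn => E.
  case: (leqP N (e + k)) => [le_N|lt_N].
    have -> : k%:Z + (e%:Z - N%:Z) = (e + k - N)%N :> int.
      by rewrite -subzn // PoszD; ring.
    have Eu' : polyR (phi u) = (tau (c * v) *: (1 : A)) *: 'X^(e + k - N).
      by apply: (@polyMXn_inj _ N); rewrite /= -E -scalerAl -exprD subnK.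
    apply/gr_coordP; exists (tau (c * v) *: (1 : A)) => //.
    by apply: (subspaceZ (fil_subspace X _)); apply: fil1.
  have -> : phi u = 0.
    apply: polyR_inj; rewrite rmorph0; apply: (@polyMXn_inj _ N).
    by rewrite /= -E (tc k v) ?scale0r ?mul0r // addnC.
  by case: (_ + _) => // j; exists 0; rewrite ?dhomog0 ?rmorph0.
Qed.

Lemma compl_perp k c : perp k c -> compl (to_hq c * yq ^+ k).
Proof.
move=> ck; rewrite -evalqC -[c%:P]mulr1 mul_polyC -[1](expr0 'X).
by apply: compl_mono => j v; rewrite addn0; apply: ck.
Qed.

(** [perp 0] is an empty condition, as R has no negative degrees. It follows that the different lies
    in R. *)
Lemma compl1 : compl 1.
Proof. by have := @compl_perp 0 1; rewrite rmorph1 mulr1; apply=> j v. Qed.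

(** A converse of [compl_mono] for each coefficient: tested on v T^k, it enters at the index e + k <
    N, where an element of R times T^N has no coefficient. *)
Lemma compl_coef q N e : compl (evalq q * yq ^+ N) -> perp (N - e) q`_e.
Proof.
case=> phi _ [_ sE] k v; rewrite ltn_subRL => ekN [F hF Ev].
have := sE (cls X F); rewrite -[_ * inj_hquot _]/(evalq q * yq ^+ N * inj (cls X F)).
rewrite -[sigma _]/(sg _) -[inj_hquot _]/(inj _) -evalq_polyR (polyR_homog X hF) -Ev.
rewrite mulrAC -rmorphM /= sgE => /evalq_inj_polyR/polyP/(_ (e + k)%N).
rewrite coef_scalp coefMXn ekN (coef_mapl tl) -scalerAr coefZ coefMXn.
rewrite ltnNge leq_addl addnK mulrC -[RHS](scale0r (1 : A)); exact: scal1_inj.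
Qed.

Lemma diff_inj z : diff z -> exists f, z = inj f.
Proof. by move=> dz; have [f] := dz _ compl1; rewrite mulr1; exists f. Qed.

Lemma diffP p : diff (evalq p) <->
  forall d k c, perp k c ->
    if (k <= d)%N then fil (d - k) (p`_d * c) else p`_d * c = 0.
Proof.
split=> [dp d k c ck|H z].
  have [f] := dp _ (compl_perp ck).
  rewrite -[_ * _]/(evalq p * (to_hq c * yq ^+ k)) -[inj_hquot _]/(inj f) mulrA -evalqC.
  rewrite -rmorphM /= => /evalq_inj_polyR/polyP/(_ d).
  rewrite coefMC coefMXn ltnNge; case: leqP => _ // ->; exact: polyR_fil.
have [q [N ->]] := hqP (z : Q) => /compl_coef qN.
(* The truncated subtraction covers positive degrees: if m - i >= N, then N - (m - i) is 0, and the
   product lies in R_i with i <= m - N. *)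
have pqN m i : (i <= m)%N ->
    if (N <= m)%N then fil (m - N) (p`_i * q`_(m - i)) else p`_i * q`_(m - i) = 0.
  move=> im; have := H i _ _ (qN (m - i)%N).
  have -> : (N - (m - i) <= i)%N = (N <= m)%N by lia.
  by case: leqP => // Nm; apply: fil_le; lia.
have [|r [Er rE]] := @poly_divXn _ (p * q) N.
  move=> d dN; rewrite coefM big1 // => i _.
  by have := pqN d i (leq_ord i); rewrite leqNgt dN.
have [|f Ef] := @polyR_onto _ _ _ r.
  move=> d; rewrite rE coefM; apply: (subspace_sum (fil_subspace X d)) => i _.
  by have := pqN _ i (leq_ord i); rewrite leq_addl addnK.
exists f; rewrite -[_ * _]/(evalq p * (evalq q * yq ^+ N)) mulrA -rmorphM /=.
by apply/evalq_inj_polyR; rewrite Er Ef.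
Qed.

Lemma compl_fin z : compl z -> exists (N : nat) f, inj (x0 X ^+ N) * z = inj f.
Proof.
have [q [N ->]] := hqP z => _; have [M [f Ef]] := polyR_shift q.
exists (M + N)%N, f; rewrite mulrA rmorphXn /= -[inj (x0 X)]evalq_polyR polyR_x0 /=.
rewrite -rmorphXn -rmorphM; apply/evalq_inj_polyR.
by rewrite exprD mulrAC -Ef.
Qed.

(* As 1 lies in the complementary module, an R-linear map phi on it is the
   multiplication by phi(1). *)
Lemma trace_diff f : trace_compl sigma f ->
  exists (m : nat) (d c : 'I_m -> Q),
    [/\ forall k, diff (d k), forall k, compl (c k) & inj f = \sum_k d k * c k].
Proof.
case=> m [phi [c [phiP cP ->]]].
have phiM k : exists h : R, forall z, compl z -> inj (phi k z) = inj h * z.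
  have [l [g [e [gP gE]]]] := phiP k.
  exists (\sum_i g i 1) => z Cz; rewrite gE // !rmorph_sum mulr_suml.
  apply: eq_bigr => i _ /=; have [[_ _ gM] _] := gP i.
  have [N [h hE]] := compl_fin Cz.
  (* Linearity compares x0^N z with h 1; afterwards x0^N is cancelled, being invertible in
     Q^h(R). *)
  have E : x0 X ^+ N * g i z = h * g i 1.
    rewrite -(gM (x0 X ^+ N)) // -(gM h) ?compl1 //; last exact: compl1.
    by congr (g i _); rewrite -[LHS]/(inj (x0 X ^+ N) * z) hE -[RHS]/(inj h * 1) mulr1.
  have [M EM] : exists M, (yq : Q) ^+ M * inj (x0 X ^+ N) = 1.
    by exists N; rewrite mulrC rmorphXn xyqn.
  rewrite -[LHS]mul1r -EM -mulrA -rmorphM E rmorphM /= -hE -!mulrA mulrA.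
  by rewrite EM mul1r mulrC.
have [h hP] := choice phiM.
exists m, (fun k => inj (h k)), c; split=> [k z Cz | // | ].
  by exists (phi k z); rewrite -[_ * _]/(inj (h k) * z) -hP.
by rewrite rmorph_sum; apply: eq_bigr => k _; rewrite /= hP.
Qed.

Lemma trace0 : trace_compl sigma 0.
Proof. by exists 0%N, (fun _ _ => 0), (fun=> 0); split=> [[]|[]|] //;
  rewrite big_ord0. Qed.

Lemma traceD f g : trace_compl sigma f -> trace_compl sigma g ->
  trace_compl sigma (f + g).
Proof.
move=> [m [phi [c [phiP cP ->]]]] [l [psi [e [psiP eP ->]]]].
exists (m + l)%N, (fun k => match split k with inl i => phi i | inr j => psi j end),
  (fun k => match split k with inl i => c i | inr j => e j end); split.
- by move=> k; case: split.
- by move=> k; case: split.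
- rewrite big_split_ord; congr (_ + _); apply: eq_bigr => i _.
    by rewrite -[lshift _ _]/(unsplit (inl i)) unsplitK.
  by rewrite -[rshift _ _]/(unsplit (inr i)) unsplitK.
Qed.

(** Multiplication by a homogeneous element of the different is a homogeneous homomorphism from the
    complementary module to R, so its values lie in the trace. *)
Lemma trace_mono d k a c f : diff (evalq (a *: 'X^d)) -> perp k c -> (k <= d)%N ->
  polyR f = (a * c) *: 'X^(d - k) -> trace_compl sigma f.
Proof.
move=> dD ck kd Ef; set D : Q := evalq _ in dD.
pose phi z : R := xget 0 [set g | inj g = D * z].
have phiE z g : inj g = D * z -> phi z = g.
  move=> gz; apply: inj_inj; rewrite gz.
  by apply: (@xgetPex _ 0 [set g | inj g = D * z]); exists g.
have phiP z : compl z -> inj (phi z) = D * z.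
  by move=> /dD[g gz]; rewrite (phiE z g) // -[inj g]/(inj_hquot g) -gz.
exists 1%N, (fun=> phi), (fun=> (to_hq c * yq ^+ k : Q)); split.
- move=> _; exists 1%N, (fun=> phi), (fun=> d%:Z); split; last first.
    by move=> u _; rewrite big_ord1.
  move=> _; split; first split=> //.
  + move=> u v Cu Cv; apply: phiE.
    by rewrite rmorphD /= !phiP // -mulrDr.
  + move=> b u _ Cu; apply: phiE.
    by rewrite rmorphM /= phiP // mulrCA.
  + move=> i u Cu /gr_hquotP[b [e [l [Eu ->]]]].
    have Ephi : (b * a) *: 'X^(d + e) = polyR (phi u) * 'X^l.
      apply/evalq_inj_polyR; rewrite phiP // {1}Eu -evalqZXn /D mulrA -rmorphM /=.
      by rewrite -scalerAl -scalerAr scalerA -exprD [b * a]mulrC.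
    case: (leqP l (d + e)) => [le_l|lt_l].
      have -> : e%:Z - l%:Z + d%:Z = (d + e - l)%N :> int.
        by rewrite -subzn // PoszD; ring.
      have Eu' : polyR (phi u) = (b * a) *: 'X^(d + e - l).
        by apply: (@polyMXn_inj _ l); rewrite /= -scalerAl -exprD subnK // Ephi.
      apply/gr_coordP; exists (b * a) => //.
      have := polyR_fil (phi u) (d + e - l).
      by rewrite Eu' coefZ coefXn eqxx mulr1.
    have -> : phi u = 0.
      apply: polyR_inj; rewrite rmorph0; apply: (@polyMXn_inj _ l).
      have /polyP/(_ (d + e)%N) := Ephi; rewrite coefMXn lt_l coefZ coefXn eqxx mulr1.
      by move=> ab0; rewrite /= -Ephi ab0 scale0r mul0r.
    by case: (_ + _) => // j; exists 0; rewrite ?dhomog0 ?rmorph0.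
- by move=> _; apply: compl_perp.
- rewrite big_ord1; symmetry; apply: phiE.
  rewrite /D -evalqC mulrA -rmorphM /=; symmetry; apply/evalq_inj_polyR.
  by rewrite Ef -[RHS]scalerAl -exprD subnK // -scalerAl mulrC mul_polyC scalerA.
Qed.

End Dedekind.

(** * Duality and the degrees of the different and the trace *)

Section Duality.
Variables (K : fieldType) (n : nat) (X : aff_scheme K n).
Local Notation R := (coord_ring X).
Local Notation A := (aff X).
Local Notation Q := (hq X).
Implicit Types (f : R) (p q : {poly A}) (z w : Q) (a c v x y : A).

Variable sigma : hquot X -> hquot X.
Hypothesis sigma_tr : trace_map sigma.
Let tl := tau_linear sigma_tr.
Local Notation tau := (tau sigma).
Local Notation compl := (complementary sigma : set Q).
Local Notation diff := (different sigma : set Q).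

(** Double orthogonal: an element outside R_k is detected by some [c] orthogonal to R_k. The index
    is [k.+1] since [perp] tests the degrees strictly below its index. *)
Lemma perp_perp k y : (forall c, perp sigma k.+1 c -> tau (c * y) = 0) -> fil k y.
Proof.
move=> Py; apply: contrapT => /(tau_separate sigma_tr (fil_subspace X k))[c [cU]].
by apply; apply: Py => j v jk vj; apply: cU; apply: fil_le vj.
Qed.

Variable r : nat.
Hypothesis fil_r : forall d a, (r <= d)%N -> fil d a.

(* The Cayley-Bacharach property: no nonzero ideal of A lies in a component of
   degree less than r. *)
Definition no_ideal : Prop :=
  forall i a, (i < r)%N -> (forall x, fil i (a * x)) -> a = 0.

(** Here [c] is orthogonal to R_r = A. Hence the complementary module vanishes in degrees below
    -r. *)
Lemma perp_gt k c : (r < k)%N -> perp sigma k c -> c = 0.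
Proof.
move=> rk ck; apply: (tau_nondegenerate sigma_tr) => a.
by apply: (ck r) => //; apply: fil_r.
Qed.

(** The dual form of the claim that [perp r] generates the unit ideal: the hypothesis puts the ideal
    yA into the double orthogonal R_(r-1), and [no_ideal] applies. For r = 0 every element lies in
    [perp r], and nondegeneracy suffices. *)
Lemma perp_gen y : no_ideal -> (forall c x, perp sigma r c -> tau (c * (y * x)) = 0) ->
  y = 0.
Proof.
move=> noI Py; case Er: r => [|k].
  apply: (tau_nondegenerate sigma_tr) => a; rewrite mulrC -[y]mulr1.
  by apply: Py => j v; rewrite Er.
apply: (noI k); first by rewrite Er.
by move=> x; apply: perp_perp => c; rewrite -Er => /Py.
Qed.

Lemma diff_mono d a :
  (forall k c, (k <= r)%N -> perp sigma k c ->
    if (k <= d)%N then fil (d - k) (a * c) else a * c = 0) ->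
  diff (evalq (a *: 'X^d)).
Proof.
move=> H; apply/(diffP sigma_tr) => e k c ck; rewrite coefZ coefXn.
case: eqP => [->|_]; last first.
  by rewrite mulr0 mul0r; case: ifP => // _; apply: (fil_subspace X _).1.
rewrite mulr1; case: (leqP k r) => [kr|rk]; first exact: H.
by rewrite (perp_gt rk ck) mulr0; case: ifP => // _; apply: (fil_subspace X _).1.
Qed.

(** For k <= r the product with an element of degree -k has degree d - k >= r, where the component
    of R is all of A. *)
Lemma diff_high d a : (r + r <= d)%N -> diff (evalq (a *: 'X^d)).
Proof.
move=> rd; apply: diff_mono => k c kr _.
have -> : (k <= d)%N by lia.
by apply: fil_r; lia.
Qed.

(** Let [B] be the set of all a whose multiples in degree d lie in the trace. It contains x c for x
    in A and c in [perp r], because (x T^(d+r)) (c T^(-r)) is a product of elements of the different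
    and the complementary module. A form tau(g _) vanishing on [B] has g = 0 by [perp_gen], so [B]
    is all of A. *)
Lemma trace_high d f : no_ideal -> (r <= d)%N ->
  (exists a, polyR f = a *: 'X^d) -> trace_compl sigma f.
Proof.
move=> noI rd.
have onto a : exists g, polyR g = a *: 'X^d.
  apply: polyR_onto => e; rewrite coefZ coefXn; case: eqP => [->|_].
    by rewrite mulr1; apply: fil_r.
  by rewrite mulr0; apply: (fil_subspace X _).1.
pose B : set A := [set a | forall x g, polyR g = (x * a) *: 'X^d -> trace_compl sigma g].
have sB : subspace B.
  split=> [x g|k a b Ba Bb x g].
    rewrite mulr0 scale0r -(rmorph0 polyR) => /polyR_inj->.
    exact: trace0.
  rewrite mulrDr -aff_scaleAr aff_scaleAl scalerDl => Eg.
  have [g1 E1] := onto (k *: x * a); have [g2 E2] := onto (x * b).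
  have -> : g = g1 + g2 by apply: polyR_inj; rewrite rmorphD /= E1 E2.
  by apply: traceD; [apply: (Ba (k *: x)) | apply: (Bb x)].
case=> a Ef; apply: (_ : B a) (1) _ _; last by rewrite mul1r.
apply: contrapT => /(tau_separate sigma_tr sB)[g [gB]]; apply.
rewrite (_ : g = 0) ?mul0r ?(linear_f0 tl) //.
apply: (perp_gen noI) => c x ck.
rewrite mulrCA; apply: gB => y h; rewrite mulrA => Eh.
have dD := @diff_high (d + r) (y * x) (leq_add rd (leqnn r)).
apply: (trace_mono sigma_tr dD ck); first exact: leq_addl.
by rewrite addnK Eh; congr (_ *: _); ring.
Qed.

Lemma trace_ge f : no_ideal -> (forall d, (d < r)%N -> (polyR f)`_d = 0) ->
  trace_compl sigma f.
Proof.
move=> noI f0.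
have ex d : exists g, polyR g = (polyR f)`_d *: 'X^d.
  apply: polyR_onto => e; rewrite coefZ coefXn; case: eqP => [->|_].
    by rewrite mulr1; apply: polyR_fil.
  by rewrite mulr0; apply: (fil_subspace X _).1.
have [g gP] := choice ex.
have -> : f = \sum_(d < size (polyR f)) g d.
  apply: polyR_inj; rewrite rmorph_sum -[LHS]coefK poly_def.
  by apply: eq_bigr => d _; rewrite /= gP.
apply: (big_ind (trace_compl sigma)) => [||d _]; [exact: trace0|exact: traceD|].
case: (ltnP d r) => [dr|rd]; last by apply: (trace_high noI rd); exists (polyR f)`_d.
have -> : g d = 0 by apply: polyR_inj; rewrite gP f0 // scale0r rmorph0.
exact: trace0.
Qed.

(* The conductor, transported to A[T]. *)
Definition cond p := forall d x, fil d (p`_d * x).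

Lemma cond_ge f : (forall d, (d < r)%N -> (polyR f)`_d = 0) -> cond (polyR f).
Proof.
move=> f0 d x; case: (ltnP d r) => [dr|rd]; last exact: fil_r.
by rewrite f0 // mul0r; apply: (fil_subspace X _).1.
Qed.

Lemma cond_trace p : no_ideal -> cond p ->
  exists2 f, trace_compl sigma f & polyR f = p.
Proof.
move=> noI cp; have [|f Ef] := @polyR_onto _ _ _ p.
  by move=> d; rewrite -[p`_d]mulr1.
exists f => //; apply: trace_ge => // d dr; rewrite Ef.
exact: (noI d).
Qed.

Definition diff_is_minimal : Prop :=
  forall z, diff z <-> exists2 f, (forall d, (d < r + r)%N -> (polyR f)`_d = 0) & z =
    inj f.

Lemma minimal_no_ideal : diff_is_minimal -> no_ideal.
Proof.
move=> dmin i a ir ai.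
have [|f f0 Ef] := (dmin (evalq (a *: 'X^((r + r).-1)))).1.
  (* For k <= r the degree 2r - 1 - k is at least r - 1 >= i. *)
  apply: diff_mono => k c kr _; have -> : (k <= (r + r).-1)%N by lia.
  by apply: fil_le (ai c); lia.
have := f0 (r + r).-1; rewrite (_ : polyR f = a *: 'X^((r + r).-1)).
  by rewrite coefZ coefXn eqxx mulr1; apply; lia.
by apply: evalq_inj; rewrite evalq_polyR -Ef.
Qed.

Lemma minimal_trace f : diff_is_minimal -> trace_compl sigma f ->
  forall d, (d < r)%N -> (polyR f)`_d = 0.
Proof.
move=> dmin /(trace_diff sigma_tr)[m [D [c [dD cC Ef]]]].
have ex k : exists q, D k * c k = evalq (q * 'X^r).
  have [g g0 Eg] := (dmin _).1 (dD k).
  have [q [N Ec]] := hqP (c k).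
  have [|s [Es _]] := @poly_divXn _ (polyR g * q) (r + N).
    move=> d dN; rewrite coefM big1 // => i _.
    (* A nonzero term needs i >= 2r; then d < r + N leaves the degree d - i - N < -r for the second
       factor, which is therefore 0. *)
    case: (ltnP i (r + r)) => [ir|ri]; first by rewrite g0 // mul0r.
    have := cC k; rewrite Ec => /(compl_coef sigma_tr) qN.
    have id := leq_ord i; have rk : (r < N - (d - i))%N by lia.
    by rewrite (perp_gt rk (qN (d - i)%N)) mulr0.
  exists s; rewrite Eg Ec -evalq_polyR mulrA -rmorphM /=.
  by apply/evalq_yE0; rewrite Es exprD mulrA.
have [q qP] := choice ex => d dr.
have -> : polyR f = (\sum_k q k) * 'X^r.
  apply: evalq_inj; rewrite evalq_polyR Ef mulr_suml rmorph_sum.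
  by apply: eq_bigr => k _; rewrite qP.
by rewrite coefMXn dr.
Qed.

Lemma minimalP :
  (no_ideal /\ forall p, cond p <-> exists2 f, trace_compl sigma f & polyR f = p) <->
  diff_is_minimal.
Proof.
split=> [[noI condT]|dmin]; last first.
  have noI := minimal_no_ideal dmin; split=> // p; split; first exact: cond_trace.
  by case=> f fT <-; apply: cond_ge; apply: minimal_trace.
move=> z; split=> [dz|[f f0 ->]]; last first.
  rewrite -evalq_polyR; apply/(diffP sigma_tr) => d k c ck.
  case: (ltnP d (r + r)) => dr.
    by rewrite f0 // mul0r; case: ifP => // _; apply: (fil_subspace X _).1.
  have := (diffP sigma_tr _).1 (@diff_high d (polyR f)`_d dr) d k c ck.
  by rewrite coefZ coefXn eqxx mulr1.
have [f Ef] := diff_inj sigma_tr dz; exists f => // d dr.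
move: dz; rewrite Ef -evalq_polyR => /(diffP sigma_tr) dz.
set a := (polyR f)`_d.
have dD : diff (evalq (a *: 'X^d)) by apply: diff_mono => k c _; apply: dz.
have ac0 c : perp sigma r c -> a * c = 0.
  move=> cr; have := dz d r c cr; case: (leqP r d) => // rd fac.
  have [|g Eg] := @polyR_onto _ _ _ ((a * c) *: 'X^(d - r)).
    move=> e; rewrite coefZ coefXn; case: eqP => [->|_]; first by rewrite mulr1.
    by rewrite mulr0; apply: (fil_subspace X _).1.
  have gT := trace_mono sigma_tr dD cr rd Eg.
  have cg : cond (polyR g) by apply/condT; exists g.
  apply: (noI (d - r)%N); first by lia.
  by move=> x; have := cg (d - r)%N x; rewrite Eg coefZ coefXn eqxx mulr1.
apply: (perp_gen noI) => c x cr.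
by rewrite mulrA [c * a]mulrC ac0 // mul0r (linear_f0 tl).
Qed.

End Duality.

(** * Local rings *)

Section Stalks.
Variables (K : fieldType) (n : nat) (Y : proj_scheme K n) (x : proj_point K n).
Local Notation P := {mpoly K[n.+1]}.
Implicit Types (F G H U : P).

Definition stfrac F G : stalk Y x :=
  to_stalk (Defs.frac (homog_away Y x) (cls Y F) (cls Y G)).

Lemma pt1 : ~ x 1.
Proof.
by have [i xi] := pt_relevant x => x1; apply: xi; rewrite -['X_i]mulr1; apply: idealM.
Qed.

Lemma ptM F G : ~ x F -> ~ x G -> ~ x (F * G).
Proof. by move=> xF xG /pt_prime[]. Qed.

Let cM F G : cls Y (F * G) = cls Y F * cls Y G.
Proof. exact: quot_piM. Qed.

Let cD F G : cls Y (F + G) = cls Y F + cls Y G.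
Proof. exact: quot_piD. Qed.

Let cN F : cls Y (- F) = - cls Y F.
Proof. exact: quot_piN. Qed.

Let c0 F : cls Y F = 0 <-> Y F.
Proof. by rewrite -[0]/(cls Y 0) quot_piE subr0. Qed.

Lemma val_stfrac d F G : F \is d.-homog -> G \is d.-homog -> ~ x G ->
  val (stfrac F G) = Defs.frac (homog_away Y x) (cls Y F) (cls Y G).
Proof. by move=> hF hG xG; rewrite insubdK //; apply/asboolP; exists d, F, G. Qed.

Lemma stalkP (z : stalk Y x) : exists d F G,
  [/\ F \is d.-homog, G \is d.-homog, ~ x G & z = stfrac F G].
Proof.
have /asboolP[d [F [G [hF hG xG E]]]] := valP z.
by exists d, F, G; split=> //; apply: val_inj; rewrite E (val_stfrac hF hG xG).
Qed.

Lemma stfrac_eq d e F G F' G' : F \is d.-homog -> G \is d.-homog -> ~ x G ->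
  F' \is e.-homog -> G' \is e.-homog -> ~ x G' ->
  (stfrac F G = stfrac F' G') <->
  exists m U, [/\ U \is m.-homog, ~ x U & Y (U * (F * G' - F' * G))].
Proof.
move=> hF hG xG hF' hG' xG'.
have sG := homog_awayP Y hG xG; have sG' := homog_awayP Y hG' xG'.
split=> [/(congr1 val)|[m [U [hU xU YU]]]].
  rewrite (val_stfrac hF hG xG) (val_stfrac hF' hG' xG').
  case/(frac_eq _ _ sG sG') => _ [m [U [hU xU ->]]] E; exists m, U; split=> //.
  by apply/c0; rewrite cM cD cN !cM.
apply: val_inj; rewrite (val_stfrac hF hG xG) (val_stfrac hF' hG' xG').
apply/(frac_eq _ _ sG sG'); exists (cls Y U); first exact: homog_awayP hU xU.
by rewrite -(cM F G') -(cM F' G) -cN -cD -cM; apply/c0.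
Qed.

Lemma stfracM d e F G F' G' : F \is d.-homog -> G \is d.-homog -> ~ x G ->
  F' \is e.-homog -> G' \is e.-homog -> ~ x G' ->
  stfrac F G * stfrac F' G' = stfrac (F * F') (G * G').
Proof.
move=> hF hG xG hF' hG' xG'; apply: val_inj; rewrite rmorphM /=.
rewrite (val_stfrac hF hG xG) (val_stfrac hF' hG' xG').
rewrite (val_stfrac (dhomogM hF hF') (dhomogM hG hG')) ?fracM ?cM //; last exact: ptM.
  exact: homog_awayP hG xG.
exact: homog_awayP hG' xG'.
Qed.

Lemma stfracD d F F' G : F \is d.-homog -> F' \is d.-homog -> G \is d.-homog -> ~ x G ->
  stfrac F G + stfrac F' G = stfrac (F + F') G.
Proof.
move=> hF hF' hG xG; have sG := homog_awayP Y hG xG.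
apply: val_inj; rewrite rmorphD /= (val_stfrac hF hG xG) (val_stfrac hF' hG xG).
rewrite (val_stfrac _ hG xG) ?rpredD // fracD //.
apply/(frac_eq _ _ (mulsetM sG sG) sG); exists 1; first exact: mulset1.
by rewrite cD; ring.
Qed.

Lemma stfracN d F G : F \is d.-homog -> G \is d.-homog -> ~ x G ->
  - stfrac F G = stfrac (- F) G.
Proof.
move=> hF hG xG; apply: val_inj; rewrite rmorphN /= (val_stfrac hF hG xG).
rewrite (val_stfrac _ hG xG) ?rpredN // fracN ?cN //.
exact: homog_awayP hG xG.
Qed.

Lemma stfrac0 d G : G \is d.-homog -> ~ x G -> stfrac 0 G = 0.
Proof.
move=> hG xG; have h0 : (0 : P) \is d.-homog by apply: rpred0.
have := stfracD h0 h0 hG xG.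
by rewrite addr0 => /(canRL (addrK _)); rewrite subrr.
Qed.

Lemma stfrac_self d G : G \is d.-homog -> ~ x G -> stfrac G G = 1.
Proof.
move=> hG xG; apply: val_inj; rewrite (val_stfrac hG hG xG) rmorph1 -frac1.
have sG := homog_awayP Y hG xG.
apply/(frac_eq _ _ sG (mulset1 _)); exists 1; first exact: mulset1.
by rewrite !mul1r mulr1 subrr.
Qed.

Lemma stfracZ (k : K) d F G : F \is d.-homog -> G \is d.-homog -> ~ x G ->
  k *: stfrac F G = stfrac (k *: F) G.
Proof.
move=> hF hG xG.
have hk : (k%:MP : P) \is 0.-homog by rewrite -[k%:MP]mulr1; apply/homogC/homog1.
rewrite -[_ *: _]/(stalk_scalar Y x k * _).
have -> : stalk_scalar Y x k = stfrac k%:MP 1.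
  apply: val_inj; rewrite stalk_scalarE; symmetry.
  have := val_stfrac hk (homog1 _ _) pt1; rewrite [cls Y 1]quot_pi1.
  exact.
by rewrite (stfracM hk (homog1 _ _) pt1 hF hG xG) mul1r mul_mpolyC.
Qed.

Lemma stfrac_eq0 d F G : F \is d.-homog -> G \is d.-homog -> ~ x G ->
  stfrac F G = 0 <-> exists m U, [/\ U \is m.-homog, ~ x U & Y (U * F)].
Proof.
have h0 : (0 : P) \is d.-homog by apply: rpred0.
move=> hF hG xG; rewrite -(stfrac0 hG xG) (stfrac_eq hF hG xG h0 hG xG).
split=> [[m [U [hU xU YU]]]|[m [U [hU xU YU]]]].
  exists (m + d)%N, (U * G); split; [exact: dhomogM|exact: ptM|].
  by move: YU; rewrite mul0r subr0 mulrA mulrAC.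
by exists m, U; split=> //; rewrite mul0r subr0 mulrA; apply: idealMr.
Qed.

Lemma stalk_pair (z w : stalk Y x) : exists d F F' G,
  [/\ [/\ F \is d.-homog, F' \is d.-homog & G \is d.-homog], ~ x G,
      z = stfrac F G & w = stfrac F' G].
Proof.
have [d [F [G [hF hG xG ->]]]] := stalkP z.
have [e [F' [G' [hF' hG' xG' ->]]]] := stalkP w.
exists (d + e)%N, (F * G'), (G * F'), (G * G'); split; first by split; apply: dhomogM.
- exact: ptM.
- by rewrite -(stfracM hF hG xG hG' hG' xG') (stfrac_self hG' xG') mulr1.
- by rewrite -(stfracM hG hG xG hF' hG' xG') (stfrac_self hG xG) mul1r.
Qed.

End Stalks.

Section StalkMap.
Variables (K : fieldType) (n : nat) (X Y : proj_scheme K n) (x : proj_point K n).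
Hypothesis XY : forall F, X F -> Y F.
Local Notation P := {mpoly K[n.+1]}.
Implicit Types (F G H U : P).

Let qmap (f : coord_ring X) : coord_ring Y := @quot_map _ X Y f.

Let qmapE F : qmap (cls X F) = cls Y F.
Proof. by apply/quot_piE/XY/quot_repr. Qed.

(** [stalk_map] works on a chosen representative F'/G'. Its equality with F/G on X is witnessed by
    some U (F' G - F G') in the ideal of X, and this witness remains valid on Y. *)
Lemma stalk_mapE d F G : F \is d.-homog -> G \is d.-homog -> ~ x G ->
  @stalk_map _ _ X Y x (stfrac X x F G) = stfrac Y x F G.
Proof.
move=> hF hG xG; have sG := homog_awayP X hG xG.
rewrite /stalk_map /stfrac -/(stfrac X x F G) (val_stfrac X hF hG xG).
congr to_stalk; rewrite /loc_map; set z := Defs.frac (homog_away X x) _ _.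
have : loc_pi (repr z) = z by apply: loc_reprK.
case: (repr z) => f sg; have [e [G' [hG' xG' Eg]]] := denomP sg.
have [F' ->] : exists F', f = cls X F' by exists (repr f); rewrite /cls quot_reprK.
have sG' := homog_awayP X hG' xG'.
have -> : loc_pi (cls X F', sg) = Defs.frac (homog_away X x) (cls X F') (cls X G').
  by congr (loc_pi (_, _)); apply: val_inj; rewrite Eg val_denom.
case/(frac_eq _ _ sG' sG) => _ [m [U [hU xU ->]]] E.
rewrite /= Eg -[quot_map Y _]/(qmap (cls X F')) -[quot_map Y _]/(qmap (cls X G')) !qmapE.
apply/frac_eq; [exact: homog_awayP hG' xG' | exact: homog_awayP hG xG|].
exists (cls Y U); first exact: homog_awayP hU xU.
have clsE (Z : proj_scheme K n) : cls Z (U * (F' * G - F * G')) =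
    cls Z U * (cls Z F' * cls Z G - cls Z F * cls Z G').
  by rewrite /cls quot_piM quot_piD quot_piN !quot_piM.
rewrite -clsE; move: E; rewrite -clsE -[0]/(cls X 0) => /quot_piE;
  rewrite subr0 => /XY YE.
by rewrite -[RHS]/(cls Y 0); apply/quot_piE; rewrite subr0.
Qed.

Lemma stalk_map_linear : linear (@stalk_map _ _ X Y x).
Proof.
move=> k z w; have [d [F [F' [G [[hF hF' hG] xG -> ->]]]]] := stalk_pair z w.
rewrite (stfracZ _ _ hF hG xG) (stfracD _ _ hF' hG xG) ?rpredZ //.
rewrite !(@stalk_mapE d) ?rpredD ?rpredZ //.
by rewrite (stfracZ _ _ hF hG xG) (stfracD _ _ hF' hG xG) ?rpredZ.
Qed.

End StalkMap.

Section UnitPower.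
Variable B : comPzRingType.
Implicit Types u v w : B.

Lemma unit_power_cancel u v w k : u * w = 1 -> u ^+ k = u ^+ k.+1 * v -> u * v = 1.
Proof.
move=> uw E; have uwk : u ^+ k * w ^+ k = 1 by rewrite -exprMn uw expr1n.
by rewrite -[RHS]uwk E exprS -[LHS]mulr1 -{1}uwk; ring.
Qed.

(** Iterating the hypothesis gives u^k = u^k u^j v^j for every j; the case j = k is used. *)
Lemma power_idempotent u v k : u ^+ k = u ^+ k.+1 * v ->
  u ^+ k * v ^+ k * (u ^+ k * v ^+ k) = u ^+ k * v ^+ k.
Proof.
move=> E; have Ej j : u ^+ k = u ^+ k * (u ^+ j * v ^+ j).
  elim: j => [|j IH]; first by rewrite !mulr1.
  by rewrite {1}IH {1}E !exprS; ring.
by rewrite mulrAC -Ej.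
Qed.

End UnitPower.

(** * Germs of the elements of A at a point *)

Section ToLocal.
Variables (K : fieldType) (n : nat) (X : aff_scheme K n) (x : supp X).
Local Notation P := {mpoly K[n.+1]}.
Local Notation A := (aff X).
Local Notation O := (local_ring x).
Implicit Types (F G H U : P) (a b : A).

Let xX0 N : ~ x ('X_ord0 ^+ N) := @point_X0n K n X x N.
Let hX0 N : ('X_ord0 ^+ N : P) \is N.-homog := homogX0 K n N.

Definition to_local (a : A) : O :=
  let N := xget 0%N [set N | fil N a] in
  stfrac X x (xget 0 [set F | F \is N.-homog /\ a = affc F]) ('X_ord0 ^+ N).

Lemma to_localE d F : F \is d.-homog -> to_local (affc F) = stfrac X x F ('X_ord0 ^+ d).
Proof.
move=> hF; rewrite /to_local; set a := affc F; set N := xget 0%N _.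
have [G hG Ea] : fil N a.
  by apply: (@xgetPex _ 0%N [set N | fil N a]); exists d, F.
set H := xget _ _; have [hH EH] : H \is N.-homog /\ a = affc H.
  by apply: (@xgetPex _ 0 [set F | F \is N.-homog /\ a = affc F]); exists G.
apply/(stfrac_eq X hH (hX0 N) (@xX0 N) hF (hX0 d) (@xX0 d)).
exists 0%N, 1; split; [exact: homog1 | exact: point1 |].
rewrite mul1r; apply: (@affc_homog_eq0 _ _ _ (N + d)).
  by apply: rpredB; [|rewrite addnC]; apply: dhomogM.
by rewrite rmorphB /= ![_ * 'X_ord0 ^+ _]mulrC !affc_X0M -EH subrr.
Qed.

Lemma to_local_zmod : zmod_morphism to_local.
Proof.
move=> a b; have [N [F [G [hF hG -> ->]]]] := fil_common a b.
rewrite -rmorphB /= (to_localE (d := N)) ?rpredB // (to_localE hF) (to_localE hG).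
by rewrite (stfracN X hG (hX0 N)) // (stfracD X hF _ (hX0 N)) ?rpredN.
Qed.

Lemma to_local_monoid : monoid_morphism to_local.
Proof.
split=> [|a b].
  by rewrite -(rmorph1 affc) (to_localE (homog1 _ _)) (stfrac_self X (homog1 _ _)) //;
    apply: point1.
have [N [F [G [hF hG -> ->]]]] := fil_common a b.
rewrite -rmorphM /= (to_localE (dhomogM hF hG)) (to_localE hF) (to_localE hG) exprD.
by rewrite -(stfracM X hF (hX0 N) _ hG (hX0 N)).
Qed.
HB.instance Definition _ := GRing.isZmodMorphism.Build _ _ to_local to_local_zmod.
HB.instance Definition _ := GRing.isMonoidMorphism.Build _ _ to_local to_local_monoid.

Lemma to_localZ k a : to_local (k *: a) = k *: to_local a.
Proof.
have [N /(_ N (leqnn _)) [F hF ->]] := filP a.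
rewrite -affcZ (to_localE (d := N)) ?rpredZ // (to_localE hF).
by rewrite -(stfracZ X k hF (hX0 N)).
Qed.

Lemma to_local_linear : linear to_local.
Proof. by move=> k a b; rewrite rmorphD /= to_localZ. Qed.

Lemma to_local_eq0 d F : F \is d.-homog ->
  to_local (affc F) = 0 <-> exists m U, [/\ U \is m.-homog, ~ x U & X (U * F)].
Proof.
move=> hF; rewrite (to_localE hF).
exact: (stfrac_eq0 X hF (hX0 d) (@xX0 d)).
Qed.

Lemma germE d F : F \is d.-homog -> germ x d (cls X F) = to_local (affc F).
Proof. by move=> hF; rewrite (to_localE hF) /stfrac rmorphXn. Qed.

Lemma stfrac_unit d F G : F \is d.-homog -> G \is d.-homog -> ~ x F -> ~ x G ->
  stfrac X x F G * stfrac X x G F = 1.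
Proof.
move=> hF hG xF xG; rewrite (stfracM X hF hG xG hG hF xF) mulrC.
by rewrite (stfrac_self X (dhomogM hG hF)) //; apply: ptM.
Qed.

Lemma max_idealP d F G : F \is d.-homog -> G \is d.-homog -> ~ x G ->
  max_ideal O (stfrac X x F G) <-> x F.
Proof.
move=> hF hG xG; split=> [nu|xF [z]].
  apply: contrapT => xF; apply: nu; exists (stfrac X x G F); exact: (stfrac_unit hF hG).
have [e [F' [G' [hF' hG' xG' ->]]]] := stalkP (z : stalk X x).
rewrite -[_ * _]/(stfrac X x F G * stfrac X x F' G') (stfracM X hF hG xG hF' hG' xG').
have h1 := homog1 K n; have x1 := @point1 _ _ X x.
rewrite -[1]/(1 : stalk X x) -(stfrac_self X h1 x1).
case/(stfrac_eq X (dhomogM hF hF') (dhomogM hG hG') (ptM xG xG') h1 h1 x1) => m [U [_ xU]].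
move/(@supp_sub _ _ _ x)/pt_prime => [//|]; rewrite mulr1 mul1r => xB.
by case: (ptM xG xG'); apply: idealBl xB _; apply: idealMr.
Qed.

Lemma to_local_max d F : F \is d.-homog -> max_ideal O (to_local (affc F)) <-> x F.
Proof. by move=> hF; rewrite (to_localE hF); apply: max_idealP (hX0 d) (@xX0 d). Qed.

Lemma local_unit_sub (z : O) : max_ideal O z -> exists w, (1 - z) * w = 1.
Proof.
have [d [F [G [hF hG xG ->]]]] := stalkP (z : stalk X x).
move=> /(max_idealP hF hG xG) xF; exists (stfrac X x G (G - F)).
have xGF : ~ x (G - F) by move=> /idealBr /(_ xF).
have -> : 1 - stfrac X x F G = stfrac X x (G - F) G :> O.
  rewrite -[1]/(1 : stalk X x) -(stfrac_self X hG xG).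
  by rewrite -[- _]/(- stfrac X x F G) (stfracN X hF hG xG) -(stfracD X hG _ hG xG) ?rpredN.
have hGF : G - F \is d.-homog by apply: rpredB.
exact: (stfrac_unit hGF hG).
Qed.

Lemma local_nonunit (z : O) : (exists w, z * w = 1) \/ max_ideal O z.
Proof. by case: (pselect (exists w, z * w = 1)) => H; [left|right]. Qed.

Lemma max_idealM (z w : O) : max_ideal O z -> max_ideal O (z * w).
Proof. by move=> nz [u zwu]; apply: nz; exists (w * u); rewrite mulrA. Qed.

Lemma max_idealD (z w : O) : max_ideal O z -> max_ideal O w -> max_ideal O (z + w).
Proof.
move=> mz mw [u zwu]; have [v] := local_unit_sub (@max_idealM z u mz).
have -> : 1 - z * u = w * u by rewrite -zwu mulrDl addrAC subrr add0r.
by rewrite -mulrA => wv; apply: mw; exists (u * v).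
Qed.

Hypothesis fA : findim A.

(** The ideals a^k A descend; [k] belongs to one of smallest dimension. *)
Lemma fitting (a : A) : exists k b, a ^+ k = a ^+ k.+1 * b.
Proof.
pose I k : set A := [set y | exists b, y = a ^+ k * b].
have sI k : subspace (I k).
  split=> [|c _ _ [u ->] [v ->]]; first by exists 0; rewrite mulr0.
  by exists (c *: u + v); rewrite mulrDr -aff_scaleAr.
pose Q m := `[< exists k, kdim (I k) [set 0] = m >].
have exQ : exists m, Q m by exists (kdim (I 0%N) [set 0]); apply/asboolP; exists 0%N.
case: (ex_minnP exQ) => m /asboolP[k km] mmin; exists k.
have sub : I k.+1 `<=` I k by move=> _ [b ->]; exists (a * b); rewrite exprSr mulrA.
have [||b Eb] := kdim_sub_eq fA (sI k.+1) (sI k) sub _ (_ : I k (a ^+ k)).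
- by rewrite km; apply: mmin; apply/asboolP; exists k.+1.
- by exists 1; rewrite mulr1.
by exists b.
Qed.

(** Where the germ of [a] is a unit, its k-th power cancels from the relation of [fitting], which
    leaves a b = 1. *)
Lemma to_local_inv (a : A) : (exists w, to_local a * w = 1) ->
  exists b, to_local a * to_local b = 1.
Proof.
move=> [w aw]; have [k [b Ek]] := fitting a; exists b.
have /(congr1 to_local) := Ek; rewrite !rmorphM !rmorphXn /=.
exact: unit_power_cancel aw.
Qed.

(** Denominators are already invertible in the image of A, so the local ring is a quotient of A. *)
Lemma to_local_onto (z : O) : exists a, to_local a = z.
Proof.
have [d [F [G [hF hG xG Ez]]]] := stalkP (z : stalk X x).
have xX : ~ x ('X_ord0 ^+ d) by apply: xX0.
have [|b Gb] := @to_local_inv (affc G).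
  exists (stfrac X x ('X_ord0 ^+ d) G); rewrite (to_localE hG).
  exact: (stfrac_unit hG (hX0 d) xG xX).
exists (affc F * b); rewrite rmorphM /= -[RHS]mulr1 -Gb mulrA; congr (_ * _).
rewrite (to_localE hF) (to_localE hG) Ez -[RHS]/(stfrac X x F G * stfrac X x G ('X_ord0 ^+ d)).
rewrite (stfracM X hF hG xG hG (hX0 d) xX).
apply/(stfrac_eq X hF (hX0 d) xX (dhomogM hF hG) (dhomogM hG (hX0 d)) (ptM xG xX)).
by exists 0%N, 1; split; [exact: homog1|exact: point1|rewrite mul1r mulrA subrr;
  apply: ideal0].
Qed.

End ToLocal.

(** * Decomposition of A into the local rings *)

Section Family.
Variables (K : fieldType) (n : nat) (X : aff_scheme K n).
Local Notation P := {mpoly K[n.+1]}.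
Local Notation A := (aff X).
Local Notation R := (coord_ring X).
Implicit Types (F G H U : P) (a b : A) (f : R) (q : {poly A}).

(** The bijection [p] enumerates records, whereas only prime ideals can be separated by polynomials;
    proof irrelevance reconciles the two. *)
Lemma supp_ext (x y : supp X) : (forall F, x F <-> y F) -> x = y.
Proof.
case: x y => [[[I I0 ID IM] Ih Ip Ir] Is] [[[J J0 JD JM] Jh Jp Jr] Js] /= IJ.
have EIJ : I = J by apply/funext => F; apply/propext; apply: IJ.
subst J.
have ? : J0 = I0 by apply: Prop_irrelevance.
have ? : JD = ID by apply: Prop_irrelevance.
have ? : JM = IM by apply: Prop_irrelevance.
subst J0 JD JM.
have ? : Jh = Ih by apply: Prop_irrelevance.
have ? : Jp = Ip by apply: Prop_irrelevance.
have ? : Jr = Ir by apply: Prop_irrelevance.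
subst Jh Jp Jr.
by have -> : Is = Js by apply: Prop_irrelevance.
Qed.

Lemma supp_separate (x y : supp X) : x <> y ->
  exists d G, [/\ G \is d.-homog, y G & ~ x G].
Proof.
move=> xy; apply: contrapT => noG; apply: xy; apply: supp_ext.
have yx F : y F -> x F.
  move=> yF; apply: hc_ideal => d; apply: contrapT => xF; apply: noG.
  by exists d, (hc d F); split=> //; [exact: hc_homog | exact: pt_homog].
by move=> F; split; [apply: (aff_dim X).2 | apply: yx].
Qed.

Hypothesis fA : findim A.

(** Take g vanishing at y but not at x. Its idempotent from [fitting] is 1 at x, where g b = 1, and
    0 at y, where it is an idempotent in the maximal ideal of a local ring. *)
Lemma idempotent_pair (x y : supp X) : x <> y ->
  exists a, to_local x a = 1 /\ to_local y a = 0.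
Proof.
move=> /supp_separate[d [G [hG yG xG]]]; set g : A := affc G.
have [k [b Ek]] := fitting fA g.
(* A positive exponent ensures that the idempotent is a multiple of [g]. *)
have Ek1 : g ^+ k.+1 = g ^+ k.+2 * b by rewrite exprS {1}Ek mulrA -exprS.
exists (g ^+ k.+1 * b ^+ k.+1); split.
  have [[w gw]|] := local_nonunit (to_local x g); last by move/(to_local_max x hG).
  have gb := unit_power_cancel gw;
    rewrite -exprMn rmorphXn rmorphM /= (gb _ k) ?expr1n //.
  by move/(congr1 (to_local x)): Ek; rewrite !rmorphM !rmorphXn.
set e := _ * _; have ee : e * e = e by apply: power_idempotent.
have me : max_ideal (local_ring y) (to_local y e).
  have mg := (to_local_max y hG).2 yG.
  by rewrite /e exprS -mulrA rmorphM; apply: max_idealM mg.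
have [w ew] := local_unit_sub me.
by rewrite -[LHS]mulr1 -ew mulrA mulrBr mulr1 -rmorphM ee subrr mul0r.
Qed.

Variables (s : nat) (p : 'I_s -> supp X).
Hypothesis p_bij : bijective p.
Local Notation pi j := (to_local (p j)).

Lemma joint_inj a b : (forall j, pi j a = pi j b) -> a = b.
Proof.
move=> ab; apply/subr0_eq; have {ab} : forall j, pi j (a - b) = 0.
  by move=> j; rewrite rmorphB /= ab subrr.
have [N /(_ N (leqnn _)) [F hF ->]] := filP (a - b) => F0.
apply/affcX/(local_zero hF) => x; have [q pq qp] := p_bij.
have /(to_local_eq0 _ hF)[m [U [_ xU XU]]] := F0 (q x).
by exists U => //; rewrite -[x]qp.
Qed.

Lemma idempotents j : exists e : A, pi j e = 1 /\ forall k, k != j -> pi k e = 0.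
Proof.
have ex k : exists e : A, pi j e = 1 /\ (k != j -> pi k e = 0).
  case: (eqVneq k j) => [->|kj]; first by exists 1; rewrite rmorph1.
  have [|e [e1 e0]] := @idempotent_pair (p j) (p k); last by exists e.
  by move=> /(bij_inj p_bij) jk; rewrite jk eqxx in kj.
have [e eP] := choice ex; exists (\prod_k e k); split.
  by rewrite rmorph_prod big1 // => k _; have [] := eP k.
move=> k kj; rewrite rmorph_prod (bigD1 k) //= (eP k).2 //.
by rewrite mul0r.
Qed.

Lemma crt (z : forall j, local_ring (p j)) : exists a, forall j, pi j a = z j.
Proof.
have [e eP] := choice idempotents.
pose b j := sval (cid (to_local_onto fA (z j))).
have bP j : pi j (b j) = z j := svalP (cid (to_local_onto fA (z j))).
exists (\sum_j e j * b j) => j;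
  rewrite rmorph_sum (bigD1 j) //= rmorphM /= (eP j).1 mul1r bP.
rewrite big1 ?addr0 // => k kj; rewrite rmorphM /= (eP k).2 ?mul0r //.
by rewrite eq_sym.
Qed.

(** By [theta_inj] and [theta_onto] this identifies A[T] with the ring in which the conductor lives;
    by [itildeE], [itilde] turns into [polyR]. *)
Definition theta q : Rtilde p := fun j => map_poly (pi j) q.

Lemma coef_theta q j d : (theta q j)`_d = pi j q`_d.
Proof. by rewrite coef_map. Qed.

Lemma theta_inj : injective theta.
Proof.
move=> q r qr; apply/polyP => d; apply: joint_inj => j.
by rewrite -!coef_theta qr.
Qed.

Lemma theta_onto (G : Rtilde p) : exists q, theta q = G.
Proof.
have [a aP] := choice (fun d => crt (fun j => (G j)`_d)).
exists (\poly_(d < \max_j size (G j)) a d); apply: functional_extensionality_dep => j.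
apply/polyP => d; rewrite coef_theta coef_poly; case: ltnP => [_|le_d].
  exact: aP.
rewrite rmorph0 nth_default //; apply: leq_trans le_d.
exact: (leq_bigmax j).
Qed.

Lemma thetaM q r : theta (q * r) = fun j => theta q j * theta r j.
Proof. by apply: functional_extensionality_dep => j; apply: rmorphM. Qed.

Lemma itildeE f : itilde p f = theta (polyR f).
Proof.
apply: functional_extensionality_dep => j; apply/polyP => d.
rewrite coef_theta -{2}[f]quot_reprK -/(cls X _) coef_polyR coef_poly.
case: ltnP => [_|le_d]; first by rewrite germE //; apply: hc_homog.
by rewrite hc_large // !rmorph0.
Qed.

(** Constants x as test elements put q_d A into R_d. Conversely, a term q_i g_(d-i) lies in R_i,
    hence in R_d. *)
Lemma conductorP (F : Rtilde p) : conductor p F <-> exists2 q, cond q & F = theta q.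
Proof.
have [q <-] := theta_onto F; split=> [cF|[r cr /theta_inj->] G]; last first.
  have [g <-] := theta_onto G; rewrite -thetaM.
  have [|f Ef] := @polyR_onto _ _ _ (r * g); last by exists f; rewrite itildeE Ef.
  move=> d; rewrite coefM; apply: (subspace_sum (fil_subspace X d)) => i _.
  by apply: (fil_le (leq_ord i)).
exists q => // d x; have [f] := cF (theta x%:P); rewrite -thetaM itildeE => /theta_inj Ef.
by rewrite -coefMC -Ef; apply: polyR_fil.
Qed.

(** The factor of A at p_j as an ideal of A; [pi j] maps it bijectively onto the local ring. *)
Definition supported (j : 'I_s) a := forall k, k != j -> pi k a = 0.

Lemma supported_ex j (z : local_ring (p j)) : exists2 a, supported j a & pi j a = z.
Proof.
have [e [e1 e0]] := idempotents j; have [b Eb] := to_local_onto fA z.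
exists (e * b); last by rewrite rmorphM /= e1 mul1r.
by move=> k kj; rewrite rmorphM /= e0 // mul0r.
Qed.

Lemma supported_inj j a b : supported j a -> supported j b -> pi j a = pi j b -> a = b.
Proof.
move=> sa sb ab; apply: joint_inj => k; case: (eqVneq k j) => [->//|kj].
by rewrite sa ?sb.
Qed.

Lemma supportedM j a x : supported j a -> supported j (a * x).
Proof. by move=> sa k kj; rewrite rmorphM /= sa // mul0r. Qed.

Lemma supported_subspace j : subspace (supported j).
Proof.
split=> [k _|c a b sa sb k kj]; first by rewrite rmorph0.
by rewrite rmorphD /= to_localZ sa // sb // scaler0 addr0.
Qed.

Lemma muE j a : supported j a -> mu (pi j a) = least (fun i => fil i a).
Proof.
move=> sa; congr (least _); apply/seteqP.
have E i : dfwith (fun k => 0 : {poly local_ring (p k)}) (pi j a *: 'X^i) = theta (a *: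
  'X^i).
  apply: functional_extensionality_dep => k; apply/polyP => d;
    rewrite coef_theta coefZ coefXn.
  case: (eqVneq k j) => [->|kj].
    by rewrite dfwith_in coefZ coefXn rmorphM; case: eqP; rewrite ?rmorph1 ?rmorph0.
  by rewrite dfwith_out 1?eq_sym // coef0 rmorphM /= sa // mul0r.
split=> i /= [].
  by move=> f; rewrite E itildeE => /theta_inj Ef; have := polyR_fil f i;
    rewrite Ef coefZ coefXn eqxx mulr1.
move=> F hF Ea; exists (cls X F); rewrite E itildeE; congr theta.
by rewrite (polyR_homog X hF) Ea.
Qed.

End Family.

(** * The Cayley-Bacharach property *)

Section Dimensions.
Variables (K : fieldType) (n : nat) (X : aff_scheme K n).
Local Notation A := (aff X).
Local Notation R := (coord_ring X).
Hypothesis fA : findim A.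
Variables (s : nat) (p : 'I_s -> supp X).
Hypothesis p_bij : bijective p.
Local Notation pi j := (to_local (p j)).

Lemma hilbE i : hilb X i = kdim (fil i) [set (0 : A)].
Proof.
(* Setting T = 1 dehomogenizes. *)
pose f (g : R) : A := (polyR g).[1].
have fE g a : polyR g = a *: 'X^i -> f g = a.
  by rewrite /f => ->; rewrite hornerZ hornerXn expr1n mulr1.
have lf : linear f.
  move=> k g h; rewrite /f rmorphD hornerD; congr (_ + _) => /=.
  have -> : k *: g = cls X k%:MP * g by [].
  rewrite rmorphM /= (polyR_homog X (d := 0)); last first.
    by rewrite -[_%:MP]mulr1; apply/homogC/homog1.
  by rewrite expr0 -mul_polyC mulr1 hornerCM aff_scaleE.
apply: (kdim_iso lf).
- split=> [|k g h [F hF ->] [G hG ->]]; first by exists 0; rewrite ?rpred0 ?rmorph0.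
  exists (k *: F + G); first by rewrite rpredD ?rpredZ.
  by rewrite rmorphD -mul_mpolyC rmorphM.
- exact: subspace0.
- by move=> g /gr_coordP[a ia /fE->].
- move=> g /gr_coordP[a ia Eg] /=; rewrite (fE _ _ Eg); split=> [a0|g0].
    by apply: polyR_inj; rewrite Eg a0 scale0r rmorph0.
  by rewrite -(fE _ _ Eg) g0 /f rmorph0 horner0.
- move=> a [F hF Ea]; exists (cls X F); first by exists F.
  by rewrite (fE _ a) /= ?subrr // (polyR_homog X hF) Ea.
Qed.

(** The successive quotients of this filtration are the local rings, which gives dim A = deg X. *)
Let trunc m : set A := [set a | forall k : 'I_s, (m <= k)%N -> pi k a = 0].

Let trunc_subspace m : subspace (trunc m).
Proof.
split=> [k _|c a b ta tb k mk]; first by rewrite rmorph0.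
by rewrite to_local_linear ta // tb // scaler0 addr0.
Qed.

Lemma deg_kdim : deg p = kdim [set: A] [set 0].
Proof.
have E m : (m <= s)%N -> kdim (trunc m) [set 0] =
    (\sum_(j < s | (j < m)%N) kdim [set: stalk X (p j)] [set 0%R])%N.
  elim: m => [_|m IH ms].
    rewrite big_pred0 // (_ : trunc 0 = [set 0]).
      apply/eqP; rewrite -leqn0; apply: least_le; exists (fun _ : 'I_0 => 0).
      split=> [[]//|v ->]; exists 0; split; first by rewrite big_ord0 subr0.
      by move=> c _; apply/rowP => -[].
    apply/seteqP; split=> [a ta /=|_ -> k _]; last by rewrite rmorph0.
    by apply: (joint_inj p_bij) => j; rewrite ta // rmorph0.
  have sub : trunc m `<=` trunc m.+1 by move=> a ta k mk; apply: ta; apply: ltnW.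
  rewrite (@kdimD _ _ fA [set 0] (trunc m)) //; [|exact: subspace0|]; last first.
    by move=> _ ->; apply: (trunc_subspace m).1.
  rewrite IH ?(ltnW ms) // [RHS](bigD1 (Ordinal ms)) //=; congr (_ + _)%N; last first.
    apply: eq_bigl => j; rewrite ltnS ltn_neqAle -(inj_eq val_inj) /=.
    by rewrite andbC.
  pose j := Ordinal ms; apply: (kdim_iso (@to_local_linear _ _ _ (p j))) => //.
  - exact: subspace0.
  - move=> u tu; split=> [u0 k|tu0]; last exact: (tu0 j).
    rewrite leq_eqVlt => /predU1P[jk|]; last exact: tu.
    by have -> : k = j by apply: val_inj.
  - move=> v _; have [a sa av] := supported_ex fA p_bij v.
    exists a; last by rewrite /= av subrr.
    by move=> k mk; apply: sa; rewrite -(inj_eq val_inj) /= gtn_eqF.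
have := E s (leqnn s); rewrite (_ : trunc s = setT).
  by move=> ->; apply: eq_bigl => j; rewrite ltn_ord.
by apply/seteqP; split=> // a _ k; rewrite leqNgt ltn_ord.
Qed.

Lemma fil_reg d (a : A) : (exists N, forall (b : A) e, (N <= e)%N -> fil e b) ->
  (reg_index p <= d)%N -> fil d a.
Proof.
move=> [N NP] rd.
have hE e : hilb X e = deg p -> setT `<=` (fil e : set A).
  rewrite hilbE deg_kdim => E; apply: (kdim_sub_eq fA) => //.
    exact: fil_subspace.
  by rewrite E.
apply: hE => //.
(* [N] shows that the set is nonempty, so that [reg_index] is not the default value of [least]. *)
apply: (@leastP [set m | forall i, (m <= i)%N -> hilb X i = deg p] N) => // i Ni.
rewrite hilbE deg_kdim; congr kdim; apply/seteqP; split=> // b _.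
exact: NP.
Qed.

End Dimensions.

(** * Socles of the local rings *)

Section Socle.
Variables (K : fieldType) (n : nat) (X : aff_scheme K n).
Local Notation P := {mpoly K[n.+1]}.
Local Notation A := (aff X).
Local Notation R := (coord_ring X).
Implicit Types (a b t x y : A).
Variable sigma : hquot X -> hquot X.
Hypothesis sigma_tr : trace_map sigma.
Local Notation tau := (tau sigma).
Let fA : findim A := aff_findim sigma_tr.
Let tl := tau_linear sigma_tr.
Variables (s : nat) (p : 'I_s -> supp X).
Hypothesis p_bij : bijective p.
Local Notation pi j := (to_local (p j)).
Local Notation O j := (local_ring (p j)).

Definition soc (j : 'I_s) : set A := [set a | supported p j a /\ socle (O j) (pi j a)].

Lemma soc_kill j a b : soc j a -> max_ideal (O j) (pi j b) -> b * a = 0.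
Proof.
move=> [sa ka] mb; apply: (@supported_inj _ _ _ _ _ p_bij j).
- by rewrite mulrC; apply: supportedM.
- by move=> k _; rewrite rmorph0.
- by rewrite rmorph0 rmorphM; apply: ka.
Qed.

Lemma socM j a b : soc j a -> soc j (b * a).
Proof.
move=> [sa ka]; split=> [|c mc]; first by rewrite mulrC; apply: supportedM.
by rewrite rmorphM mulrCA ka // mulr0.
Qed.

(* Double annihilator: a functional tau(g _) vanishing on tA has g t = 0, hence
   kills the annihilator of the maximal ideal at p j. *)
Lemma soc_gen j t x : soc j t -> t != 0 -> soc j x -> exists b, x = b * t.
Proof.
move=> St t0 Sx; apply: contrapT => nx.
pose U : set A := [set y | exists b, y = b * t].
have sU : subspace U.
  split=> [|k _ _ [b ->] [c ->]]; first by exists 0; rewrite mul0r.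
  by exists (k *: b + c); rewrite mulrDl -aff_scaleAl.
have [g [gU gx]] := tau_separate sigma_tr sU nx.
have gt : g * t = 0.
  by apply: (tau_nondegenerate sigma_tr) => a; rewrite -mulrA; apply: gU; exists a;
    rewrite mulrC.
apply: gx; have [[w gw]|mg] := local_nonunit (pi j g); last first.
  by rewrite (soc_kill Sx mg) (linear_f0 tl).
case/eqP: t0; apply: (@supported_inj _ _ _ _ _ p_bij j); first exact: St.1.
  by move=> k _; rewrite rmorph0.
by rewrite rmorph0 -[LHS]mul1r -gw mulrAC -rmorphM gt rmorph0 mul0r.
Qed.

(** Among the nonzero multiples y of [a] supported at one point, take one with yA of smallest
    dimension. If c in the maximal ideal does not kill y, then c y generates the same ideal, so y =
    c d y for some d, and y = 0 because 1 - c d is a unit there. *)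
Lemma soc_ex a : a != 0 -> exists j t b, [/\ t != 0, soc j t & t = a * b].
Proof.
move=> a0; have [j aj] : exists j, pi j a <> 0.
  apply: contrapT => na; case/eqP: a0; apply: (joint_inj p_bij) => j.
  by rewrite rmorph0; apply: contrapT => aj; apply: na; exists j.
have [e [e1 e0]] := idempotents fA p_bij j.
have sae b : supported p j (a * e * b).
  by move=> k kj; rewrite !rmorphM /= e0 // mulr0 mul0r.
pose I y : set A := [set z | exists c, z = y * c].
have sI y : subspace (I y).
  split=> [|k _ _ [u ->] [v ->]]; first by exists 0; rewrite mulr0.
  by exists (k *: u + v); rewrite mulrDr -aff_scaleAr.
pose Q m := `[< exists b, a * e * b <> 0 /\ kdim (I (a * e * b)) [set 0] = m >].
have exQ : exists m, Q m.
  exists (kdim (I (a * e * 1)) [set 0]); apply/asboolP; exists 1; split=> //.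
  by rewrite mulr1 => /(congr1 (pi j)); rewrite rmorphM /= e1 mulr1 rmorph0.
case: (ex_minnP exQ) => m /asboolP[b [y0 ym]] mmin; set y := a * e * b in y0 ym.
exists j, y, (e * b); split; [exact/eqP| |by rewrite mulrA].
have kill c : max_ideal (O j) (pi j c) -> c * y = 0.
  move=> mc; apply: contrapT => cy.
  have Ecy : c * y = a * e * (c * b) by rewrite /y mulrCA.
  have sub : I (c * y) `<=` I y by move=> _ [d ->]; exists (c * d);
    rewrite [c * y]mulrC mulrA.
  have [||d Ed] := kdim_sub_eq fA (sI (c * y)) (sI y) sub _ (_ : I y y).
  - rewrite ym; apply: mmin; apply/asboolP; exists (c * b); split; first by rewrite -Ecy.
    by rewrite -Ecy.
  - by exists 1; rewrite mulr1.
  have [w cw] := local_unit_sub (@max_idealM _ _ _ _ _ (pi j d) mc).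
  case: y0; apply: (@supported_inj _ _ _ _ _ p_bij j); first exact: sae.
    by move=> k _; rewrite rmorph0.
  rewrite rmorph0 -[LHS]mul1r -cw mulrAC mulrBl mul1r -!rmorphM.
  have -> : c * d * y = y by rewrite mulrAC -Ed.
  by rewrite subrr mul0r.
split; first exact: sae.
move=> z mz; have [c Ec] := to_local_onto fA z.
by rewrite -Ec -rmorphM kill ?rmorph0 // Ec.
Qed.

(** The socle element found inside the ideal of the idempotent at p_j can only be supported at
    p_j. *)
Lemma soc_nonzero j : exists t, t != 0 /\ soc j t.
Proof.
have [e [e1 e0]] := idempotents fA p_bij j.
have [|k [t [b [t0 St Et]]]] := @soc_ex e.
  apply/eqP => E0; have /eqP := oner_neq0 (O j); case.
  by rewrite -e1 E0 rmorph0.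
suff jk : j = k by exists t; rewrite jk; split; [exact: t0 | exact: St].
apply: contrapT => jk; case/eqP: t0.
apply: (@supported_inj _ _ _ _ _ p_bij k); first exact: St.1.
  by move=> l _; rewrite rmorph0.
rewrite Et rmorphM /= e0 ?mul0r ?rmorph0 //; apply/eqP => kj; exact: jk.
Qed.

(** This shows that the number does not depend on [t] and [e]: the products e_k t span the socle
    over K, since the socle is generated by t and killed by the maximal ideal. *)
Lemma mu_soc j (t : O j) (e : 'I_(residue_dim (p j)) -> O j) i :
  t != 0 -> socle (O j) t -> basis_mod [set: O j] (max_ideal (O j)) e ->
  (\max_k mu (e k * t)%R <= i)%N <-> soc j `<=` fil i.
Proof.
move=> t0 socle_t [_ eB].
have [u su ut] := supported_ex fA p_bij t.
have Su : soc j u by split=> //; rewrite ut.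
have u0 : u != 0 by apply: contraNneq t0 => u0; rewrite -ut u0 rmorph0.
pose b k := sval (cid (to_local_onto fA (e k))).
have bP k : pi j (b k) = e k := svalP (cid (to_local_onto fA (e k))).
have muk k : mu (e k * t) = least (fun i => fil i (b k * u)).
  rewrite -bP -ut -rmorphM; apply: (muE p_bij).
  by rewrite mulrC; apply: supportedM.
split=> [/bigmax_leqP mui x Sx|Si]; last first.
  apply/bigmax_leqP => k _; rewrite muk; apply: least_le.
  by apply: Si; apply: socM.
have [c ->] := soc_gen Su u0 Sx.
have [r [mr _]] := eB (pi j c) I.
have -> : c * u = \sum_k r 0 k *: (b k * u).
  have -> : \sum_k r 0 k *: (b k * u) = (\sum_k r 0 k *: b k) * u.
    by rewrite mulr_suml; apply: eq_bigr => k _; rewrite aff_scaleAl.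
  apply/subr0_eq; rewrite -mulrBl; apply: (soc_kill Su).
  rewrite rmorphB /= (linear_sum (@to_local_linear _ _ _ (p j))).
  by under eq_bigr => k _ do rewrite bP.
apply: (subspace_sum (fil_subspace X i)) => k _; apply: (subspaceZ (fil_subspace X i)).
apply: (fil_le (mui k isT)); rewrite muk.
have [N NP] := filP (b k * u).
apply: (@leastP (fun i => fil i (b k * u)) N); exact: NP.
Qed.

End Socle.

Lemma bijective_inj_surj (T : Type) (U : Type) (f : T -> U) :
  injective f -> (forall u, exists t, f t = u) -> bijective f.
Proof.
by move=> fI /choice[g gP]; exists g => // t; apply: fI; rewrite gP.
Qed.

Lemma unit_mul_swap (B : comPzRingType) (u w f g : B) :
  u * w = 1 -> f * g = w * g * (u * f).
Proof. by move=> uw; rewrite -[LHS]mul1r -uw; ring. Qed.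

Lemma unit_mul_eq0 (B : comPzRingType) (u w v : B) : u * w = 1 -> u * v = 0 -> v = 0.
Proof. by move=> uw uv; rewrite -[v]mul1r -uw mulrAC uv mul0r. Qed.

(** * The maximal subscheme of a socle element *)

Section Subscheme.
Variables (K : fieldType) (n : nat) (X : aff_scheme K n).
Local Notation P := {mpoly K[n.+1]}.
Local Notation A := (aff X).
Implicit Types (F G H U : P) (a b t x y : A).
Hypothesis fA : findim A.
Variables (s : nat) (p : 'I_s -> supp X).
Hypothesis p_bij : bijective p.
Local Notation pi j := (to_local (p j)).
Local Notation O j := (local_ring (p j)).
Variables (j : 'I_s) (t : A).
Hypotheses (St : soc p j t) (t0 : t != 0).

(** Cuts out the closed subscheme of X whose affine ring is A/tA; asking for each component
    separately makes the ideal homogeneous. *)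
Definition sub_car F := forall d, exists b : A, affc (hc d F) = b * t.

Lemma sub_homogP d F : F \is d.-homog -> sub_car F <-> exists b : A, affc F = b * t.
Proof.
move=> hF; split=> [/(_ d)|Fb e]; first by rewrite (hcE _ hF) eqxx.
by rewrite (hcE _ hF); case: eqP => // _; exists 0; rewrite rmorph0 mul0r.
Qed.

Definition sub_ideal : ideal P.
Proof.
exists sub_car.
- by move=> d; exists 0; rewrite pihomog0 rmorph0 mul0r.
- move=> F G Fs Gs d; have [b Eb] := Fs d; have [c Ec] := Gs d; exists (b + c).
  by rewrite pihomogD rmorphD /= Eb Ec mulrDl.
- move=> G F Fs d; have [b bP] := choice Fs.
  exists (\sum_(i < d.+1) affc (hc i G) * b (d - i)%N).
  rewrite hcM rmorph_sum mulr_suml; apply: eq_bigr => i _.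
  by rewrite rmorphM /= bP mulrA.
Defined.

Definition sub_scheme : proj_scheme K n.
Proof.
exists sub_ideal.
- move=> F d Fs; apply/(sub_homogP (hc_homog d F)); exact: Fs.
(* Multiplication by X_0^N shifts the degree and leaves the class in A unchanged, so the ideal is
   saturated. *)
- move=> F [N NF] d; have [b Eb] := NF _ (homogX0 K n N) (N + d)%N.
  exists b; rewrite -Eb mulrC (hcMr _ _ (homogX0 K n N)) leq_addr addKn mulrC.
  by rewrite affc_X0M.
Defined.

Lemma sub_sub F : X F -> sub_scheme F.
Proof. by move=> XF d; exists 0; rewrite mul0r; apply/affcX/sch_homog. Qed.

Lemma sub_schemeP d F : F \is d.-homog -> sub_scheme F <-> exists b : A, affc F = b * t.
Proof. exact: sub_homogP. Qed.

Local Notation smap k := (@stalk_map _ _ X sub_scheme (p k)).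

Lemma smap_linear k : linear (smap k).
Proof. exact: stalk_map_linear sub_sub. Qed.

Lemma smap_onto k (w : stalk sub_scheme (p k)) : exists z, smap k z = w.
Proof.
have [d [F [G [hF hG xG ->]]]] := stalkP w.
by exists (stfrac X (p k) F G); rewrite (stalk_mapE sub_sub hF hG xG).
Qed.

(** A fraction F/G vanishes on the subscheme if the class of U F lies in tA for some U outside p_k.
    The germ of U is a unit, so F/G is itself a multiple of the germ of t. *)
Lemma smap_eq0 k (z : O k) : smap k z = 0 <-> exists b : A, z = pi k (b * t).
Proof.
have [d [F [G [hF hG xG ->]]]] := stalkP (z : stalk X (p k)).
have hX0 N : ('X_ord0 ^+ N : P) \is N.-homog := homogX0 K n N.
have xX0 N : ~ p k ('X_ord0 ^+ N) := @point_X0n K n X (p k) N.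
rewrite (stalk_mapE sub_sub hF hG xG); split=> [|[b Eb]].
  case/(stfrac_eq0 sub_scheme hF hG xG) => m [U [hU xU]].
  case/(sub_schemeP (dhomogM hU hF)) => b; rewrite rmorphM => /(congr1 (pi k)).
  rewrite rmorphM /= => Eb.
  have [[w Uw]|] := local_nonunit (pi k (affc U)); last by move/(to_local_max _ hU).
  have [v Ev] := to_local_onto fA (w * stfrac X (p k) ('X_ord0 ^+ d) G : O k).
  exists (v * b); rewrite -mulrA rmorphM /= -Eb Ev.
  transitivity (pi k (affc F) * stfrac X (p k) ('X_ord0 ^+ d) G : O k).
    rewrite (to_localE _ hF) -[RHS]/(stfrac X (p k) F _ * stfrac X (p k) _ G).
    rewrite (stfracM X hF (hX0 d) (xX0 d) (hX0 d) hG xG).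
    apply/(stfrac_eq X hF hG xG (dhomogM hF (hX0 d)) (dhomogM (hX0 d) hG) (ptM (xX0 d) xG)).
    exists 0%N, 1; split; [exact: homog1|exact: point1|].
    by rewrite mulrA subrr mulr0; apply: ideal0.
  exact: unit_mul_swap Uw.
have [N /(_ N (leqnn _)) [H hH EH]] := filP (b * t).
apply/(stfrac_eq0 sub_scheme hF hG xG).
have : stfrac X (p k) F G = stfrac X (p k) H ('X_ord0 ^+ N).
  by rewrite -(to_localE _ hH) -EH -Eb.
case/(stfrac_eq X hF hG xG hH (hX0 N) (xX0 N)) => m [U [hU xU XU]].
exists (m + N)%N, (U * 'X_ord0 ^+ N); split; [exact: dhomogM|exact: ptM|].
have hUF : U * 'X_ord0 ^+ N * F \is (m + N + d).-homog by apply/dhomogM/hF/dhomogM.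
apply/(sub_schemeP hUF); exists (affc (U * G) * b).
rewrite -[_ * b * t]mulrA EH -rmorphM; apply/subr0_eq; rewrite -rmorphB; apply: affcX.
have -> : U * 'X_ord0 ^+ N * F - U * G * H = U * (F * 'X_ord0 ^+ N - H * G) by ring.
exact: XU.
Qed.

Let fO k : findim (stalk X (p k)).
Proof.
apply: (findim_onto (@to_local_linear _ _ _ (p k)) _ fA).
exact: to_local_onto fA.
Qed.

Let pi_t_neq0 : pi j t <> 0.
Proof.
move=> pt0; case/eqP: t0.
apply: (supported_inj p_bij St.1 (supported_subspace p j).1).
by rewrite pt0 rmorph0.
Qed.

(** Away from p_j the germ of t is 0 and the stalks do not change. At p_j the kernel is generated by
    this germ and has the dimension of the residue field, because the annihilator of a nonzero socle
    element is the maximal ideal. *)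
Lemma sub_max_pj : max_pj_subscheme p j sub_scheme.
Proof.
split.
  split; [exact: sub_sub| |exact: smap_onto].
  move=> k kj; apply: bijective_inj_surj; last exact: smap_onto.
  move=> z w /eqP; rewrite -subr_eq0 -(linear_fB (@smap_linear k)) => /eqP.
  case/smap_eq0 => b; rewrite rmorphM /= (St.1 k kj) mulr0; exact: subr0_eq.
rewrite /deg_sub /deg /deg_sub (bigD1 j) //= [RHS](bigD1 j) //= addnAC; congr (_ + _)%N.
  pose I : set (stalk X (p j)) := [set z | exists b : A, z = pi j (b * t)].
  have sI : subspace I.
    split=> [|k _ _ [b ->] [c ->]]; first by exists 0; rewrite mul0r rmorph0.
    by exists (k *: b + c); rewrite mulrDl -aff_scaleAl -(@to_local_linear _ _ _ (p j)).
  have s0 := subspace0 (stalk X (p j)).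
  rewrite (@kdimD _ _ (fO j) [set 0] I) //; last by move=> _ ->; apply: sI.1.
  congr (_ + _)%N.
    symmetry; apply: (kdim_iso (@smap_linear j)) => //.
    - exact: subspace0.
    - by move=> z _; apply: smap_eq0.
    - by move=> v _; have [z <-] := smap_onto v; exists z; rewrite //= subrr.
  pose f (z : O j) : stalk X (p j) := z * pi j t.
  have lf : linear f.
    move=> k z w; rewrite /f mulrDl; congr (_ + _).
    by rewrite -[k *: z]/(stalk_scalar X (p j) k * z) -mulrA.
  apply: (kdim_iso lf) => //.
  - by move=> z _; have [b <-] := to_local_onto fA z; exists b; rewrite rmorphM.
  - move=> z _; split=> [zt0 [w zw]|mz]; last exact: St.2.
    have pt0 : pi j t = 0 := unit_mul_eq0 zw zt0.
    exact: pi_t_neq0 pt0.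
  - move=> _ [b ->]; exists (pi j b) => //=.
    by rewrite rmorphM subrr.
apply: eq_bigr => k kj; symmetry.
apply: (@kdim_iso _ _ _ (smap k) setT [set 0] setT [set 0] (@smap_linear k)).
- exact: subspaceT.
- exact: subspace0.
- by [].
- move=> z _; split=> [/smap_eq0[b ->]|->]; last exact: linear_f0 (@smap_linear k).
  by rewrite rmorphM /= (St.1 k kj) mulr0.
- by move=> v _; have [z <-] := smap_onto v; exists z; rewrite //= subrr.
Qed.

Lemma sub_is_mu : exists m, is_mu_sub p j sub_scheme m.
Proof.
have [|||e eB] := @kdim_basis _ _ (fO j) setT (max_ideal (O j)).
- exact: subspaceT.
- split=> [[w]|k z w mz mw]; first by rewrite mul0r => /esym/eqP; rewrite oner_eq0.
  apply: max_idealD => //.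
  by rewrite -[k *: z]/(stalk_scalar X (p j) k * z) mulrC; apply: max_idealM.
- by [].
eexists; exists (pi j t), e; split=> [|z|//|]; last by [].
  split; last exact: St.2.
  by apply/eqP => /pi_t_neq0.
split=> [/smap_eq0[b ->]|[b ->]]; first by exists (pi j b); rewrite rmorphM.
by apply/smap_eq0; have [c <-] := to_local_onto fA b; exists c; rewrite rmorphM.
Qed.

End Subscheme.

(** * Translation back to schemes *)

Section Main.
Variables (K : fieldType) (n : nat) (X : aff_scheme K n).
Local Notation A := (aff X).
Variable sigma : hquot X -> hquot X.
Hypothesis sigma_tr : trace_map sigma.
Variables (s : nat) (p : 'I_s -> supp X).
Hypothesis p_bij : bijective p.
Let fA : findim A := aff_findim sigma_tr.
Local Notation r := (reg_index p).

(** By [mu_soc] all maximal subschemes at p_j give the same number, and [sub_scheme] shows that the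
    minimum runs over a nonempty set. *)
Lemma pt_deg_soc j i : (pt_deg p j <= i)%N <-> soc p j `<=` fil i.
Proof.
have [t [t0 St]] := soc_nonzero sigma_tr p_bij j.
have [m mY] := sub_is_mu fA p_bij St t0.
have [Y _ [t' [e [[t'0 St'] _ eB ->]]]] :
  [set m | exists2 Y, max_pj_subscheme p j Y & is_mu_sub p j Y m] (pt_deg p j).
  by apply: (@leastP _ m); exists (sub_scheme t); [exact: sub_max_pj|].
exact: (mu_soc sigma_tr p_bij).
Qed.

Let fil_r d (a : A) : (r <= d)%N -> fil d a.
Proof. exact/fil_reg/(fil_full sigma_tr). Qed.

(** A nonzero ideal inside R_i contains a nonzero socle element, hence the whole socle at some p_j,
    and the degree of p_j is at most i. Conversely, the socle at p_j is a nonzero ideal inside the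
    component of R indexed by the degree of p_j. *)
Lemma cayley_bacharachP : cayley_bacharach p <-> no_ideal X r.
Proof.
split=> [CB i a ir ai|noI j].
  apply/eqP/negPn/negP => /(soc_ex sigma_tr p_bij)[j [t [b [t0 St Et]]]].
  have : (pt_deg p j <= i)%N.
    apply/pt_deg_soc => x /(soc_gen sigma_tr p_bij St t0)[c ->].
    by rewrite Et mulrC -mulrA; apply: ai.
  by rewrite CB leqNgt ir.
apply/eqP; rewrite eqn_leq; apply/andP; split.
  by apply/pt_deg_soc => x _; apply: fil_r.
rewrite leqNgt; apply/negP => lt_r.
have [t [/eqP t0 St]] := soc_nonzero sigma_tr p_bij j; apply: t0.
apply: (noI _ _ lt_r) => x; have /pt_deg_soc := leqnn (pt_deg p j); apply.
by rewrite mulrC; apply: socM.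
Qed.

Lemma coord_geP m f : coord_ge X m f <-> forall d, (d < m)%N -> (polyR f)`_d = 0.
Proof.
split=> [[N [g [gP ->]]] d dm|f0].
  rewrite rmorph_sum coef_sum big_nat_cond big1 // => i /andP[/andP[mi _] _] /=.
  have [a _ ->] := (gr_coordP _ _).1 (gP i).
  by rewrite coefZ coefXn ltn_eqF ?mulr0 //; apply: leq_trans mi.
have ex i : exists g, polyR g = (polyR f)`_i *: 'X^i.
  apply: polyR_onto => e; rewrite coefZ coefXn; case: eqP => [->|_].
    by rewrite mulr1; apply: polyR_fil.
  by rewrite mulr0; apply: (fil_subspace X _).1.
have [g gP] := choice ex; exists (size (polyR f)), g; split.
  by move=> i; apply/gr_coordP; exists (polyR f)`_i => //; apply: polyR_fil.
apply: polyR_inj; rewrite rmorph_sum big_geq_mkord big_mkcond /=.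
rewrite -[LHS]coefK poly_def; apply: eq_bigr => i _; rewrite gP.
by case: leqP => // /f0->; rewrite scale0r.
Qed.

Lemma minimal_differentP : minimal_different p sigma <-> diff_is_minimal sigma r.
Proof.
have E f : coord_ge X (2 * r) f <-> forall d, (d < r + r)%N -> (polyR f)`_d = 0.
  by rewrite addnn -mul2n; apply: coord_geP.
split=> [H z|H].
  have -> : different sigma z = ((@inj_hquot _ _ X) @` @coord_ge _ _ X (2 * r)) z.
    by rewrite -H.
  by split=> [[f /E f0 <-]|[f /E f0 ->]]; exists f.
apply/seteqP; split=> z.
  by move=> /H[f /E f0 ->]; exists f.
by case=> f /E f0 <-; apply/H; exists f.
Qed.

Lemma conductor_traceP :
  conductor p = itilde p @` trace_compl sigma <->
  forall q : {poly A}, cond q <-> exists2 f, trace_compl sigma f & polyR f = q.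
Proof.
have cP q : conductor p (theta p q) <-> cond q.
  rewrite (conductorP fA p_bij); split=> [[q' cq' /(theta_inj p_bij)->] //|cq].
  by exists q.
have tP q : (itilde p @` trace_compl sigma) (theta p q) <->
    exists2 f, trace_compl sigma f & polyR f = q.
  split=> -[f fT]; first by rewrite itildeE => /(theta_inj p_bij) Ef; exists f.
  by move=> <-; exists f; rewrite ?itildeE.
split=> [H q|H]; first by rewrite -cP -tP H.
apply/seteqP; split=> F; have [q <-] := theta_onto fA p_bij F.
  by move=> /cP/H/tP.
by move=> /tP/H/cP.
Qed.

Lemma trace_conductor_minimal :
  (cayley_bacharach p -> conductor p `<=` itilde p @` trace_compl sigma) /\
  ((cayley_bacharach p /\ conductor p = itilde p @` trace_compl sigma) <->
     minimal_different p sigma).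
Proof.
split=> [/cayley_bacharachP noI F|].
  case/(conductorP fA p_bij) => q /(cond_trace sigma_tr fil_r noI)[f fT Ef] ->.
  by exists f => //; rewrite itildeE Ef.
rewrite minimal_differentP -(minimalP sigma_tr fil_r).
by rewrite cayley_bacharachP conductor_traceP.
Qed.

End Main.

Theorem proposition6p3 (K : fieldType) (n : nat) (X : proj_scheme K n)
    (X_dim : zero_dim X) (X_gor : locally_gorenstein X)
    (X_hyp : forall x : supp X, ~ x 'X_ord0)
    (s : nat) (p : 'I_s -> supp X) (p_bij : bijective p)
    (sigma : hquot X -> hquot X) (sigma_tr : trace_map sigma) :
  (cayley_bacharach p ->
     conductor p `<=` itilde p @` trace_compl sigma) /\
  ((cayley_bacharach p /\ conductor p = itilde p @` trace_compl sigma) <->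
     minimal_different p sigma).
Proof.
exact: (@trace_conductor_minimal K n (AffScheme X_dim X_hyp) sigma sigma_tr s p p_bij).
Qed.
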